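(* Let $0<a<1$. There is a positive constant $K=K(a)$, depending only on $a$, such that the following holds. Let $(\lambda_n)_{n\ge 1}$ be a sequence of real numbers with $a\le \lambda_n<1$ for all $n$ and $\lambda_n\lambda_{n-1}\cdots\lambda_1\to 0$ as $n\to\infty$, let $f_n$, $n\in\mathbb{N}$, be centred inner functions with $|f_n'(0)|\le\lambda_n$, and put $F_n=f_n\circ\cdots\circ f_1$. Then, with $\delta=\bigl(6(1/a+1)\bigr)^{-1}$, for every $n\ge 1$, $$\left|\frac{|A\cap F_n^{-1}(E)|}{|E|}-\frac{|A|}{2\pi}\right|\le K(\lambda_n\cdots\lambda_1)^{\delta},$$ for all arcs $A\subset\partial\mathbb{D}$ and all measurable sets $E\subset\partial\mathbb{D}$ with $|E|>0$.
   Context: $\mathbb{D}=\{z\in\mathbb{C}:|z|<1\}$ is the unit disc. An inner function is a function analytic in $\mathbb{D}$, mapping $\mathbb{D}$ into its closure, with non-tangential boundary values of modulus $1$ almost everywhere on $\partial\mathbb{D}$. It is centred if it fixes $0$. The non-tangential boundary values of an inner function $f$ (defined almost everywhere on $\partial\mathbb{D}$) are denoted by the same letter $f$; $F_n^{-1}(E)$ for $E\subset\partial\mathbb{D}$ is the preimage under the boundary map of the inner function $F_n$ (defined up to a null set). $|E|$ denotes the one-dimensional Lebesgue measure (arc length) of $E\subset\partial\mathbb{D}$, so $|\partial\mathbb{D}|=2\pi$. *)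

(* Defs.v *)
(* MathComp-Analysis over an arbitrary realType R, with the complex field R[i]
   of mathcomp-real-closed. *)
From HB Require Import structures.
From mathcomp Require Import all_boot all_order all_algebra.
From mathcomp Require Import complex.
From mathcomp Require Import all_classical all_reals all_analysis.

Set Implicit Arguments.
Unset Strict Implicit.
Unset Printing Implicit Defensive.
Import Order.TTheory GRing.Theory Num.Theory.
Import numFieldNormedType.Exports.

Local Open Scope classical_set_scope.
Local Open Scope ring_scope.
Local Open Scope complex_scope.

(* R[i] is made a normed module over itself, so that derivable f z 1 and
   derive1 f z are complex differentiability and the complex derivative. The
   norm `|z| takes its values in R[i]: x <= y there means that y - x is a
   nonnegative real. *)
HB.instance Definition _ (R : realType) := GRing.ComAlgebra.copy R[i] R[i]^o.
HB.instance Definition _ (R : realType) := Vector.copy R[i] R[i]^o.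
HB.instance Definition _ (R : realType) := NormedModule.copy R[i] R[i]^o.

Definition unit_disc (R : realType) : set R[i] := [set z | `|z| < 1].

Definition unit_circle (R : realType) : set R[i] := [set z | `|z| = 1].

Definition cis (R : realType) (t : R) : R[i] := cos t +i* sin t.

(* Nontangential approach region at w, of aperture M; empty when M <= 1. *)
Definition stolz (R : realType) (M : R) (w : R[i]) : set R[i] :=
  [set z | unit_disc z /\ `|z - w| < M%:C * (1 - `|z|)].

Definition nontangential_limit (R : realType) (f : R[i] -> R[i])
    (w l : R[i]) : Prop :=
  forall M : R, f @ within (stolz M w) (nbhs w) --> l.

(* Analytic functions on the disc are represented by total functions whose
   values outside the disc are irrelevant. *)
Definition inner_function (R : realType) (f : R[i] -> R[i]) : Prop :=
  [/\ forall z, unit_disc z -> derivable f z 1,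
      forall z, unit_disc z -> `|f z| <= 1
    & {ae lebesgue_measure, forall t : R,
         exists2 l, unit_circle l & nontangential_limit f (cis t) l}].

Definition centred_inner (R : realType) (f : R[i] -> R[i]) : Prop :=
  inner_function f /\ f 0 = 0.

Fixpoint iter_comp (T : Type) (f : nat -> T -> T) (n : nat) : T -> T :=
  if n is m.+1 then f m.+1 \o iter_comp f m else id.

(* The preimage of E under the boundary map of f; boundary points at which f
   has no nontangential limit are left out. *)
Definition boundary_preimage (R : realType) (f : R[i] -> R[i])
    (E : set R[i]) : set R[i] :=
  [set w | unit_circle w /\ exists2 l, E l & nontangential_limit f w l].

Definition angles (R : realType) (E : set R[i]) : set R :=
  `[0, 2 * pi[%classic `&` @cis R @^-1` E.

(* Lebesgue measurability of sets of angles: the sigma-algebra is that of the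
   Caratheodory-measurable sets, the domain of completed_lebesgue_measure. *)
Definition arc_measurable (R : realType) (E : set R[i]) : Prop :=
  (wlength (@idfun R))^*%mu.-cara.-measurable (angles E).

(* The measure is at most 2 * pi, so that fine loses nothing. *)
Definition arc_length (R : realType) (E : set R[i]) : R :=
  fine (completed_lebesgue_measure (angles E)).

(* Degenerate arcs (empty, one point) and the whole circle are included. *)
Definition circle_arc (R : realType) (A : set R[i]) : Prop :=
  exists2 I : set R, is_interval I & A = @cis R @` I.

(* Main.v *)
(* Let w(z, W) be the harmonic measure at z of a set W of the unit circle. Every
   holomorphic self-map F of the disc satisfies w(z, F^-1(W)) <= w(F(z), W).
   For a centred inner f with |f'(0)| <= lam, the Schwarz lemma sharpened by
   Harnack's inequality bounds |f(z)| / (1 - |f(z)|) by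
   2 / (3 - lam) * |z| / (1 - |z|), and 2 / (3 - lam) <= lam^(3 delta). Put
   q = (lam_n ... lam_1)^delta; on the circle |z| = 1 - q^2 it follows that
   |F_n| <= q, so that there w(z, F_n^-1(E)) is at most (1 + O(q)) |E| / (2 pi).
   Averaging this over a q-neighbourhood of the arc A, of length |A| + O(q),
   bounds |A /\ F_n^-1(E)| from above, since Poisson smoothing at that radius
   carries only a mass O(q) farther than q. The same bound for the complement of
   A and |F_n^-1(E)| >= |E| give the bound from below. The inequality between
   harmonic measures and the Lebesgue density theorem also show that F_n has
   unimodular nontangential limits almost everywhere. *)
Require Import Defs.
From mathcomp Require Import all_boot all_order all_algebra.
From mathcomp Require Import complex.
From mathcomp Require Import all_classical all_reals all_analysis.
From mathcomp Require Import measurable_realfun.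
From mathcomp Require Import ring lra.
Set Implicit Arguments.
Unset Strict Implicit.
Unset Printing Implicit Defensive.
Import Order.TTheory GRing.Theory Num.Theory.
Import numFieldNormedType.Exports.
Local Open Scope classical_set_scope.
Local Open Scope ring_scope.
Local Open Scope complex_scope.

(** * The modulus and limits in the complex plane *)

(** The exponents come from a balance. Smoothing at height [rho] below the circle carries a mass
    [O(rho / s)] farther than [s], enlarging an arc by [s] costs [O(s)], and on the circle of radius
    [1 - rho] the odds of [F_n] are at most [L / rho], where [L = (lam_n ... lam_1)^(3 delta)]. The
    three errors are of the same size [q] when [s = q], [rho = q^2] and [L = q^3]; this is why the
    contraction factor is compared with the power [3 delta]. Preimages are not measured directly.
    Each is enclosed in a Borel set [V] satisfying the inequality between harmonic measures, so that
    only upper bounds arise, and lower bounds come from complements. Since [boundary_preimage]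
    refers to the limits of the composite itself, these limits must be constructed, and the same
    inequality does it because it passes through compositions. Every contour used is a circle about
    [0], so Cauchy's theorem is proved for [h(u) du / u] on polar rectangles, an annulus being a
    rectangle with two sides identified. *)

Section ComplexPlane.
Variable R : realType.
Implicit Types (z u w : R[i]) (s t : R).

(** The norm of [R[i]] takes its values in [R[i]]; its real part lets all estimates take place in
    the ordered field [R]. *)
Definition cnorm z : R := complex.Re `|z|.

Lemma norm_cnormE z : `|z| = (cnorm z)%:C.
Proof. by rewrite /cnorm normc_def. Qed.

Lemma cnorm_sqrt z : cnorm z = Num.sqrt (complex.Re z ^+ 2 + complex.Im z ^+ 2).
Proof. by rewrite /cnorm normc_def. Qed.

Lemma cnorm_ge0 z : 0 <= cnorm z.
Proof. by rewrite cnorm_sqrt sqrtr_ge0. Qed.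

Lemma sqr_cnorm z : cnorm z ^+ 2 = complex.Re z ^+ 2 + complex.Im z ^+ 2.
Proof. by rewrite cnorm_sqrt sqr_sqrtr// addr_ge0// sqr_ge0. Qed.

Lemma cnormM z w : cnorm (z * w) = cnorm z * cnorm w.
Proof. by apply: (@complexI R); rewrite -norm_cnormE normrM !norm_cnormE rmorphM. Qed.

Lemma ler_cnormD z w : cnorm (z + w) <= cnorm z + cnorm w.
Proof. by rewrite -lecR rmorphD/= -!norm_cnormE; exact: ler_normD. Qed.

Lemma cnormN z : cnorm (- z) = cnorm z.
Proof. by rewrite /cnorm normrN. Qed.

Lemma cnorm_distC z w : cnorm (z - w) = cnorm (w - z).
Proof. by rewrite -cnormN opprB. Qed.

Lemma ler_cnormB z w : cnorm (z - w) <= cnorm z + cnorm w.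
Proof. by rewrite -(cnormN w); exact: ler_cnormD. Qed.

Lemma ler_cnorm_sub z w : cnorm z - cnorm w <= cnorm (z - w).
Proof. by rewrite lerBlDr (le_trans _ (ler_cnormD _ _))// subrK. Qed.

Lemma ler_norm_cnormB z u : `|cnorm z - cnorm u| <= cnorm (u - z).
Proof.
rewrite ler_norml lerNl opprB ler_cnorm_sub/= cnorm_distC; exact: ler_cnorm_sub.
Qed.

Lemma ler_cnorm_dist z u w : cnorm (z - w) <= cnorm (z - u) + cnorm (u - w).
Proof. by rewrite (le_trans _ (ler_cnormD _ _))// addrA subrK. Qed.

Lemma cnorm_real (x : R) : cnorm x%:C = `|x|.
Proof. by rewrite cnorm_sqrt/= expr0n addr0 sqrtr_sqr. Qed.

Lemma cnorm0 : cnorm 0 = 0.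
Proof. by rewrite /cnorm normr0. Qed.

Lemma cnorm1 : cnorm 1 = 1.
Proof. by rewrite /cnorm normr1. Qed.

Lemma cnorm_eq0 z : (cnorm z == 0) = (z == 0).
Proof. by rewrite -(inj_eq (@complexI R)) -norm_cnormE normr_eq0. Qed.

Lemma cnorm_gt0 z : (0 < cnorm z) = (z != 0).
Proof. by rewrite lt_neqAle cnorm_ge0 andbT eq_sym cnorm_eq0. Qed.

Lemma cnormV z : cnorm z^-1 = (cnorm z)^-1.
Proof. by apply: (@complexI R); rewrite -norm_cnormE normfV norm_cnormE fmorphV. Qed.

Lemma cnorm_conj z : cnorm (conjc z) = cnorm z.
Proof. by rewrite !cnorm_sqrt; case: z => a b /=; rewrite sqrrN. Qed.

Lemma ler_Re_cnorm z : `|complex.Re z| <= cnorm z.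
Proof.
by rewrite cnorm_sqrt -sqrtr_sqr ler_wsqrtr// lerDl sqr_ge0.
Qed.

Lemma ler_Im_cnorm z : `|complex.Im z| <= cnorm z.
Proof.
by rewrite cnorm_sqrt -sqrtr_sqr ler_wsqrtr// lerDr sqr_ge0.
Qed.

Lemma ler_cnorm_ReIm z : cnorm z <= `|complex.Re z| + `|complex.Im z|.
Proof.
rewrite -(@ler_pXn2r _ 2)// ?nnegrE ?cnorm_ge0 ?addr_ge0// sqr_cnorm.
rewrite sqrrD !real_normK ?num_real// lerD2r lerDl.
by rewrite mulrn_wge0// mulr_ge0.
Qed.

Lemma conjcM_cnorm z : z * conjc z = (cnorm z ^+ 2)%:C.
Proof. by rewrite -sqr_normc norm_cnormE rmorphXn. Qed.

Lemma ReB z w : complex.Re (z - w) = complex.Re z - complex.Re w.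
Proof. by case: z w => [a b] [c d]. Qed.

Lemma ImB z w : complex.Im (z - w) = complex.Im z - complex.Im w.
Proof. by case: z w => [a b] [c d]. Qed.

Lemma ReD z w : complex.Re (z + w) = complex.Re z + complex.Re w.
Proof. by case: z w => [a b] [c d]. Qed.

Lemma ImD z w : complex.Im (z + w) = complex.Im z + complex.Im w.
Proof. by case: z w => [a b] [c d]. Qed.

Lemma ReM z w : complex.Re (z * w) = complex.Re z * complex.Re w - complex.Im z * complex.Im w.
Proof. by case: z w => [a b] [c d]. Qed.

Lemma ImM z w : complex.Im (z * w) = complex.Re z * complex.Im w + complex.Im z * complex.Re w.
Proof. by case: z w => [a b] [c d]. Qed.

Lemma cnorm_cis t : cnorm (cis t) = 1.
Proof. by rewrite cnorm_sqrt/= cos2Dsin2 sqrtr1. Qed.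

Lemma cisD s t : cis (s + t) = cis s * cis t.
Proof.
by apply/eqP; rewrite eq_complex /= cosD sinD eqxx/= addrC [cos s * _]mulrC [sin s * _]mulrC addrC
  [sin t * _]mulrC [cos t * _]mulrC addrC eqxx.
Qed.

Lemma cisD2pi t : cis (t + 2 * pi) = cis t.
Proof. by rewrite /cis mulrC -[pi * 2]/(pi * 2%:R) mulr_natr cosD2pi sinD2pi. Qed.

Lemma cnorm_real_cis (r : R) t : 0 <= r -> cnorm (r%:C * cis t) = r.
Proof. by move=> r0; rewrite cnormM cnorm_real cnorm_cis mulr1 ger0_norm. Qed.

Lemma nbhs_cnorm z (P : set R[i]) :
  nbhs z P <-> exists2 e : R, 0 < e & forall u, cnorm (u - z) < e -> P u.
Proof.
split.
  move=> /nbhs_ballP[e /= e0 eP].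
  (* A positive element of [R[i]] has zero imaginary part, so the radius is a real number. *)
  have eE : e = (complex.Re e)%:C by move: e0; rewrite ltcE /= => /andP[/eqP + _]; case: (e) => a b /= ->.
  exists (complex.Re e); first by rewrite -ltcR -eE.
  move=> u ue; apply: eP; rewrite -ball_normE /ball_ /= distrC norm_cnormE eE.
  by rewrite ltcR.
move=> [e e0 eP]; apply/nbhs_ballP; exists e%:C => /=; first by rewrite ltcR.
move=> u; rewrite -ball_normE /ball_ /= distrC norm_cnormE ltcR => /eP.
by [].
Qed.

Lemma cvg_cnormP {T : Type} (F : set_system T) {FF : Filter F} (f : T -> R[i]) z :
  f @ F --> z <-> forall e : R, 0 < e -> \forall x \near F, cnorm (f x - z) < e.
Proof.
split.
  move=> fz e e0; have ez : nbhs z [set u | cnorm (u - z) < e].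
    by apply/nbhs_cnorm; exists e.
  exact: fz ez.
move=> H P /nbhs_cnorm[e e0 eP].
by apply: filterS (H _ e0) => x; exact: eP.
Qed.

Lemma cvg_complex {T : Type} (F : set_system T) {FF : Filter F} (f : T -> R[i]) z :
  f @ F --> z <-> (complex.Re (f x) @[x --> F] --> complex.Re z /\
                   complex.Im (f x) @[x --> F] --> complex.Im z).
Proof.
split=> [/cvg_cnormP fz|[] /cvgrPdist_lt fR /cvgrPdist_lt fI].
  split; apply/cvgrPdist_lt => e e0; near=> x; rewrite distrC -?ReB -?ImB.
    by rewrite (le_lt_trans (ler_Re_cnorm _))//; near: x; exact: fz.
  by rewrite (le_lt_trans (ler_Im_cnorm _))//; near: x; exact: fz.
apply/cvg_cnormP => e e0; near=> x.
rewrite (le_lt_trans (ler_cnorm_ReIm _))// [e]splitr ltrD// ?ReB ?ImB distrC.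
  by near: x; apply: fR; rewrite divr_gt0.
by near: x; apply: fI; rewrite divr_gt0.
Unshelve. all: by end_near. Qed.

Lemma continuous_cis : continuous (@cis R).
Proof.
by move=> t; apply/cvg_complex; split; [exact: continuous_cos|exact: continuous_sin].
Qed.

Lemma continuous_real_complex : continuous (fun x : R => x%:C).
Proof. by move=> x; apply/cvg_complex; split; [exact: cvg_id|exact: cvg_cst]. Qed.

Lemma continuous_cnorm : continuous (cnorm : R[i] -> R).
Proof.
move=> z; have FF : Filter (nbhs z) by exact: nbhs_filter.
apply/(@cvgrPdist_lt _ _ _ (nbhs z) FF) => e e0; apply/nbhs_cnorm; exists e => // u.
exact/le_lt_trans/ler_norm_cnormB.
Qed.

End ComplexPlane.

(** * Complex differentiability *)

Section ComplexDifferentiability.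
Variable R : realType.
Implicit Types (z u w : R[i]) (f g : R[i] -> R[i]).

#[local] Instance nbhsC_filter z : Filter (nbhs z).
Proof. exact: nbhs_filter. Qed.

#[local] Instance nbhsC_pfilter z : ProperFilter (nbhs z).
Proof. exact: nbhs_pfilter. Qed.

Section Limits.
Context {T : Type} (F : set_system T) {FF : Filter F}.
Implicit Types (h k : T -> R[i]).

Lemma cvgcD h k z w : h @ F --> z -> k @ F --> w ->
  (fun x => h x + k x) @ F --> z + w.
Proof.
move=> /cvg_complex[hR hI] /cvg_complex[kR kI]; apply/cvg_complex.
by rewrite ReD ImD; split; under eq_fun do rewrite ?ReD ?ImD; exact: cvgD.
Qed.

Lemma cvgcM h k z w : h @ F --> z -> k @ F --> w ->
  (fun x => h x * k x) @ F --> z * w.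
Proof.
move=> /cvg_complex[hR hI] /cvg_complex[kR kI]; apply/cvg_complex.
rewrite ReM ImM; split; under eq_fun do rewrite ?ReM ?ImM.
  by apply: cvgB; exact: cvgM.
by apply: cvgD; exact: cvgM.
Qed.

Lemma cvgc_cst z : (fun=> z) @ F --> z.
Proof. by apply/cvg_complex; split; exact: cvg_cst. Qed.

Lemma cvgcN h z : h @ F --> z -> (fun x => - h x) @ F --> - z.
Proof.
move=> hz; have := cvgcM (@cvgc_cst (-1)) hz; rewrite mulN1r.
by under eq_fun do rewrite mulN1r.
Qed.

Lemma cvgcB h k z w : h @ F --> z -> k @ F --> w ->
  (fun x => h x - k x) @ F --> z - w.
Proof.
by move=> hz /cvgcN; exact: cvgcD.
Qed.

Lemma cvgcV h z : z != 0 -> h @ F --> z -> (fun x => (h x)^-1) @ F --> z^-1.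
Proof.
move=> z0 /cvg_complex[hR hI]; apply/cvg_complex.
have n0 : complex.Re z ^+ 2 + complex.Im z ^+ 2 != 0.
  by rewrite -sqr_cnorm expf_neq0// cnorm_eq0.
have VE u : u^-1 = (complex.Re u / (complex.Re u ^+ 2 + complex.Im u ^+ 2)) +i*
    (- (complex.Im u / (complex.Re u ^+ 2 + complex.Im u ^+ 2))) :> R[i].
  by case: u.
have ncvg : complex.Re (h x) ^+ 2 + complex.Im (h x) ^+ 2 @[x --> F] -->
    complex.Re z ^+ 2 + complex.Im z ^+ 2.
  by apply: cvgD; rewrite !expr2; apply: cvgM.
rewrite VE; split; under eq_fun do rewrite VE /=.
  by apply: cvgM => //; exact: cvgV.
by apply: cvgN; apply: cvgM => //; exact: cvgV.
Qed.

End Limits.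

(* Caratheodory's formulation of complex differentiability. *)
Definition cdiff f z :=
  exists2 g : R[i] -> R[i], {for z, continuous g} &
    forall u, f u - f z = g u * (u - z).

(** Away from [z] the difference quotient is a slope in any case, so a slope that is correct near
    [z] can be extended. *)
Lemma cdiff_local f g z (e : R) : 0 < e -> {for z, continuous g} ->
  (forall u, cnorm (u - z) < e -> f u - f z = g u * (u - z)) -> cdiff f z.
Proof.
move=> e0 gc gE.
exists (fun u => if u == z then g z else (f u - f z) / (u - z)); last first.
  move=> u; case: eqVneq => [->|uz]; first by rewrite !subrr mulr0.
  by rewrite divfK// subr_eq0.
rewrite /prop_for /continuous_at eqxx; apply/cvg_cnormP => d d0.
have /cvg_cnormP/(_ _ d0)/nbhs_cnorm[r r0 rP] := gc.
apply/nbhs_cnorm; exists (Num.min e r); first by rewrite lt_min e0.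
move=> u; rewrite lt_min => /andP[/gE uE /rP ur].
case: ifPn => [_|uz]; first by rewrite subrr cnorm0.
by rewrite uE mulfK// subr_eq0.
Qed.

Lemma cdiff_continuous f z : cdiff f z -> {for z, continuous f}.
Proof.
move=> [g gc gE].
have -> : f = (fun u => f z + g u * (u - z)).
  by apply/funext => u; rewrite -gE addrCA subrr addr0.
apply: cvgcD; first exact: cvgc_cst.
by apply: cvgcM; [exact: gc|apply: cvgcB; [exact: cvg_id|exact: cvgc_cst]].
Qed.

Lemma eq_near_cdiff f g z (e : R) : 0 < e ->
  (forall u, cnorm (u - z) < e -> f u = g u) -> cdiff f z -> cdiff g z.
Proof.
move=> e0 fg [h hc hE]; apply: (cdiff_local e0 hc) => u ue.
by rewrite -!fg ?subrr ?cnorm0.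
Qed.

Lemma cdiff_cst c z : cdiff (fun=> c) z.
Proof.
by exists (fun=> 0); [exact: cvgc_cst|move=> u; rewrite subrr mul0r].
Qed.

Lemma cdiff_id z : cdiff id z.
Proof. by exists (fun=> 1); [exact: cvgc_cst|move=> u; rewrite mul1r]. Qed.

Lemma cdiffD f g z : cdiff f z -> cdiff g z -> cdiff (fun u => f u + g u) z.
Proof.
move=> [f' fc fE] [g' gc gE].
exists (fun u => f' u + g' u); first by apply: cvgcD; [exact: fc|exact: gc].
by move=> u; rewrite mulrDl -fE -gE; ring.
Qed.

Lemma cdiffM f g z : cdiff f z -> cdiff g z -> cdiff (fun u => f u * g u) z.
Proof.
move=> [f' fc fE] dg; have gcz := cdiff_continuous dg.
have [g' gc gE] := dg.
exists (fun u => f' u * g u + f z * g' u).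
  apply: cvgcD.
    by apply: cvgcM; [exact: fc|exact: gcz].
  by apply: cvgcM; [exact: cvgc_cst|exact: gc].
by move=> u; rewrite mulrDl mulrAC -fE -mulrA -gE; ring.
Qed.

Lemma cdiffN f z : cdiff f z -> cdiff (fun u => - f u) z.
Proof.
move=> df; have := cdiffM (cdiff_cst (-1) z) df.
by under eq_fun do rewrite mulN1r.
Qed.

Lemma cdiffB f g z : cdiff f z -> cdiff g z -> cdiff (fun u => f u - g u) z.
Proof. by move=> df /cdiffN; exact: cdiffD. Qed.

Lemma cdiffV f z : f z != 0 -> cdiff f z -> cdiff (fun u => (f u)^-1) z.
Proof.
move=> fz0 df; have fcz := cdiff_continuous df.
have [f' fc fE] := df.
have fz1 : 0 < cnorm (f z) by rewrite cnorm_gt0.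
have /cvg_cnormP/(_ _ fz1)/nbhs_cnorm[e e0 eP] := fcz.
apply: (@cdiff_local _ (fun u => - f' u / (f u * f z)) _ _ e0).
  apply: cvgcM; first by apply: cvgcN; exact: fc.
  apply: cvgcV; first by rewrite mulf_neq0.
  by apply: cvgcM; [exact: fcz|exact: cvgc_cst].
move=> u ue; have fu0 : f u != 0.
  by apply/eqP => fu0; have := eP _ ue; rewrite fu0 sub0r cnormN ltxx.
have := fE u; rewrite mulrAC mulNr => <-.
by field; rewrite fu0 fz0.
Qed.

Lemma cdiff_comp f g z : cdiff f z -> cdiff g (f z) -> cdiff (g \o f) z.
Proof.
move=> df; have fcz := cdiff_continuous df; move: df.
move=> [f' fc fE] [g' gc gE].
exists (fun u => g' (f u) * f' u); last by move=> u /=; rewrite gE fE mulrA.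
by apply: cvgcM; [exact: (continuous_comp fcz)|exact: fc].
Qed.

(** Provides the affine function that is subtracted in the local step of Goursat's argument. *)
Lemma cdiff_lin_approx f z : cdiff f z -> exists d, forall e : R, 0 < e ->
  exists2 r : R, 0 < r & forall u, cnorm (u - z) < r ->
    cnorm (f u - f z - d * (u - z)) <= e * cnorm (u - z).
Proof.
move=> [g /cvg_cnormP gc gE].
exists (g z) => e e0; have /nbhs_cnorm[r r0 rP] := gc _ e0.
exists r => // u /rP gu; rewrite gE -mulrBl cnormM ler_wpM2r ?cnorm_ge0//.
exact: ltW.
Qed.

(** The value of the slope at [z] is recorded for the Schwarz lemma, where [f u / u] is extended to
    [0] by the derivative. *)
Lemma derivable_slope f z : derivable f z 1 ->
  exists2 g : R[i] -> R[i], {for z, continuous g} &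
    (forall u, f u - f z = g u * (u - z)) /\ g z = derive1 f z.
Proof.
move=> df.
exists (fun u => if u == z then derive1 f z else (f u - f z) / (u - z)); last first.
  split; last by rewrite eqxx.
  move=> u; case: eqVneq => [->|uz]; first by rewrite !subrr mulr0.
  by rewrite divfK// subr_eq0.
rewrite /prop_for /continuous_at eqxx.
apply/cvg_cnormP => e e0.
have := df; rewrite /derivable => /cvg_cnormP/(_ _ e0).
rewrite -/(derive f z 1) -derive1E.
move=> /nbhs_cnorm[r r0 rP].
apply/nbhs_cnorm; exists r => // u ur.
case: ifPn => [_|uz]; first by rewrite subrr cnorm0.
have := rP (u - z); rewrite subr0 => /(_ ur); rewrite subr_eq0 => /(_ uz).
rewrite /GRing.scale/= mulr1 subrK mulrC.
by [].
Qed.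

Lemma derivable_cdiff f z : derivable f z 1 -> cdiff f z.
Proof. by move=> /derivable_slope[g gc [gE _]]; exists g. Qed.

End ComplexDifferentiability.

(** * Integrals of complex-valued functions on a segment *)

Section ComplexIntegral.
Variable R : realType.
Local Notation mu := (@lebesgue_measure R).
Implicit Types (a b c : R) (f g : R -> R[i]).

Lemma continuous_integrable a b (f : R -> R) :
  (forall t, a <= t <= b -> {for t, continuous f}) ->
  mu.-integrable `[a, b] (EFin \o f).
Proof.
move=> fc; apply: continuous_compact_integrable; first exact: segment_compact.
by apply: continuous_in_subspaceT => t; rewrite inE/= in_itv/=; exact: fc.
Qed.

Lemma integrable_itvS a b c d (f : R -> R) : a <= c -> d <= b ->
  mu.-integrable `[a, b] (EFin \o f) -> mu.-integrable `[c, d] (EFin \o f).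
Proof.
move=> ac db; apply: integrableS => //; apply: subset_itvScc; by rewrite bnd_simp.
Qed.

Lemma Rintegral_split a b c (f : R -> R) : a <= c -> c <= b ->
  mu.-integrable `[a, b] (EFin \o f) ->
  \int[mu]_(t in `[a, b]) f t =
    \int[mu]_(t in `[a, c]) f t + \int[mu]_(t in `[c, b]) f t.
Proof.
move=> ac cb fi; rewrite -(@Rintegral_itv_obnd_cbnd _ c); last first.
  apply: integrableS (integrable_itvS ac (lexx b) fi) => //.
  exact: subset_itv_oc_cc.
rewrite -(@Rintegral_itvB _ f (BLeft a) (BRight b) c)// ?bnd_simp//.
by rewrite addrC subrK.
Qed.

Lemma Rintegral_norm_le a b (f : R -> R) (M : R) : a <= b ->
  mu.-integrable `[a, b] (EFin \o f) ->
  (forall t, a <= t <= b -> `|f t| <= M) ->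
  `|\int[mu]_(t in `[a, b]) f t| <= M * (b - a).
Proof.
move=> ab fi fM; apply: (le_trans (le_normr_Rintegral _ fi)) => //.
have -> : M * (b - a) = \int[mu]_(t in `[a, b]) M.
  rewrite Rintegral_cst//= lebesgue_measure_itv /= lte_fin.
  by have [_|ba|->] := ltgtP a b; rewrite ?subrr//; rewrite leNgt ba in ab.
apply: le_Rintegral => //.
- exact: (integrable_norm fi).
- by apply: continuous_integrable => t _; exact: cvg_cst.
Qed.

Lemma RintegralC a b M : a <= b -> \int[mu]_(t in `[a, b]) M = M * (b - a).
Proof.
move=> ab; rewrite Rintegral_cst//= lebesgue_measure_itv /= lte_fin.
by have [_|ba|->] := ltgtP a b; rewrite ?subrr//; rewrite leNgt ba in ab.
Qed.

Definition cint a b f : R[i] :=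
  (\int[mu]_(t in `[a, b]) complex.Re (f t)) +i*
  (\int[mu]_(t in `[a, b]) complex.Im (f t)).

Definition cintegrable a b f :=
  mu.-integrable `[a, b] (EFin \o (fun t => complex.Re (f t))) /\
  mu.-integrable `[a, b] (EFin \o (fun t => complex.Im (f t))).

Lemma continuous_cintegrable a b f :
  (forall t, a <= t <= b -> {for t, continuous f}) -> cintegrable a b f.
Proof.
move=> fc; split; apply: continuous_integrable => t /fc;
  by move/cvg_complex => [].
Qed.

Lemma cintegrableD a b f g : cintegrable a b f -> cintegrable a b g ->
  cintegrable a b (fun t => f t + g t).
Proof.
move=> [fR fI] [gR gI]; split.
  rewrite (_ : _ \o _ = fun t => (EFin \o (fun t => complex.Re (f t))) t + (EFin \o (fun t => complex.Re (g t))) t)%E.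
    exact: integrableD.
  by apply/funext => t /=; rewrite ReD EFinD.
rewrite (_ : _ \o _ = fun t => (EFin \o (fun t => complex.Im (f t))) t + (EFin \o (fun t => complex.Im (g t))) t)%E.
  exact: integrableD.
by apply/funext => t /=; rewrite ImD EFinD.
Qed.

Lemma integrable_lincomb a b (f g : R -> R) (k l : R) :
  mu.-integrable `[a, b] (EFin \o f) -> mu.-integrable `[a, b] (EFin \o g) ->
  mu.-integrable `[a, b] (EFin \o (fun t => k * f t + l * g t)).
Proof.
move=> fi gi.
rewrite (_ : _ \o _ = (fun t => k%:E * (EFin \o f) t + l%:E * (EFin \o g) t)%E)//.
by apply: integrableD => //; exact: integrableZl.
Qed.

Lemma cintegrableZ a b f k : cintegrable a b f -> cintegrable a b (fun t => k * f t).
Proof.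
move=> [fR fI]; split.
  have := integrable_lincomb (complex.Re k) (- complex.Im k) fR fI.
  congr (integrable _ _ _); apply/funext => t /=; congr EFin.
  by rewrite ReM mulNr.
have := integrable_lincomb (complex.Re k) (complex.Im k) fI fR.
by congr (integrable _ _ _); apply/funext => t /=; congr EFin; rewrite ImM.
Qed.

Lemma eq_cint a b f g : (forall t, a <= t <= b -> f t = g t) -> cint a b f = cint a b g.
Proof.
move=> fg; congr (_ +i* _); apply: eq_Rintegral => t;
  by rewrite inE/= in_itv/= => /fg ->.
Qed.

Lemma cintD a b f g : cintegrable a b f -> cintegrable a b g ->
  cint a b (fun t => f t + g t) = cint a b f + cint a b g.
Proof.
move=> [fR fI] [gR gI]; rewrite /cint.
under eq_Rintegral do rewrite ReD; rewrite RintegralD//.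
by under [X in _ +i* X]eq_Rintegral do rewrite ImD; rewrite [X in _ +i* X]RintegralD.
Qed.

Lemma RintegralLC a b (f g : R -> R) (k l : R) :
  mu.-integrable `[a, b] (EFin \o f) -> mu.-integrable `[a, b] (EFin \o g) ->
  \int[mu]_(t in `[a, b]) (k * f t + l * g t) =
  k * \int[mu]_(t in `[a, b]) f t + l * \int[mu]_(t in `[a, b]) g t.
Proof.
move=> fi gi.
have ki : mu.-integrable `[a, b] (EFin \o (fun t => k * f t)).
  by rewrite (_ : _ \o _ = (fun t => k%:E * (EFin \o f) t)%E)//; exact: integrableZl.
have li : mu.-integrable `[a, b] (EFin \o (fun t => l * g t)).
  by rewrite (_ : _ \o _ = (fun t => l%:E * (EFin \o g) t)%E)//; exact: integrableZl.
by rewrite RintegralD// !RintegralZl.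
Qed.

Lemma cintZ a b f k : cintegrable a b f ->
  cint a b (fun t => k * f t) = k * cint a b f.
Proof.
move=> [fR fI]; apply/eqP; rewrite eq_complex /cint ReM ImM/=.
under eq_Rintegral do rewrite ReM -mulNr.
rewrite (RintegralLC _ _ fR fI) mulNr eqxx/=.
by under eq_Rintegral do rewrite ImM; rewrite (RintegralLC _ _ fI fR).
Qed.

Lemma cintB a b f g : cintegrable a b f -> cintegrable a b g ->
  cint a b (fun t => f t - g t) = cint a b f - cint a b g.
Proof.
move=> fi gi; under eq_cint do rewrite -mulN1r.
by rewrite cintD ?cintZ ?mulN1r//; exact: cintegrableZ.
Qed.

Lemma cint_split a b c f : a <= c -> c <= b -> cintegrable a b f ->
  cint a b f = cint a c f + cint c b f.
Proof.
by move=> ac cb [fR fI]; rewrite /cint (Rintegral_split ac cb fR) (Rintegral_split ac cb fI).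
Qed.

Lemma cint_norm_le a b f M : a <= b -> cintegrable a b f ->
  (forall t, a <= t <= b -> cnorm (f t) <= M) ->
  cnorm (cint a b f) <= 2 * (M * (b - a)).
Proof.
move=> ab [fR fI] fM; rewrite (le_trans (ler_cnorm_ReIm _))//= mulr_natl mulr2n.
apply: lerD; apply: Rintegral_norm_le => // t /fM; apply: le_trans.
  exact: ler_Re_cnorm.
exact: ler_Im_cnorm.
Qed.

Lemma cint_cst a b (c : R[i]) : a <= b -> cint a b (fun=> c) = (b - a)%:C * c.
Proof.
by move=> ab; rewrite /cint !RintegralC//; case: c => x y; simpc; rewrite ![(b - a) * _]mulrC.
Qed.

Lemma Rintegral_FTC2 a b (f F : R -> R) : a < b -> continuous f ->
  (forall x : R, is_derive x 1 F (f x)) ->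
  \int[mu]_(t in `[a, b]) f t = F b - F a.
Proof.
move=> ab fc FE; rewrite /Rintegral (@continuous_FTC2 _ f F)//.
- exact: continuous_subspaceT.
- have Fc : continuous F.
    by move=> x; apply/differentiable_continuous/derivable1_diffP; case: (FE x).
  split.
  + by move=> x _; case: (FE x).
  + exact/cvg_at_right_filter/Fc.
  + exact/cvg_at_left_filter/Fc.
- by move=> x _; rewrite derive1E; case: (FE x).
Qed.

Lemma cint_cis a b : a <= b -> cint a b (@cis R) * 'i = cis b - cis a.
Proof.
rewrite le_eqVlt => /predU1P[->|ab].
  rewrite /cint !set_itv1 !Rintegral_set1 subrr; apply/eqP.
  by rewrite eq_complex/= !(mul0r, mulr0, mulr1, subrr, addr0, eqxx).
have cosI : \int[mu]_(t in `[a, b]) cos t = sin b - sin a.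
  by apply: Rintegral_FTC2 => //; exact: continuous_cos.
have sinI : \int[mu]_(t in `[a, b]) sin t = (- cos b) - (- cos a).
  apply: (@Rintegral_FTC2 _ _ sin (- cos)) => //; first exact: continuous_sin.
  by move=> x; have := is_deriveN (is_derive_cos x); rewrite opprK.
rewrite /cint/= cosI sinI; apply/eqP.
by rewrite eq_complex/= !mulr0 !mulr1 sub0r !addr0 opprB opprK addrC eqxx/=.
Qed.

End ComplexIntegral.

(** * Bisection of rectangles *)

Section Bisection.
Variable R : realType.

Lemma exists_halving_lt (w e : R) : 0 < e -> exists n : nat, w / 2 ^+ n < e.
Proof.
move=> e0; have we0 : 0 <= `|w| / e by rewrite divr_ge0// ltW.
exists (Num.bound (`|w| / e)); set k := Num.bound _.
have wk : `|w| / e < 2 ^+ k.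
  apply: (lt_trans (archi_boundP we0)).
  by rewrite -natrX ltr_nat ltn_expl.
rewrite ltr_pdivrMr ?exprn_gt0// (le_lt_trans (ler_norm _))//.
by rewrite mulrC -ltr_pdivrMr.
Qed.

(** If [G] failed, some quarter would fail at each stage, and the nested failing rectangles would
    shrink to a point contradicting the local hypothesis. Goursat's theorem and the boundedness of
    continuous functions are both instances. *)
Lemma rectangle_bisection (G : R -> R -> R -> R -> Prop) (a b c d : R) :
  a <= b -> c <= d ->
  (forall a' b' c' d', a <= a' -> a' <= b' -> b' <= b ->
     c <= c' -> c' <= d' -> d' <= d ->
     let m := (a' + b') / 2 in let n := (c' + d') / 2 in
     G a' m c' n -> G m b' c' n -> G a' m n d' -> G m b' n d' ->
     G a' b' c' d') ->
  (forall x y, a <= x <= b -> c <= y <= d -> exists2 r, 0 < r &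
     forall a' b' c' d', a <= a' -> b' <= b -> c <= c' -> d' <= d ->
       a' <= x <= b' -> c' <= y <= d' -> b' - a' < r -> d' - c' < r ->
       G a' b' c' d') ->
  G a b c d.
Proof.
move=> ab cd merge loc; apply: contrapT => nG.
pose bad (s : R * R * R * R) := let: (x, x', y, y') := s in
  [/\ a <= x, x <= x', x' <= b, c <= y & y <= y'] /\ y' <= d /\ ~ G x x' y y'.
pose sub (s t : R * R * R * R) :=
  let: (x, x', y, y') := s in let: (u, u', v, v') := t in
  [/\ x <= u, u' <= x', y <= v & v' <= y'] /\
  u' - u = (x' - x) / 2 /\ v' - v = (y' - y) / 2.
(* [choice] wants a total map, so the claim is made conditional on [bad s]. *)
have step s : exists t, bad s -> bad t /\ sub s t.
  have [bs|nbs] := pselect (bad s); last by exists s.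
  case: s bs => [[[x x'] y] y'] [[ax xx xb cy yy] [yd nGs]].
  pose m := (x + x') / 2; pose n := (y + y') / 2.
  have [xm mx] : x <= m /\ m <= x' by rewrite /m; lra.
  have [yn ny] : y <= n /\ n <= y' by rewrite /n; lra.
  have mE1 : m - x = (x' - x) / 2 by rewrite /m; lra.
  have mE2 : x' - m = (x' - x) / 2 by rewrite /m; lra.
  have nE1 : n - y = (y' - y) / 2 by rewrite /n; lra.
  have nE2 : y' - n = (y' - y) / 2 by rewrite /n; lra.
  have [G1|nG1] := pselect (G x m y n); last first.
    by exists (x, m, y, n) => _; do 3?split => //; lra.
  have [G2|nG2] := pselect (G m x' y n); last first.
    by exists (m, x', y, n) => _; do 3?split => //; lra.
  have [G3|nG3] := pselect (G x m n y'); last first.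
    by exists (x, m, n, y') => _; do 3?split => //; lra.
  have [G4|nG4] := pselect (G m x' n y'); last first.
    by exists (m, x', n, y') => _; do 3?split => //; lra.
  by exfalso; apply: nGs; apply: merge.
have [f fP] := choice step.
pose s n := iter n f (a, b, c, d).
have sbad n : bad (s n).
  elim: n => [|n IH]; first by do 2?split.
  by have [] := fP _ IH.
have ssub n : sub (s n) (s n.+1) by have [] := fP _ (sbad n).
pose x n := (s n).1.1.1; pose x' n := (s n).1.1.2.
pose y n := (s n).1.2; pose y' n := (s n).2.
have sE n : s n = (x n, x' n, y n, y' n).
  by rewrite /x /x' /y /y'; case: (s n) => [[[? ?] ?] ?].
have sb n := sbad n; have ss n := ssub n.
have {}sb n : [/\ a <= x n, x n <= x' n, x' n <= b, c <= y n & y n <= y' n] /\ y' n <= d /\ ~ G (x n) (x' n) (y n) (y' n).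
  by have := sb n; rewrite sE.
have {}ss n : [/\ x n <= x n.+1, x' n.+1 <= x' n, y n <= y n.+1 & y' n.+1 <= y' n] /\
   x' n.+1 - x n.+1 = (x' n - x n) / 2 /\ y' n.+1 - y n.+1 = (y' n - y n) / 2.
  by have := ss n; rewrite !sE.
have xnd : {homo x : n m / (n <= m)%N >-> n <= m}.
  by apply: homo_leq => // [? ? ?|n]; [exact: le_trans|case: (ss n) => -[]].
have ynd : {homo y : n m / (n <= m)%N >-> n <= m}.
  by apply: homo_leq => // [? ? ?|n]; [exact: le_trans|case: (ss n) => -[]].
have x'ni : {homo x' : n m / (n <= m)%N >-> m <= n}.
  by apply: homo_leq => // [p q r ? ?|n]; [exact: (@le_trans _ _ p)|case: (ss n) => -[]].
have y'ni : {homo y' : n m / (n <= m)%N >-> m <= n}.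
  by apply: homo_leq => // [p q r ? ?|n]; [exact: (@le_trans _ _ p)|case: (ss n) => -[]].
have nest (u u' : nat -> R) : {homo u : n m / (n <= m)%N >-> n <= m} ->
    {homo u' : n m / (n <= m)%N >-> m <= n} -> (forall n, u n <= u' n) ->
    exists X, forall n, u n <= X <= u' n.
  move=> und u'ni uu'.
  have uu n m : u n <= u' m.
    have [nm|/ltnW mn] := leqP n m; first by rewrite (le_trans (und _ _ nm)).
    by rewrite (le_trans (uu' n))// u'ni.
  exists (sup (range u)) => n; apply/andP; split.
    by apply: ub_le_sup; [exists (u' 0%N) => _ [k _ <-]|exists n].
  by apply: ge_sup; [exists (u 0%N); exists 0%N|move=> _ [k _ <-]].
have [X XP] := nest x x' xnd x'ni (fun n => let: conj (And5 _ h _ _ _) _ := sb n in h).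
have [Y YP] := nest y y' ynd y'ni (fun n => let: conj (And5 _ _ _ _ h) _ := sb n in h).
have [||r r0 rP] := loc X Y.
- by have := XP 0%N; rewrite /x /x'.
- by have := YP 0%N; rewrite /y /y'.
have wx n : x' n - x n = (b - a) / 2 ^+ n.
  elim: n => [|n IH]; first by rewrite expr0 divr1.
  by case: (ss n) => _ [-> _]; rewrite IH exprSr invfM mulrA.
have wy n : y' n - y n = (d - c) / 2 ^+ n.
  elim: n => [|n IH]; first by rewrite expr0 divr1.
  by case: (ss n) => _ [_ ->]; rewrite IH exprSr invfM mulrA.
have [n nP] := exists_halving_lt (Num.max (b - a) (d - c)) r0.
have [[ax xx xb cy yy] [yd]] := sb n; apply.
apply: rP => //.
  rewrite wx (le_lt_trans _ nP)// ler_pM2r ?invr_gt0 ?exprn_gt0//.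
  by rewrite le_max lexx.
rewrite wy (le_lt_trans _ nP)// ler_pM2r ?invr_gt0 ?exprn_gt0//.
by rewrite le_max lexx orbT.
Qed.

End Bisection.

(** * Cauchy's theorem in an annulus *)

Section Goursat.
Variable R : realType.
Implicit Types (f g h : R[i] -> R[i]) (r t : R).

#[local] Existing Instance nbhsC_filter.

(* The integral of [h(u) du / u] along the boundary of the polar rectangle
   [r1 <= |u| <= r2], [t1 <= arg u <= t2]. *)
Definition polar_form h r1 r2 t1 t2 : R[i] :=
  'i * cint t1 t2 (fun t => h (r2%:C * cis t) - h (r1%:C * cis t)) -
  cint r1 r2 (fun r => (h (r%:C * cis t2) - h (r%:C * cis t1)) * (r^-1)%:C).

(** The chord is the integral of a unit vector along the arc; the factor 2 is that of
    [cint_norm_le]. *)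
Lemma ler_cnorm_cisB t s : cnorm (cis t - cis s) <= 2 * `|t - s| :> R.
Proof.
wlog st : s t / s <= t.
  move=> W; have [/W//|/ltW/W] := leP s t.
  by rewrite cnorm_distC distrC.
rewrite -cint_cis// cnormM (_ : cnorm 'i = 1); last first.
  by rewrite cnorm_sqrt/= expr0n expr1n add0r sqrtr1.
rewrite mulr1 ger0_norm ?subr_ge0// (le_trans (@cint_norm_le _ _ _ _ 1 st _ _))//.
- by apply: continuous_cintegrable => x _; exact: continuous_cis.
- by move=> x _; rewrite cnorm_cis.
- by rewrite mul1r.
Qed.

Lemma polar_ray_continuous h r t : {for r%:C * cis t, continuous h} ->
  {for t, continuous (fun t => h (r%:C * cis t))} /\
  {for r, continuous (fun r => h (r%:C * cis t))}.
Proof.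
move=> hc; split.
  apply: (@continuous_comp _ _ _ (fun t => r%:C * cis t) h); last exact: hc.
  by apply: cvgcM; [exact: cvgc_cst|exact: continuous_cis].
apply: (@continuous_comp _ _ _ (fun r => r%:C * cis t) h); last exact: hc.
by apply: cvgcM; [exact: continuous_real_complex|exact: cvgc_cst].
Qed.

Section PolarForm.
Variables (r1 r2 : R).
Hypotheses (r10 : 0 < r1) (r12 : r1 <= r2).

Let contA h := forall u, r1 <= cnorm u <= r2 -> {for u, continuous h}.

Lemma polar_arc_cintegrable h t1 t2 r : contA h -> r1 <= r <= r2 ->
  cintegrable t1 t2 (fun t => h (r%:C * cis t)).
Proof.
move=> hc /andP[rr rr']; apply: continuous_cintegrable => t _.
apply: (proj1 (polar_ray_continuous _)); apply: hc.
by rewrite cnorm_real_cis ?rr// (le_trans _ rr)// ltW.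
Qed.

Lemma polar_ray_cintegrable h t : contA h ->
  cintegrable r1 r2 (fun r => h (r%:C * cis t) * (r^-1)%:C).
Proof.
move=> hc; apply: continuous_cintegrable => r /andP[rr rr'].
have r0 : 0 < r by rewrite (lt_le_trans r10).
apply: cvgcM.
  apply: (proj2 (polar_ray_continuous _)); apply: hc.
  by rewrite cnorm_real_cis ?rr// ltW.
apply: (@continuous_comp _ _ _ (fun x : R => x^-1) (fun x : R => x%:C)).
  by apply: inv_continuous; rewrite gt_eqF.
exact: continuous_real_complex.
Qed.

End PolarForm.

Lemma contAS (a b c d : R) h : a <= c -> d <= b ->
  (forall u, a <= cnorm u <= b -> {for u, continuous h}) ->
  (forall u, c <= cnorm u <= d -> {for u, continuous h}).
Proof.
move=> ac db hc u /andP[cu ud]; apply: hc.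
by rewrite (le_trans ac)//= (le_trans ud).
Qed.

Lemma polar_form_arcs h r1 r2 t1 t2 : 0 < r1 -> r1 <= r2 ->
  (forall u, r1 <= cnorm u <= r2 -> {for u, continuous h}) ->
  polar_form h r1 r2 t1 t2 =
  'i * (cint t1 t2 (fun t => h (r2%:C * cis t)) -
        cint t1 t2 (fun t => h (r1%:C * cis t))) -
  (cint r1 r2 (fun r => h (r%:C * cis t2) * (r^-1)%:C) -
   cint r1 r2 (fun r => h (r%:C * cis t1) * (r^-1)%:C)).
Proof.
move=> r10 r12 hc; rewrite /polar_form.
under [X in _ - X]eq_cint do rewrite mulrBl.
rewrite !cintB//; try (apply: polar_arc_cintegrable hc _ => //);
  try (apply: polar_ray_cintegrable hc); rewrite ?lexx ?r12//.
Qed.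

(** The integrals along the interior cuts cancel. *)
Lemma polar_form_split h r1 r r2 t1 t t2 : 0 < r1 -> r1 <= r -> r <= r2 ->
  t1 <= t -> t <= t2 ->
  (forall u, r1 <= cnorm u <= r2 -> {for u, continuous h}) ->
  polar_form h r1 r2 t1 t2 =
  polar_form h r1 r t1 t + polar_form h r r2 t1 t +
  (polar_form h r1 r t t2 + polar_form h r r2 t t2).
Proof.
move=> r10 r1r rr2 t1t tt2 hc.
have r0 := lt_le_trans r10 r1r; have r12 := le_trans r1r rr2.
have hc1 := contAS (lexx r1) rr2 hc; have hc2 := contAS r1r (lexx r2) hc.
rewrite !polar_form_arcs//.
rewrite !(@cint_split _ t1 t2 t)//; try (apply: polar_arc_cintegrable hc _; rewrite ?lexx ?r12//; lra).
rewrite !(@cint_split _ r1 r2 r)//; try (apply: polar_ray_cintegrable hc; lra).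
ring.
Qed.

Lemma polar_formD f g c r1 r2 t1 t2 : 0 < r1 -> r1 <= r2 ->
  (forall u, r1 <= cnorm u <= r2 -> {for u, continuous f}) ->
  (forall u, r1 <= cnorm u <= r2 -> {for u, continuous g}) ->
  polar_form (fun u => f u + c * g u) r1 r2 t1 t2 =
  polar_form f r1 r2 t1 t2 + c * polar_form g r1 r2 t1 t2.
Proof.
move=> r10 r12 fc gc.
have fgc u : r1 <= cnorm u <= r2 -> {for u, continuous (fun u => f u + c * g u)}.
  move=> ru; apply: cvgcD; first exact: fc.
  by apply: cvgcM; [exact: cvgc_cst|exact: gc].
rewrite (polar_form_arcs _ _ r10 r12 fc) (polar_form_arcs _ _ r10 r12 gc).
rewrite (polar_form_arcs _ _ r10 r12 fgc).
have fa r := @polar_arc_cintegrable r1 r2 r10 f t1 t2 r fc.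
have ga r := @polar_arc_cintegrable r1 r2 r10 g t1 t2 r gc.
have fr t := @polar_ray_cintegrable r1 r2 r10 f t fc.
have gr t := @polar_ray_cintegrable r1 r2 r10 g t gc.
have arcD r : r1 <= r <= r2 ->
    cint t1 t2 (fun t => f (r%:C * cis t) + c * g (r%:C * cis t)) =
    cint t1 t2 (fun t => f (r%:C * cis t)) + c * cint t1 t2 (fun t => g (r%:C * cis t)).
  move=> rr; rewrite cintD; [|exact: fa|exact/cintegrableZ/ga].
  by rewrite cintZ//; exact: ga.
have rayD t :
    cint r1 r2 (fun r => (f (r%:C * cis t) + c * g (r%:C * cis t)) * (r^-1)%:C) =
    cint r1 r2 (fun r => f (r%:C * cis t) * (r^-1)%:C) +
    c * cint r1 r2 (fun r => g (r%:C * cis t) * (r^-1)%:C).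
  under eq_cint do rewrite mulrDl -mulrA.
  rewrite cintD; [|exact: fr|exact/cintegrableZ/gr].
  by rewrite cintZ.
rewrite !arcD ?rayD ?lexx ?r12//; ring.
Qed.

(** In the coordinate [log u] this is the integral of a constant along the boundary of a
    rectangle. *)
Lemma polar_form_cst c r1 r2 t1 t2 : r1 <= r2 -> t1 <= t2 ->
  polar_form (fun=> c) r1 r2 t1 t2 = 0.
Proof.
move=> r12 t12; rewrite /polar_form subrr cint_cst//.
by under eq_cint do rewrite mul0r; rewrite cint_cst// !mulr0 subrr.
Qed.

(** The form is [du], which is exact. Together with the constants this disposes of affine
    functions. *)
Lemma polar_form_id r1 r2 t1 t2 : 0 < r1 -> r1 <= r2 -> t1 <= t2 ->
  polar_form id r1 r2 t1 t2 = 0.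
Proof.
move=> r10 r12 t12; rewrite /polar_form.
have -> : cint r1 r2 (fun r => (r%:C * cis t2 - r%:C * cis t1) * (r^-1)%:C) =
    cint r1 r2 (fun=> cis t2 - cis t1).
  apply: eq_cint => r /andP[r1r _]; have r0 : r%:C != 0 :> R[i].
    by rewrite -cnorm_gt0 cnorm_real normr_gt0 gt_eqF// (lt_le_trans r10).
  by rewrite fmorphV -mulrBr mulrAC mulfV// mul1r.
rewrite cint_cst//.
under eq_cint do rewrite -mulrBl.
rewrite cintZ; last first.
  by apply: continuous_cintegrable => t _; exact: continuous_cis.
by rewrite -cint_cis//= rmorphB/=; ring.
Qed.

(** Two opposite sides in each integral and the factor of [cint_norm_le] make 4; on the rays,
    [1 / r] is at most [1 / r1]. *)
Lemma polar_form_norm_le h r1 r2 t1 t2 M : 0 < r1 -> r1 <= r2 -> t1 <= t2 ->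
  (forall u, r1 <= cnorm u <= r2 -> {for u, continuous h}) ->
  (forall r t, r1 <= r <= r2 -> t1 <= t <= t2 -> cnorm (h (r%:C * cis t)) <= M) ->
  cnorm (polar_form h r1 r2 t1 t2) <= 4 * M * ((t2 - t1) + (r2 - r1) / r1).
Proof.
move=> r10 r12 t12 hc hM; rewrite /polar_form (le_trans (ler_cnormB _ _))//.
rewrite mulrDr lerD// ?cnormM.
  rewrite (_ : cnorm 'i = 1); last by rewrite cnorm_sqrt/= expr0n expr1n add0r sqrtr1.
  rewrite mul1r (le_trans (@cint_norm_le _ _ _ _ (2 * M) t12 _ _))//; last by lra.
    have := cintegrableD (@polar_arc_cintegrable r1 r2 r10 h t1 t2 r2 hc _)
      (cintegrableZ (-1) (@polar_arc_cintegrable r1 r2 r10 h t1 t2 r1 hc _)).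
    by under eq_fun do rewrite mulN1r; apply; rewrite ?lexx ?r12.
  move=> t tt; rewrite (le_trans (ler_cnormB _ _))// mulr_natl mulr2n.
  by rewrite lerD// hM ?lexx ?r12.
rewrite (le_trans (@cint_norm_le _ _ _ _ (2 * M / r1) r12 _ _))//; last by lra.
  have := cintegrableD (@polar_ray_cintegrable r1 r2 r10 h t2 hc)
      (cintegrableZ (-1) (@polar_ray_cintegrable r1 r2 r10 h t1 hc)).
  by under eq_fun do rewrite mulN1r -mulrBl.
move=> r /[dup] rr /andP[r1r rr2]; have r0 := lt_le_trans r10 r1r.
have M0 : 0 <= M by rewrite (le_trans (cnorm_ge0 _) (hM r t1 rr _))// lexx.
rewrite cnormM cnorm_real gtr0_norm ?invr_gt0//.
apply: ler_pM => //; first exact: cnorm_ge0.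
- by rewrite invr_ge0 ltW.
- rewrite (le_trans (ler_cnormB _ _))// mulr_natl mulr2n.
  by rewrite lerD// hM ?lexx ?t12.
- by rewrite lef_pV2.
Qed.

(** Subtracting the affine part at the point changes nothing and leaves an integrand that is small
    compared with the diameter, on a contour whose length is of the order of the diameter. *)
Lemma polar_form_local h r1 r2 t1 t2 (x y e : R) : 0 < r1 -> 0 < e ->
  (forall u, r1 <= cnorm u <= r2 -> cdiff h u) ->
  r1 <= x <= r2 -> t1 <= y <= t2 ->
  exists2 d : R, 0 < d & forall a b c c', r1 <= a -> b <= r2 -> t1 <= c -> c' <= t2 ->
    a <= x <= b -> c <= y <= c' -> b - a < d -> c' - c < d ->
    cnorm (polar_form h a b c c') <= e * ((b - a) + (c' - c)) ^+ 2.
Proof.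
move=> r10 e0 hd /[dup] xr /andP[r1x xr2] ty.
have r20 : 0 < r2 by lra.
set z := x%:C * cis y; have zn : cnorm z = x by rewrite cnorm_real_cis; lra.
have zr : r1 <= cnorm z <= r2 by rewrite zn.
have [d dP] := cdiff_lin_approx (hd z zr).
(* The factors are the 4 of [polar_form_norm_le], a Lipschitz constant of polar coordinates, and the
   ratio between the length of the contour and the sum of the sides. *)
have k0 : 0 < 4 * (1 + 2 * r2) * (1 + r1^-1).
  by rewrite !mulr_gt0// addr_gt0// ?invr_gt0//; lra.
have [s s0 sP] := dP (e / (4 * (1 + 2 * r2) * (1 + r1^-1))) (divr_gt0 e0 k0).
set e' := e / _ in sP; have e'0 : 0 < e' by rewrite divr_gt0.
have q0 : 0 < 2 * (1 + 2 * r2) by lra.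
exists (s / (2 * (1 + 2 * r2))); first by rewrite divr_gt0.
move=> a b c c' r1a br2 t1c c't2 /andP[ax xb] /andP[cy yc'] bad ccd.
have a0 : 0 < a by lra.
have hc u : a <= cnorm u <= b -> {for u, continuous h}.
  by move=> /andP[au ub]; apply/cdiff_continuous/hd; rewrite (le_trans r1a au) (le_trans ub br2).
set rem : R[i] -> R[i] := fun u => h u + (-1) * (h z - d * z + d * u).
have linc u : {for u, continuous (fun u => h z - d * z + d * u)}.
  by apply: cvgcD; [exact: cvgc_cst|apply: cvgcM; [exact: cvgc_cst|exact: cvg_id]].
have remc u : a <= cnorm u <= b -> {for u, continuous rem}.
  move=> /hc hu; apply: cvgcD; first exact: hu.
  by apply: cvgcM; [exact: cvgc_cst|exact: linc].
have -> : polar_form h a b c c' = polar_form rem a b c c'.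
  rewrite polar_formD; [|lra|lra|exact: hc|by move=> *; exact: linc].
  rewrite polar_formD; [|lra|lra|by move=> *; exact: cvgc_cst|by move=> *; exact: cvg_id].
  by rewrite polar_form_cst ?polar_form_id; [ring|lra..].
have zd r t : a <= r <= b -> c <= t <= c' ->
    cnorm (r%:C * cis t - z) <= (1 + 2 * r2) * ((b - a) + (c' - c)).
  move=> /andP[ar rb] /andP[ct tc'].
  have -> : r%:C * cis t - z = (r - x)%:C * cis t + x%:C * (cis t - cis y).
    by rewrite /z rmorphB/=; ring.
  rewrite (le_trans (ler_cnormD _ _))// !cnormM cnorm_cis mulr1 !cnorm_real.
  have := ler_cnorm_cisB t y; set cd := cnorm _ => cdle.
  have rx : `|r - x| <= b - a by rewrite ler_norml; apply/andP; split; lra.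
  have t_y : `|t - y| <= c' - c by rewrite ler_norml; apply/andP; split; lra.
  have cd0 : 0 <= cd := cnorm_ge0 _.
  rewrite (_ : `|x| = x); last by rewrite ger0_norm; lra.
  have : x * cd <= r2 * (2 * (c' - c)).
    by apply: ler_pM => //; [lra|rewrite (le_trans cdle)// ler_pM2l].
  have : 0 <= r2 * (b - a) by rewrite mulr_ge0 ?(ltW r20)// subr_ge0 (le_trans ax).
  nra.
have remM r t : a <= r <= b -> c <= t <= c' ->
    cnorm (rem (r%:C * cis t)) <= e' * ((1 + 2 * r2) * ((b - a) + (c' - c))).
  move=> ar ct; have zz := zd _ _ ar ct.
  have -> : rem (r%:C * cis t) = h (r%:C * cis t) - h z - d * (r%:C * cis t - z).
    by rewrite /rem; ring.
  apply: (le_trans (sP _ _)); last by rewrite ler_wpM2l// ltW.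
  apply: (le_lt_trans zz).
  move: bad ccd; rewrite !ltr_pdivlMr//; nra.
have := polar_form_norm_le a0 _ _ remc remM => /(_ (le_trans ax xb) (le_trans cy yc')).
move=> /le_trans; apply.
set S := (b - a) + (c' - c).
have S0 : 0 <= S by rewrite /S; lra.
have : (c' - c) + (b - a) / a <= (1 + r1^-1) * S.
  have : (b - a) / a <= (b - a) * r1^-1.
    by rewrite ler_wpM2l ?lef_pV2//; lra.
  have : 0 <= (c' - c) * r1^-1 by rewrite mulr_ge0 ?invr_ge0; lra.
  rewrite /S; nra.
have e'E : e' * (4 * (1 + 2 * r2) * (1 + r1^-1)) = e by rewrite /e' divfK// gt_eqF.
rewrite -e'E => le1.
have p0 : 0 <= 4 * (e' * ((1 + 2 * r2) * S)).
  have c0 : 0 <= 1 + 2 * r2 by rewrite addr_ge0// mulr_ge0// ltW.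
  by rewrite mulr_ge0// mulr_ge0 ?(ltW e'0)// mulr_ge0.
have := ler_wpM2l p0 le1; move=> /le_trans; apply.
by rewrite le_eqVlt; apply/orP; left; apply/eqP; ring.
Qed.

(** The local bound is quadratic in the size of the rectangle, so the bounds for four quarters add
    up exactly to the bound for the whole. It holds for every [e]. *)
Lemma goursat_polar h r1 r2 t1 t2 : 0 < r1 -> r1 <= r2 -> t1 <= t2 ->
  (forall u, r1 <= cnorm u <= r2 -> cdiff h u) ->
  polar_form h r1 r2 t1 t2 = 0.
Proof.
move=> r10 r12 t12 hd.
suff key (e : R) : 0 < e ->
    cnorm (polar_form h r1 r2 t1 t2) <= e * ((r2 - r1) + (t2 - t1)) ^+ 2.
  apply/eqP; rewrite -cnorm_eq0 eq_le cnorm_ge0 andbT.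
  set S := _ + _ in key; apply/ler_addgt0Pl => e e0; rewrite addr0.
  have S1 : 0 < S ^+ 2 + 1 by rewrite ltr_wpDl// sqr_ge0.
  apply: (le_trans (key _ (divr_gt0 e0 S1))).
  rewrite mulrAC ler_pdivrMr// ler_wpM2l ?ltW//.
  by rewrite ltrDl.
move=> e0.
have hc u : r1 <= cnorm u <= r2 -> {for u, continuous h} by move=> /hd/cdiff_continuous.
pose G a b c d := cnorm (polar_form h a b c d) <= e * ((b - a) + (d - c)) ^+ 2.
apply: (@rectangle_bisection _ G) => //.
  move=> a b c d r1a ab br2 t1c cd dt2 m n G1 G2 G3 G4; rewrite /G.
  have hcab := contAS r1a br2 hc.
  rewrite (@polar_form_split h a m b c n d)//; try (by rewrite /m /n; lra).
  rewrite (le_trans (ler_cnormD _ _))//.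
  have := lerD (ler_cnormD (polar_form h a m c n) (polar_form h m b c n))
    (ler_cnormD (polar_form h a m n d) (polar_form h m b n d)).
  move=> /le_trans; apply.
  have := lerD (lerD G1 G2) (lerD G3 G4); move=> /le_trans; apply.
  rewrite le_eqVlt; apply/orP; left; apply/eqP; rewrite /m /n; by field.
move=> x y xr yt; have [d d0 dP] := @polar_form_local h r1 r2 t1 t2 x y e r10 e0 hd xr yt.
by exists d => // a b c c'; exact: dP.
Qed.

Definition circle_int h r : R[i] := cint 0 (2 * pi) (fun t => h (r%:C * cis t)).

(** On the rectangle with angles from [0] to [2 * pi] the two rays coincide and cancel, leaving the
    two circles. *)
Lemma circle_int_const h r1 r2 : 0 < r1 -> r1 <= r2 ->
  (forall u, r1 <= cnorm u <= r2 -> cdiff h u) ->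
  circle_int h r1 = circle_int h r2.
Proof.
move=> r10 r12 hd.
have hc u : r1 <= cnorm u <= r2 -> {for u, continuous h} by move=> /hd/cdiff_continuous.
have pi0 : 0 <= 2 * pi :> R by rewrite mulr_ge0// pi_ge0.
have := goursat_polar r10 r12 pi0 hd; rewrite polar_form_arcs//.
have -> : cis (2 * pi) = cis 0 :> R[i] by rewrite -[LHS]/(cis (2 * pi)) -(add0r (2 * pi)) cisD2pi.
rewrite [X in _ - X]subrr subr0 => /eqP; rewrite mulf_eq0 subr_eq0.
rewrite -cnorm_eq0 cnorm_sqrt/= expr0n expr1n add0r sqrtr1 oner_eq0/= => /eqP.
by rewrite /circle_int.
Qed.

End Goursat.

(** * The Poisson formula *)

Section CauchyPoisson.
Variable R : realType.
Implicit Types (f g h k : R[i] -> R[i]) (r t rho : R) (z u w : R[i]).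

#[local] Existing Instance nbhsC_filter.

Lemma two_pi_gt0 : 0 < 2 * pi :> R.
Proof. by rewrite mulr_gt0// pi_gt0. Qed.

Lemma eq_near_continuous f g z (e : R) : 0 < e ->
  (forall u, cnorm (u - z) < e -> f u = g u) ->
  {for z, continuous f} -> {for z, continuous g}.
Proof.
move=> e0 fg /cvg_cnormP fc; apply/cvg_cnormP => d d0.
have /nbhs_cnorm[r r0 rP] := fc _ d0.
apply/nbhs_cnorm; exists (Num.min e r); first by rewrite lt_min e0.
move=> u; rewrite lt_min => /andP[/fg <- /rP].
by rewrite -fg// subrr cnorm0.
Qed.

Lemma disc_bounded k rho : 0 <= rho ->
  (forall u, cnorm u <= rho -> {for u, continuous k}) ->
  exists M : R, forall r t, 0 <= r <= rho -> 0 <= t <= 2 * pi ->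
    cnorm (k (r%:C * cis t)) <= M.
Proof.
move=> rho0 kc.
pose G (a b c d : R) := exists M : R, forall r t, a <= r <= b -> c <= t <= d ->
    cnorm (k (r%:C * cis t)) <= M.
apply: (@rectangle_bisection _ G) => //.
- exact/ltW/two_pi_gt0.
- move=> a b c d _ _ _ _ _ _ m n [M1 P1] [M2 P2] [M3 P3] [M4 P4].
  exists (Num.max (Num.max M1 M2) (Num.max M3 M4)) => r t /andP[ar rb] /andP[ct td].
  rewrite !le_max; have [rm|/ltW mr] := leP r m; have [tn|/ltW nt] := leP t n.
  + by rewrite P1 ?ar ?ct.
  + by rewrite (P3 r t) ?ar ?nt ?orbT.
  + by rewrite (P2 r t) ?mr ?ct ?orbT.
  + by rewrite (P4 r t) ?mr ?nt ?orbT.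
move=> x y /andP[x0 xr] ty.
have zn : cnorm (x%:C * cis y) <= rho by rewrite cnorm_real_cis.
have /cvg_cnormP/(_ _ ltr01)/nbhs_cnorm[e e0 eP] := kc _ zn.
have q0 : 0 < 1 + 2 * rho + 1 by rewrite addr_gt0// ltr_wpDr// mulr_ge0.
exists (e / (1 + 2 * rho + 1)); first by rewrite divr_gt0.
move=> a b c d a0 br c0 dp /andP[ax xb] /andP[cy yd] ba dc.
exists (cnorm (k (x%:C * cis y)) + 1) => r t /andP[ar rb] /andP[ct td].
rewrite -lerBlDl (le_trans (ler_cnorm_sub _ _))//; apply/ltW/eP.
have -> : r%:C * cis t - x%:C * cis y = (r - x)%:C * cis t + x%:C * (cis t - cis y).
  by rewrite rmorphB/=; ring.
rewrite (le_lt_trans (ler_cnormD _ _))// !cnormM cnorm_cis mulr1 !cnorm_real.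
have rx : `|r - x| <= b - a by rewrite ler_norml; apply/andP; split; lra.
have t_y : `|t - y| <= d - c by rewrite ler_norml; apply/andP; split; lra.
have : `|x| * cnorm (cis t - cis y) <= rho * (2 * (d - c)).
  rewrite ger0_norm// ler_pM ?cnorm_ge0// (le_trans (ler_cnorm_cisB _ _))//.
  by rewrite ler_pM2l.
move: ba dc; rewrite !ltr_pdivlMr// => ba dc xcd.
set A := `|r - x| in rx *; set B := _ * cnorm _ in xcd *.
have b0 : 0 <= b - a by rewrite (le_trans _ rx)// normr_ge0.
have d0 : 0 <= d - c by rewrite (le_trans _ t_y)// normr_ge0.
clear -rx xcd ba dc b0 d0 rho0 e0; nra.
Qed.

Lemma circle_int_continuous k rho r : 0 < r < rho ->
  (forall u, cnorm u <= rho -> {for u, continuous k}) ->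
  {for r, continuous (circle_int k)}.
Proof.
move=> r0 kc.
have rho0 : 0 <= rho by case/andP: r0 => r0 rr; rewrite ltW// (lt_trans r0).
have [M MP] := disc_bounded rho0 kc.
have kcont x t : x \in (`]0, rho[%classic : set R) -> {for x%:C * cis t, continuous k}.
  rewrite inE/= in_itv/= => /andP[x0 xr]; apply: kc.
  by rewrite cnorm_real_cis ltW.
apply/cvg_complex; split.
  apply: (@continuity_under_integral _ _ _ (@lebesgue_measure R)
     (fun x t => complex.Re (k (x%:C * cis t))) `[0, 2 * pi] _ 0 rho _ _ (fun=> M)) => //.
  - move=> x xI; apply: (proj1 (@continuous_cintegrable R 0 (2 * pi) (fun t => k (x%:C * cis t)) _)).
    by move=> t _; apply: (proj1 (polar_ray_continuous _)); apply: kcont; rewrite inE.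
  - apply: aeW => t _ x xI.
    by have /cvg_complex[] := proj2 (polar_ray_continuous (kcont x t xI)).
  - by apply: continuous_integrable => t _; exact: cvg_cst.
  - move=> x /=; rewrite in_itv/= => /andP[x0 xr]; apply: aeW => t/=; rewrite in_itv/= => tI.
    by rewrite (le_trans (ler_Re_cnorm _))// MP// !ltW.
  - by rewrite inE/= in_itv.
apply: (@continuity_under_integral _ _ _ (@lebesgue_measure R)
     (fun x t => complex.Im (k (x%:C * cis t))) `[0, 2 * pi] _ 0 rho _ _ (fun=> M)) => //.
- move=> x xI; apply: (proj2 (@continuous_cintegrable R 0 (2 * pi) (fun t => k (x%:C * cis t)) _)).
  by move=> t _; apply: (proj1 (polar_ray_continuous _)); apply: kcont; rewrite inE.
- apply: aeW => t _ x xI.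
  by have /cvg_complex[] := proj2 (polar_ray_continuous (kcont x t xI)).
- by apply: continuous_integrable => t _; exact: cvg_cst.
- move=> x /=; rewrite in_itv/= => /andP[x0 xr]; apply: aeW => t/=; rewrite in_itv/= => tI.
  by rewrite (le_trans (ler_Im_cnorm _))// MP// !ltW.
- by rewrite inE/= in_itv.
Qed.

Lemma circle_int_shrink k s : 0 < s -> {for 0, continuous k} ->
  (forall r r', 0 < r -> r <= r' -> r' < s -> circle_int k r = circle_int k r') ->
  (forall u, cnorm u < s -> {for u, continuous k}) ->
  forall r, 0 < r < s -> circle_int k r = (2 * pi)%:C * k 0.
Proof.
move=> s0 k0c kconst kc r /andP[r0 rs].
apply/eqP; rewrite -subr_eq0 -cnorm_eq0 eq_le cnorm_ge0 andbT.
apply/ler_addgt0Pl => e e0; rewrite addr0.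
have e'0 : 0 < e / (2 * (2 * pi)) by rewrite divr_gt0// mulr_gt0// two_pi_gt0.
have /cvg_cnormP/(_ _ e'0)/nbhs_cnorm[d d0 dP] := k0c.
pose r' := Num.min r (d / 2).
have r'0 : 0 < r' by rewrite /r' lt_min r0 divr_gt0.
have r'r : r' <= r by rewrite /r' ge_min lexx.
have r'd : r' < d by rewrite /r' gt_min; apply/orP; right; lra.
rewrite -(kconst r' r)//; have -> : (2 * pi)%:C * k 0 = cint 0 (2 * pi) (fun=> k 0).
  by rewrite cint_cst ?subr0// ltW// two_pi_gt0.
have ki : cintegrable 0 (2 * pi) (fun t => k (r'%:C * cis t)).
  apply: continuous_cintegrable => t _; apply: (proj1 (polar_ray_continuous _)).
  by apply: kc; rewrite cnorm_real_cis ?(le_lt_trans r'r)// ltW.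
have ci : cintegrable 0 (2 * pi) (fun=> k 0).
  by apply: continuous_cintegrable => t _; exact: cvgc_cst.
rewrite -cintB//.
have pi20 := ltW two_pi_gt0.
apply: (le_trans (@cint_norm_le _ _ _ _ (e / (2 * (2 * pi))) pi20 _ _)).
- have := cintegrableD ki (cintegrableZ (-1) ci).
  by under eq_fun do rewrite mulN1r.
- move=> t _; apply/ltW/dP; by rewrite subr0 cnorm_real_cis// ltW.
- rewrite subr0 le_eqVlt; apply/orP; left; apply/eqP.
  by move: (@pi_gt0 R); move: (@pi R) => p p0; field; rewrite gt_eqF.
Qed.

(* The point [z] is excepted because the lemma is applied to difference
   quotients at [z]; the continuity of the circle means in the radius bridges
   the circle through [z]. *)
Lemma mean_value k rho z : cnorm z < rho ->
  (forall u, cnorm u <= rho -> {for u, continuous k}) ->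
  (forall u, 0 < cnorm u <= rho -> u != z -> cdiff k u) ->
  circle_int k rho = (2 * pi)%:C * k 0.
Proof.
move=> zr kc kd; set s := cnorm z in zr.
have s0 : 0 <= s := cnorm_ge0 z.
have r0 : 0 < rho by rewrite (le_lt_trans s0).
have k0c : {for 0, continuous k} by apply: kc; rewrite cnorm0 ltW.
have conz r r' : 0 < r -> r <= r' -> r' <= rho -> (s < r) || (r' < s) ->
    circle_int k r = circle_int k r'.
  move=> r00 rr' r'r sr; apply: circle_int_const => // u /andP[ru ur'].
  apply: kd; first by rewrite (lt_le_trans r00)// (le_trans ur').
  apply/eqP => uz; move: sr; rewrite /s -uz => /orP[] h.
    by move: ru; rewrite leNgt h.
  by move: ur'; rewrite leNgt h.
have small r : 0 < r -> r < rho -> (s == 0) || (r < s) -> circle_int k r = (2 * pi)%:C * k 0.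
  move=> r00 rrho /orP[/eqP s00|rs].
    apply: (@circle_int_shrink _ rho r0 k0c); last by rewrite r00.
      by move=> a b a0 ab bs; apply: conz => //; [exact: ltW|rewrite s00 a0].
    by move=> u /ltW; exact: kc.
  apply: (@circle_int_shrink _ s (lt_trans r00 rs) k0c); last by rewrite r00.
  - by move=> a b a0 ab bs; apply: conz => //; [exact/ltW/(lt_trans bs)|rewrite bs orbT].
  - by move=> u us; apply: kc; rewrite ltW// (lt_trans us).
move: s0; rewrite le_eqVlt => /predU1P[s0|s0].
  rewrite -(@conz (rho / 2) rho)//; [|lra..|].
    by rewrite small//; [lra|lra|rewrite -s0 eqxx].
  by apply/orP; left; lra.
have cs : {for s, continuous (circle_int k)} by apply: circle_int_continuous kc; rewrite s0.
apply/eqP; rewrite -subr_eq0 -cnorm_eq0 eq_le cnorm_ge0 andbT.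
apply/ler_addgt0Pl => e e0; rewrite addr0.
have e20 : 0 < e / 2 by lra.
have /cvg_cnormP/(_ _ e20)/nbhs_ballP[d /= d0 dP] := cs.
(* The radii [s - m] and [s + m] lie on either side of the exceptional circle, both with means
   within [e / 2] of the mean over it. *)
pose m := Num.min (d / 2) (Num.min (s / 2) ((rho - s) / 2)).
have m0 : 0 < m by rewrite !lt_min; apply/and3P; split; lra.
have md : m <= d / 2 by rewrite /m ge_min lexx.
have ms : m <= s / 2 by rewrite /m !ge_min lexx orbT.
have mr : m <= (rho - s) / 2 by rewrite /m !ge_min lexx !orbT.
have D1 : cnorm (circle_int k (s - m) - circle_int k s) < e / 2.
  by apply: dP; rewrite /ball/= opprB addrCA subrr addr0 ger0_norm; lra.
have D2 : cnorm (circle_int k (s + m) - circle_int k s) < e / 2.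
  by apply: dP; rewrite /ball/= opprD addNKr normrN ger0_norm; lra.
rewrite -(small (s - m)); [|lra|lra|by apply/orP; right; lra].
rewrite -(@conz (s + m) rho)//; [|lra|lra|by apply/orP; left; lra].
rewrite (le_trans (ler_cnorm_dist _ (circle_int k s) _))// [e]splitr.
by apply: lerD; rewrite ltW// cnorm_distC.
Qed.


(** The Poisson kernel of the disc of radius [rho], normalised to total mass [2 * pi]. *)
Definition poisson rho z t : R :=
  (rho ^+ 2 - cnorm z ^+ 2) / cnorm (rho%:C * cis t - z) ^+ 2.

Section PoissonKernel.
Variables (rho : R) (z : R[i]).
Hypothesis zr : cnorm z < rho.

Let rho0 : 0 < rho. Proof. exact: le_lt_trans (cnorm_ge0 z) zr. Qed.

Lemma circle_neq t : rho%:C * cis t - z != 0.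
Proof.
rewrite subr_eq0; apply/eqP => /(congr1 (@cnorm R)).
by rewrite cnorm_real_cis ?ltW// => rz; move: zr; rewrite -rz ltxx.
Qed.

Lemma poisson_gt0 t : 0 < poisson rho z t.
Proof.
rewrite divr_gt0// ?exprn_gt0 ?cnorm_gt0 ?circle_neq// subr_gt0.
by rewrite ltr_pXn2r// nnegrE ?cnorm_ge0// ltW.
Qed.

Lemma continuous_poisson : continuous (poisson rho z).
Proof.
move=> t; apply: cvgM; first exact: cvg_cst.
apply: cvgV; first by rewrite expf_neq0// cnorm_eq0 circle_neq.
rewrite expr2; under eq_fun do rewrite expr2.
have ct : {for t, continuous (fun t => cnorm (rho%:C * cis t - z))}.
  apply: (@continuous_comp _ _ _ (fun t => rho%:C * cis t - z) (@cnorm R)).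
    apply: cvgcB; last exact: cvgc_cst.
    by apply: cvgcM; [exact: cvgc_cst|exact: continuous_cis].
  exact: continuous_cnorm.
by apply: cvgM; exact: ct.
Qed.

Lemma cdiff_conj_denom u : cnorm u <= rho ->
  (rho ^+ 2)%:C - conjc z * u != 0.
Proof.
move=> ur; rewrite subr_eq0; apply/eqP => /(congr1 (@cnorm R)).
rewrite cnorm_real cnormM cnorm_conj ger0_norm ?sqr_ge0// => rE.
have : cnorm z * cnorm u < rho ^+ 2.
  rewrite expr2; apply: (@le_lt_trans _ _ (cnorm z * rho)).
    by rewrite ler_wpM2l// cnorm_ge0.
  by rewrite ltr_pM2r.
by rewrite rE ltxx.
Qed.

(** In this form the factor [u - z] cancels against the increment of a function at [z]. *)
Lemma poissonE t (u := rho%:C * cis t) :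
  (poisson rho z t)%:C =
  ((rho ^+ 2 - cnorm z ^+ 2)%:C * u) / (((rho ^+ 2)%:C - conjc z * u) * (u - z)).
Proof.
have uz : u - z != 0 := circle_neq t.
have un : cnorm u = rho by rewrite cnorm_real_cis// ltW.
have rE : (rho ^+ 2)%:C = u * conjc u by rewrite conjcM_cnorm un.
have u0 : u != 0 by rewrite -cnorm_gt0 un.
have cuz : conjc u - conjc z != 0 by rewrite -raddfB /= conjc_eq0.
rewrite rE (_ : u * conjc u - conjc z * u = u * (conjc u - conjc z)); last by ring.
have -> : (poisson rho z t)%:C =
    (rho ^+ 2 - cnorm z ^+ 2)%:C / ((u - z) * (conjc u - conjc z)).
  by rewrite /poisson rmorphM fmorphV -raddfB conjcM_cnorm.
field.
by rewrite u0 uz cuz.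
Qed.

(** On the circle the quotient is the conjugate of the Herglotz kernel [(u + z) / (u - z)], written
    so as to be holomorphic in [u] on the closed disc; its mean value gives the mass of the
    kernel. *)
Lemma poisson_Re t (u := rho%:C * cis t) :
  poisson rho z t = complex.Re (((rho ^+ 2)%:C + conjc z * u) / ((rho ^+ 2)%:C - conjc z * u)).
Proof.
have uz : u - z != 0 := circle_neq t.
have un : cnorm u = rho by rewrite cnorm_real_cis// ltW.
have rE : (rho ^+ 2)%:C = u * conjc u by rewrite conjcM_cnorm un.
have u0 : u != 0 by rewrite -cnorm_gt0 un.
have cuz : conjc u - conjc z != 0 by rewrite -raddfB /= conjc_eq0.
have -> : ((rho ^+ 2)%:C + conjc z * u) / ((rho ^+ 2)%:C - conjc z * u) =
    ((conjc u + conjc z) * (u - z)) * ((cnorm (u - z) ^- 2)%:C).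
  rewrite (_ : (cnorm (u - z) ^- 2)%:C = ((u - z) * (conjc u - conjc z))^-1); last first.
    by rewrite fmorphV -raddfB conjcM_cnorm.
  have uuz : u * conjc u - conjc z * u != 0.
    have -> : u * conjc u - conjc z * u = u * (conjc u - conjc z) by ring.
    exact: mulf_neq0.
  rewrite rE; field.
  by rewrite uz; apply/and3P; split.
rewrite /poisson -/u; move: (cnorm (u - z) ^- 2) => c.
rewrite -{1}un !sqr_cnorm; clear.
by case: (u) (z) => a b [d e] /=; ring.
Qed.

Lemma Rintegral_poisson :
  \int[lebesgue_measure]_(t in `[0, 2 * pi]) poisson rho z t = 2 * pi.
Proof.
pose k u : R[i] := ((rho ^+ 2)%:C + conjc z * u) / ((rho ^+ 2)%:C - conjc z * u).
have kd u : cnorm u <= rho -> cdiff k u.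
  move=> ur; have l c : cdiff (fun u => (rho ^+ 2)%:C + c * u) u.
    by apply: cdiffD; [exact: cdiff_cst|apply: cdiffM; [exact: cdiff_cst|exact: cdiff_id]].
  apply: cdiffM; first exact: l.
  apply: cdiffV; first exact: cdiff_conj_denom.
  by apply: cdiffB; [exact: cdiff_cst|apply: cdiffM; [exact: cdiff_cst|exact: cdiff_id]].
have := @mean_value k rho z zr (fun u p => cdiff_continuous (kd u p))
  (fun u p _ => kd u (proj2 (andP p))).
have -> : k 0 = 1.
  rewrite /k !mulr0 addr0 subr0 divff// -cnorm_gt0 cnorm_real normr_gt0.
  by rewrite expf_neq0// gt_eqF.
rewrite mulr1 => /(congr1 (@complex.Re R)) /= mE.
transitivity (complex.Re (circle_int k rho)); last exact: mE.
by apply: eq_Rintegral => t _; rewrite poisson_Re.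
Qed.

(* Apply [mean_value] to the product of the slope of [f] at [z] with
   [u (rho ^ 2 - |z| ^ 2) / (rho ^ 2 - conj z u)], which vanishes at [0]. *)
Lemma poisson_formula f : (forall u, cnorm u <= rho -> {for u, continuous f}) ->
  (forall u, 0 < cnorm u <= rho -> cdiff f u) ->
  cint 0 (2 * pi) (fun t => (poisson rho z t)%:C * f (rho%:C * cis t)) =
  (2 * pi)%:C * f z.
Proof.
move=> fc fd; have pi20 := ltW two_pi_gt0.
have [z0|z0] := eqVneq z 0.
  have := @mean_value f rho z zr fc (fun u p _ => fd u p); rewrite z0 => <-.
  apply: eq_cint => t _; rewrite /poisson cnorm0 !subr0 cnorm_real_cis ?ltW//.
  by rewrite expr0n subr0 divff ?mul1r// expf_neq0// gt_eqF.
have dfz : cdiff f z by apply: fd; rewrite cnorm_gt0 z0 ltW.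
have [g gc gE] := dfz.
have gq u : u != z -> g u = (f u - f z) / (u - z).
  by move=> uz; rewrite gE mulfK// subr_eq0.
have gnear u : u != z -> forall v, cnorm (v - u) < cnorm (u - z) ->
    (f v - f z) / (v - z) = g v.
  move=> uz v vu; rewrite gq//; apply/eqP => vz; move: vu.
  by rewrite vz cnorm_distC ltxx.
have uz0 u : u != z -> 0 < cnorm (u - z) by move=> uz; rewrite cnorm_gt0 subr_eq0.
have gcont u : cnorm u <= rho -> {for u, continuous g}.
  move=> ur; have [->|uz] := eqVneq u z; first exact: gc.
  apply: (eq_near_continuous (uz0 u uz) (gnear u uz)).
  apply: cvgcM; first by apply: cvgcB; [exact: fc|exact: cvgc_cst].
  apply: cvgcV; first by rewrite subr_eq0.
  by apply: cvgcB; [exact: cvg_id|exact: cvgc_cst].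
have gdiff u : 0 < cnorm u <= rho -> u != z -> cdiff g u.
  move=> ur uz; apply: (eq_near_cdiff (uz0 u uz) (gnear u uz)).
  apply: cdiffM; first by apply: cdiffB; [exact: fd|exact: cdiff_cst].
  apply: cdiffV; first by rewrite subr_eq0.
  by apply: cdiffB; [exact: cdiff_id|exact: cdiff_cst].
pose q u : R[i] := ((rho ^+ 2 - cnorm z ^+ 2)%:C * u) / ((rho ^+ 2)%:C - conjc z * u).
have qd u : cnorm u <= rho -> cdiff q u.
  move=> ur; apply: cdiffM; first by apply: cdiffM; [exact: cdiff_cst|exact: cdiff_id].
  apply: cdiffV; first exact: cdiff_conj_denom.
  by apply: cdiffB; [exact: cdiff_cst|apply: cdiffM; [exact: cdiff_cst|exact: cdiff_id]].
have := @mean_value (fun u => g u * q u) rho z zr _ _.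
have -> : q 0 = 0 by rewrite /q mulr0 mul0r.
rewrite !mulr0 => mv.
have {}mv : circle_int (fun u => g u * q u) rho = 0.
  apply: mv.
    by move=> u ur; apply: cvgcM; [exact: gcont|exact/cdiff_continuous/qd].
  by move=> u /[dup] ur /andP[_ ur'] uz; apply: cdiffM; [exact: gdiff|exact: qd].
have pci h : (forall u, cnorm u <= rho -> {for u, continuous h}) ->
    cintegrable 0 (2 * pi) (fun t => (poisson rho z t)%:C * h (rho%:C * cis t)).
  move=> hc; apply: continuous_cintegrable => t _; apply: cvgcM.
    apply: (@continuous_comp _ _ _ (poisson rho z) (fun x : R => x%:C)).
      exact: continuous_poisson.
    exact: continuous_real_complex.
  apply: (proj1 (polar_ray_continuous _)); apply: hc.
  by rewrite cnorm_real_cis// ltW.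
have cstc (c : R[i]) u : cnorm u <= rho -> {for u, continuous (fun=> c)}.
  by move=> _; exact: cvgc_cst.
apply/eqP; rewrite -subr_eq0 -mv /circle_int.
have -> : (2 * pi)%:C * f z = cint 0 (2 * pi) (fun t => (poisson rho z t)%:C * f z).
  under eq_cint do rewrite mulrC.
  rewrite (@cintZ _ 0 (2 * pi) (fun t => (poisson rho z t)%:C) (f z)); last first.
    have := pci (fun=> 1) (cstc 1).
    by under eq_fun do rewrite mulr1.
  rewrite mulrC; congr (_ * _).
  rewrite /cint/= Rintegral_poisson.
  by rewrite RintegralC// mul0r.
rewrite -cintB; [|exact: pci|exact: (pci (fun=> f z) (cstc (f z)))].
apply/eqP/eq_cint => t _; rewrite -mulrBr gE poissonE /q.
set u := _ * cis t; have uz : u - z != 0 := circle_neq t.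
have un : cnorm u = rho by rewrite cnorm_real_cis// ltW.
have ud := @cdiff_conj_denom u; rewrite un lexx in ud.
move: (ud isT); move: ((rho ^+ 2)%:C - _) => D D0.
by field; rewrite uz D0.
Qed.

Lemma poisson_formula_Re f : (forall u, cnorm u <= rho -> {for u, continuous f}) ->
  (forall u, 0 < cnorm u <= rho -> cdiff f u) ->
  \int[lebesgue_measure]_(t in `[0, 2 * pi])
     (poisson rho z t * complex.Re (f (rho%:C * cis t))) = 2 * pi * complex.Re (f z).
Proof.
move=> fc fd; have /(congr1 (@complex.Re R)) := poisson_formula fc fd.
rewrite /cint/= ReM/= mul0r subr0 => <-.
by apply: eq_Rintegral => t _; rewrite ReM/= mul0r subr0.
Qed.

End PoissonKernel.

End CauchyPoisson.

(** * Harnack's inequality and the Schwarz lemma *)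

Section SchwarzHarnack.
Variable R : realType.
Implicit Types (f g h k : R[i] -> R[i]) (r t rho : R) (z u w : R[i]).

#[local] Existing Instance nbhsC_filter.

Lemma cnorm_circle_le rho z t : 0 <= rho ->
  cnorm (rho%:C * cis t - z) <= rho + cnorm z.
Proof. by move=> rho0; rewrite (le_trans (ler_cnormB _ _))// cnorm_real_cis. Qed.

Lemma cnorm_circle_ge rho z t : 0 <= rho ->
  rho - cnorm z <= cnorm (rho%:C * cis t - z).
Proof. by move=> rho0; rewrite (le_trans _ (ler_cnorm_sub _ _))// cnorm_real_cis. Qed.

Lemma poisson_ge rho z t : cnorm z < rho ->
  (rho - cnorm z) / (rho + cnorm z) <= poisson rho z t.
Proof.
move=> zr; have z0 := cnorm_ge0 z; have r0 : 0 < rho := le_lt_trans z0 zr.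
have := cnorm_circle_le z t (ltW r0); rewrite /poisson.
have : 0 < cnorm (rho%:C * cis t - z) by rewrite cnorm_gt0 circle_neq.
move: (cnorm _) z0 zr => x x0 zr; move: (cnorm _) => y y0 yx.
rewrite ler_pdivrMr ?(lt_le_trans y0)// mulrAC ler_pdivlMr ?exprn_gt0//.
have : y ^+ 2 <= (rho + x) ^+ 2 by rewrite ler_pXn2r ?nnegrE//; lra.
have : 0 <= rho - x by lra.
move: (y ^+ 2) => y2; nra.
Qed.

Lemma poisson_le rho z t : cnorm z < rho ->
  poisson rho z t <= (rho + cnorm z) / (rho - cnorm z).
Proof.
move=> zr; have z0 := cnorm_ge0 z; have r0 : 0 < rho := le_lt_trans z0 zr.
have := cnorm_circle_ge z t (ltW r0); rewrite /poisson.
have : 0 < cnorm (rho%:C * cis t - z) by rewrite cnorm_gt0 circle_neq.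
move: (cnorm _) z0 zr => x x0 zr; move: (cnorm _) => y y0 yx.
rewrite ler_pdivrMr ?exprn_gt0// mulrAC ler_pdivlMr ?subr_gt0//.
have : (rho - x) ^+ 2 <= y ^+ 2 by rewrite ler_pXn2r ?nnegrE//; lra.
have : 0 <= rho + x by lra.
move: (y ^+ 2) => y2; nra.
Qed.

(** The kernel at [z] is bounded below by a multiple of the kernel at [0]. Differentiability is
    asked away from [0] because the Schwarz lemma applies this to [f u / u], of which only
    continuity is known at [0]. *)
Lemma harnack f rho z : cnorm z < rho ->
  (forall u, cnorm u <= rho -> {for u, continuous f}) ->
  (forall u, 0 < cnorm u <= rho -> cdiff f u) ->
  (forall t, 0 <= complex.Re (f (rho%:C * cis t))) ->
  (rho - cnorm z) / (rho + cnorm z) * complex.Re (f 0) <= complex.Re (f z).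
Proof.
move=> zr fc fd f0; have z0 := cnorm_ge0 z; have r0 : 0 < rho := le_lt_trans z0 zr.
have fz := poisson_formula_Re zr fc fd.
have c0 : cnorm (0 : R[i]) < rho by rewrite cnorm0.
have f00 := poisson_formula_Re c0 fc fd.
rewrite -(@ler_pM2l _ (2 * pi)) ?two_pi_gt0// -fz mulrCA -f00.
have Rc t : {for t, continuous (fun t => complex.Re (f (rho%:C * cis t)))}.
  have zn : cnorm (rho%:C * cis t) <= rho by rewrite cnorm_real_cis// ltW.
  by have /cvg_complex[] := proj1 (polar_ray_continuous (fc _ zn)).
have Pc w : cnorm w < rho -> lebesgue_measure.-integrable `[0, 2 * pi]
    (EFin \o (fun t => poisson rho w t * complex.Re (f (rho%:C * cis t)))).
  move=> wr; apply: continuous_integrable => t _.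
  by apply: cvgM; [exact: continuous_poisson|exact: Rc].
rewrite -RintegralZl//; last exact: Pc.
apply: le_Rintegral => //; last 2 first.
  exact: Pc.
  move=> t _; rewrite mulrA ler_wpM2r// /poisson cnorm0 subr0 expr0n subr0.
  by rewrite cnorm_real_cis ?(ltW r0)// divff ?mulr1 ?poisson_ge// expf_neq0// gt_eqF.
apply: continuous_integrable => t _; apply: cvgM; first exact: cvg_cst.
by apply: cvgM; [exact: continuous_poisson|exact: Rc].
Qed.

(** With [g u = f u / u], the maximum modulus bound is [|g| <= 1 / rho] on the circle of radius
    [rho]. Harnack's inequality for the nonnegative real part of [1 / rho - e * g], with [e]
    unimodular, carries the gap at [0], where [g 0] is the derivative, over to [z]; then [rho] tends
    to [1]. *)
Lemma schwarz_harnack f lam : (forall z, cnorm z < 1 -> derivable f z 1) ->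
  (forall z, cnorm z < 1 -> cnorm (f z) <= 1) -> f 0 = 0 ->
  cnorm (derive1 f 0) <= lam ->
  forall z, cnorm z < 1 ->
    cnorm (f z) <= cnorm z * (1 - (1 - lam) * (1 - cnorm z) / (1 + cnorm z)).
Proof.
move=> fd f1 f0 flam z z1.
have c01 : cnorm (0 : R[i]) < 1 by rewrite cnorm0.
have [g gc [gE g0]] := derivable_slope (fd _ c01).
have fE u : f u = g u * u by have := gE u; rewrite f0 !subr0.
have [z0|z0] := eqVneq z 0; first by rewrite z0 f0 cnorm0 mul0r.
have x0 : 0 < cnorm z by rewrite cnorm_gt0.
rewrite fE cnormM mulrC ler_pM2l//.
have gdiff u : u != 0 -> cnorm u < 1 -> cdiff g u.
  move=> u0 u1; have un : 0 < cnorm u by rewrite cnorm_gt0.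
  apply: (@eq_near_cdiff _ (fun v => f v * v^-1) g u (cnorm u) un).
    move=> v vu; rewrite fE mulfK//; apply/eqP => v0; move: vu.
    by rewrite v0 sub0r cnormN ltxx.
  apply: cdiffM; first exact/derivable_cdiff/fd.
  by apply: cdiffV => //; exact: cdiff_id.
have gcont u : cnorm u < 1 -> {for u, continuous g}.
  have [->//|u0] := eqVneq u 0.
  by move=> u1; apply/cdiff_continuous/gdiff.
set G := cnorm (g z); set x := cnorm z in z1 x0 *.
(* A rotation making the value at [z] real and nonnegative, so that a bound on a real part bounds
   the modulus. *)
have [e e1 eG] : exists2 e : R[i], cnorm e = 1 & e * g z = G%:C.
  have [gz0|gz0] := eqVneq (g z) 0.
    by exists 1; rewrite ?cnorm1// /G gz0 mulr0 cnorm0.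
  exists (G%:C / g z); last by rewrite divfK.
  by rewrite cnormM cnormV cnorm_real ger0_norm ?cnorm_ge0// divff// cnorm_eq0.
have key rho : x < rho -> rho < 1 ->
    G * (rho * (rho + x)) <= (rho + x) - (rho - x) * (1 - lam * rho).
  move=> xr r1; have r0 : 0 < rho := lt_trans x0 xr.
  have := @harnack (fun u => (rho^-1)%:C - e * g u) rho z xr.
  have hc u : cnorm u <= rho -> {for u, continuous (fun u => (rho^-1)%:C - e * g u)}.
    move=> ur; apply: cvgcB; first exact: cvgc_cst.
    by apply: cvgcM; [exact: cvgc_cst|apply/gcont/(le_lt_trans ur)].
  move=> /(_ hc) H.
  have {}H := H _ _; rewrite eG !ReB/= in H.
  have e0 : complex.Re (e * g 0) <= lam.
    rewrite (le_trans (ler_norm _))// (le_trans (ler_Re_cnorm _))//.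
    by rewrite cnormM e1 mul1r g0.
  have {H} : (rho - x) / (rho + x) * (rho^-1 - complex.Re (e * g 0)) <= rho^-1 - G.
    apply: H.
      move=> u /andP[u0 ur]; apply: cdiffB; first exact: cdiff_cst.
      apply: cdiffM; first exact: cdiff_cst.
      by apply: gdiff; rewrite -?cnorm_gt0// (le_lt_trans ur).
    move=> t; rewrite ReB/= subr_ge0 (le_trans (ler_norm _))// (le_trans (ler_Re_cnorm _))//.
    have un : cnorm (rho%:C * cis t) = rho by rewrite cnorm_real_cis// ltW.
    rewrite cnormM e1 mul1r -(ler_pM2r r0) mulVf ?gt_eqF// -{2}un -cnormM -fE.
    by apply: f1; rewrite un.
  have rx : 0 < rho + x by rewrite addr_gt0.
  move=> H1; have H2 : (rho - x) / (rho + x) * (rho^-1 - lam) <= rho^-1 - G.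
    apply: le_trans H1; rewrite ler_wpM2l ?lerB// divr_ge0 ?subr_ge0//; exact: ltW.
  have rrx : 0 < rho * (rho + x) by rewrite mulr_gt0.
  move: H2; rewrite -(ler_pM2r rrx).
  have -> : (rho - x) / (rho + x) * (rho^-1 - lam) * (rho * (rho + x)) =
      (rho - x) * (1 - lam * rho) by field; rewrite !gt_eqF.
  have -> : (rho^-1 - G) * (rho * (rho + x)) = (rho + x) - G * (rho * (rho + x)).
    by field; rewrite gt_eqF.
  lra.
have x1 : 0 < 1 + x by rewrite addr_gt0.
suff : G * (1 + x) <= (1 + x) - (1 - x) * (1 - lam).
  rewrite -ler_pdivlMr// => /le_trans; apply.
  by rewrite le_eqVlt; apply/orP; left; apply/eqP; field; rewrite gt_eqF.
rewrite leNgt; apply/negP => lt1.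
(* [key] says that [D rho <= 0] for [rho] just below [1]; continuity transfers this to [D 1]. *)
pose D rho := G * (rho * (rho + x)) - ((rho + x) - (rho - x) * (1 - lam * rho)).
have Dc : D rho @[rho --> (1 : R)] --> D 1.
  have idc : (fun r : R => r) @ (1 : R) --> (1 : R) by exact: cvg_id.
  have cc (c : R) : (fun=> c) @ (1 : R) --> c by exact: cvg_cst.
  apply: cvgB; first by apply: cvgM => //; apply: cvgM => //; exact: cvgD.
  apply: cvgB; first exact: cvgD.
  by apply: cvgM; [exact: cvgB|apply: cvgB => //; exact: cvgM].
have D10 : 0 < D 1 by rewrite /D !(mul1r, mulr1) subr_gt0.
have : \forall rho \near (1 : R), 0 < D rho by exact: cvgr_gt Dc _ D10.
move=> /nbhs_ballP[d /= d0 dP].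
pose rho := 1 - Num.min (d / 2) ((1 - x) / 2).
have m0 : 0 < Num.min (d / 2) ((1 - x) / 2) by rewrite lt_min; apply/andP; split; lra.
have m1 : Num.min (d / 2) ((1 - x) / 2) <= d / 2 by rewrite ge_min lexx.
have m2 : Num.min (d / 2) ((1 - x) / 2) <= (1 - x) / 2 by rewrite ge_min lexx orbT.
have := dP rho; rewrite /ball/= /rho opprB addrCA subrr addr0 ger0_norm; last exact: ltW.
move=> /(_ ltac:(lra)); rewrite -/rho /D subr_gt0 ltNge => /negP; apply.
by apply: key; rewrite /rho; lra.
Qed.

End SchwarzHarnack.

(** * Harmonic measure *)

Section HarmonicMeasure.
Variable R : realType.
Local Notation mu := (@lebesgue_measure R).
Local Notation Icc := (`[0, 2 * pi]%classic : set (measurableTypeR R)).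
Implicit Types (f g h k : R[i] -> R[i]) (r t s rho : R) (z u w : R[i]).
Implicit Types (U V W A D : set (measurableTypeR R)).

(* The harmonic measure at [z] of the set of the points [cis t], [t] in [W],
   multiplied by [2 * pi]. *)
Definition hm z W : \bar R :=
  (\int[mu]_(t in Icc `&` W) (poisson 1 z t)%:E)%E.

Lemma measurable_poisson z D : cnorm z < 1 -> measurable_fun D (poisson 1 z).
Proof.
move=> z1; apply: (@measurable_funS _ _ _ _ setT) => //.
by apply: continuous_measurable_fun; exact: continuous_poisson.
Qed.

Lemma measurable_poissonE z D : cnorm z < 1 ->
  measurable_fun D (fun t => (poisson 1 z t)%:E).
Proof. by move=> z1; apply/measurable_EFinP; exact: measurable_poisson. Qed.

Lemma poisson_ge0 z t : cnorm z < 1 -> 0 <= poisson 1 z t.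
Proof. by move=> z1; rewrite ltW// poisson_gt0. Qed.

Lemma measurableII W : measurable W -> measurable (Icc `&` W).
Proof. by move=> mW; apply: measurableI. Qed.

Lemma mu_Icc : mu Icc = (2 * pi)%:E.
Proof. by rewrite /= lebesgue_measure_itv/= lte_fin two_pi_gt0 -EFinD subr0. Qed.

Lemma hm_ge0 z W : cnorm z < 1 -> (0 <= hm z W)%E.
Proof. by move=> z1; apply: integral_ge0 => t _; rewrite lee_fin poisson_ge0. Qed.

Lemma hm_le z W W' : cnorm z < 1 -> measurable W -> measurable W' ->
  Icc `&` W `<=` W' -> (hm z W <= hm z W')%E.
Proof.
move=> z1 mW mW' WW'; apply: ge0_subset_integral => //.
- exact: measurableII.
- exact: measurableII.
- exact: measurable_poissonE.
- by move=> t _; rewrite lee_fin poisson_ge0.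
- by move=> t tW; split; [exact: (proj1 tW)|exact: WW'].
Qed.

Lemma hmU z W W' : cnorm z < 1 -> measurable W -> measurable W' ->
  [disjoint W & W'] -> hm z (W `|` W') = (hm z W + hm z W')%E.
Proof.
move=> z1 mW mW' /disj_setPS WW'; rewrite /hm setIUr ge0_integral_setU//.
- exact: measurableII.
- exact: measurableII.
- exact: measurable_poissonE.
- by move=> t _; rewrite lee_fin poisson_ge0.
- by apply/disj_setPS => t [[_ tW] [_ tW']]; exact: WW'.
Qed.

Lemma hm_full z : cnorm z < 1 -> hm z setT = (2 * pi)%:E.
Proof.
move=> z1; rewrite -(Rintegral_poisson z1) /hm setIT /Rintegral fineK//.
have := @continuous_integrable R 0 (2 * pi) (poisson 1 z) (fun t _ => @continuous_poisson R 1 z z1 t).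
exact: integrable_fin_num.
Qed.

Lemma hmC z W : cnorm z < 1 -> measurable W ->
  (hm z W + hm z (~` W))%E = (2 * pi)%:E.
Proof.
move=> z1 mW; rewrite -hmU ?setUv ?hm_full//; first exact: measurableC.
by apply/disj_setPCl.
Qed.

Lemma hm_fin_num z W : cnorm z < 1 -> measurable W -> hm z W \is a fin_num.
Proof.
move=> z1 mW; rewrite ge0_fin_numE ?hm_ge0//.
by apply: (@le_lt_trans _ _ (hm z setT)); [exact: hm_le|rewrite hm_full// ltry].
Qed.

Lemma hm_le_cst z W c : cnorm z < 1 -> measurable W ->
  (forall t, Icc t -> W t -> poisson 1 z t <= c) ->
  (hm z W <= c%:E * mu (Icc `&` W))%E.
Proof.
move=> z1 mW Pc; rewrite -integral_cst; last exact: measurableII.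
apply: ge0_le_integral => //.
- exact: measurableII.
- by move=> t _; rewrite lee_fin poisson_ge0.
- exact: measurable_poissonE.
- by move=> t [It Wt]; rewrite lee_fin Pc.
Qed.

Lemma hm_le_mu z W : cnorm z < 1 -> measurable W ->
  (hm z W <= ((1 + cnorm z) / (1 - cnorm z))%:E * mu (Icc `&` W))%E.
Proof. by move=> z1 mW; apply: hm_le_cst => // t _ _; exact: poisson_le. Qed.

Lemma hm0 W : measurable W -> hm 0 W = mu (Icc `&` W).
Proof.
move=> mW; rewrite -[RHS]mul1e -(integral_cst mu _ 1%E); last exact: measurableII.
apply: eq_integral => t _.
by rewrite /poisson cnorm0 subr0 expr0n subr0 mul1r cnorm_cis expr1n divr1.
Qed.

Lemma hm_le_hm z z' W (c : R) : cnorm z < 1 -> cnorm z' < 1 -> measurable W ->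
  0 <= c -> (forall t, Icc t -> W t -> poisson 1 z' t <= c * poisson 1 z t) ->
  (hm z' W <= c%:E * hm z W)%E.
Proof.
move=> z1 z'1 mW c0 Pc; have mI := measurableII mW.
rewrite /hm -ge0_integralZl//; last 2 first.
- exact: measurable_poissonE.
- by move=> t _; rewrite lee_fin poisson_ge0.
- apply: ge0_le_integral => //.
  + by move=> t _; rewrite lee_fin poisson_ge0.
  + exact: measurable_poissonE.
  + by apply: emeasurable_funM => //; exact: measurable_poissonE.
  + by move=> t [It Wt]; rewrite -EFinM lee_fin Pc.
Qed.

(** The error is multiplicative and uniform in [t], so it integrates to upper semicontinuity of [hm]
    in the point, whatever the set. *)
Lemma poisson_usc z (e : R) : cnorm z < 1 -> 0 < e ->
  exists2 d : R, 0 < d & forall z', cnorm (z' - z) < d ->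
    cnorm z' < 1 /\ forall t, poisson 1 z' t <= (1 + e) * poisson 1 z t.
Proof.
move=> z1 e0; set b := 1 - cnorm z; have b0 : 0 < b by rewrite subr_gt0.
(* For [|z' - z| < s * b] the numerator grows by a factor of at most [1 + 2 * s] and the denominator
   keeps at least the fraction [(1 - s) ^ 2]; the two bounds on [s] give
   [1 + 2 * s <= (1 + e) * (1 - s) ^ 2]. *)
pose s := Num.min (4^-1) (e / 8).
have s0 : 0 < s by rewrite lt_min invr_gt0 divr_gt0// ltr0n.
have s4 : s <= 4^-1 by rewrite /s ge_min lexx.
have s8 : s <= e / 8 by rewrite /s ge_min lexx orbT.
exists (s * b); first by rewrite mulr_gt0.
move=> z' z'z.
have zz' : cnorm z' - cnorm z <= cnorm (z' - z) := ler_cnorm_sub _ _.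
have z'1 : cnorm z' < 1 by rewrite /b in z'z; nra.
split=> // t; rewrite /poisson !expr1n mulrA.
have x0 := cnorm_ge0 z; have x'0 := cnorm_ge0 z'.
have yb : b <= cnorm (1%:C * cis t - z) by exact: cnorm_circle_ge.
have y'y : cnorm (1%:C * cis t - z) - cnorm (1%:C * cis t - z') <= cnorm (z' - z).
  have -> : z' - z = (1%:C * cis t - z) - (1%:C * cis t - z') by ring.
  exact: ler_cnorm_sub.
have y'0 : 0 < cnorm (1%:C * cis t - z') by rewrite cnorm_gt0 circle_neq.
move: (cnorm (1%:C * cis t - z)) (cnorm (1%:C * cis t - z')) yb y'y y'0 => y y' yb y'y y'0.
have y0 : 0 < y := lt_le_trans b0 yb.
rewrite ler_pdivrMr ?exprn_gt0// mulrAC ler_pdivlMr ?exprn_gt0//.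
have yy' : y * (1 - s) <= y'.
  have : s * b <= s * y by rewrite ler_pM2l.
  lra.
have num : 1 - cnorm z' ^+ 2 <= (1 - cnorm z ^+ 2) * (1 + 2 * s).
  have : cnorm z - cnorm z' <= s * b.
    by have := ler_cnorm_sub z z'; rewrite cnorm_distC; lra.
  have : 1 - cnorm z ^+ 2 = b * (1 + cnorm z) by rewrite /b; ring.
  have sb0 : 0 <= s * b by rewrite mulr_ge0// ltW.
  move: (cnorm z) (cnorm z') x0 x'0 z1 z'1 => x x' x0 x'0 z1 z'1 E xx'.
  have h1 : (x - x') * (x + x') <= s * b * (x + x') by rewrite ler_wpM2r// addr_ge0.
  have h2 : s * b * (x + x') <= s * b * (2 * (1 + x)) by rewrite ler_wpM2l//; lra.
  rewrite E; have -> : 1 - x' ^+ 2 = b * (1 + x) + (x - x') * (x + x').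
    by rewrite -E; ring.
  by clear -h1 h2; lra.
have den : y ^+ 2 * (1 - s) ^+ 2 <= y' ^+ 2.
  by rewrite -exprMn ler_pXn2r// nnegrE; [nra|exact: ltW].
have cf : (1 + 2 * s) <= (1 + e) * (1 - s) ^+ 2.
  have : (1 + 8 * s) * (1 - s) ^+ 2 <= (1 + e) * (1 - s) ^+ 2.
    by rewrite ler_wpM2r ?sqr_ge0//; lra.
  have : 1 + 2 * s <= (1 + 8 * s) * (1 - s) ^+ 2 by nra.
  lra.
have N0 : 0 <= 1 - cnorm z ^+ 2 by rewrite subr_ge0 expr_le1// ltW.
apply: (@le_trans _ _ ((1 - cnorm z ^+ 2) * ((1 + e) * (1 - s) ^+ 2) * y ^+ 2)).
  rewrite ler_wpM2r ?sqr_ge0// (le_trans num)// ler_wpM2l//.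
rewrite [X in _ <= X](_ : _ = (1 - cnorm z ^+ 2) * (1 + e) * y' ^+ 2); last by ring.
rewrite -!mulrA ler_wpM2l// ler_wpM2l//; first by rewrite addr_ge0// ltW.
by rewrite mulrA -expr2 mulrC.
Qed.

End HarmonicMeasure.

(** * Exchange of integrals and subordination *)

Section HarmonicMeasureFubini.
Variable R : realType.
Local Notation mu := (@lebesgue_measure R).
Local Notation Icc := (`[0, 2 * pi]%classic : set (measurableTypeR R)).
Implicit Types (f g h k F : R[i] -> R[i]) (r t s rho : R) (z u w : R[i]).
Implicit Types (U V W A D : set (measurableTypeR R)).

Lemma integral_mulindic D (f : measurableTypeR R -> \bar R) :
  (\int[mu]_(x in D) f x = \int[mu]_x (f x * (\1_D x)%:E))%E.
Proof. by rewrite integral_mkcond epatch_indic. Qed.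

Let indic_ge0 D x : 0 <= \1_D x :> R.
Proof. by rewrite indicE. Qed.

Lemma measurable_poisson_joint (G : measurableTypeR R -> R[i]) :
  measurable_fun setT (fun y => complex.Re (G y)) ->
  measurable_fun setT (fun y => complex.Im (G y)) ->
  measurable_fun [set: measurableTypeR R * measurableTypeR R]
    (fun p : measurableTypeR R * measurableTypeR R => poisson 1 (G p.2) p.1).
Proof.
move=> mR mI.
(* The inverse becomes a power so that [measurable_powR] applies. *)
have -> : (fun p : measurableTypeR R * measurableTypeR R => poisson 1 (G p.2) p.1) =
  (fun p => (1 - (complex.Re (G p.2) ^+ 2 + complex.Im (G p.2) ^+ 2)) *
     ((cos p.1 - complex.Re (G p.2)) ^+ 2 + (sin p.1 - complex.Im (G p.2)) ^+ 2) `^ (-1)).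
  apply/funext => -[x y] /=; rewrite /poisson !sqr_cnorm powR_inv1 ?addr_ge0 ?sqr_ge0//.
  by rewrite expr1n mul1r ReB ImB.
have m2R : measurable_fun setT (fun p : measurableTypeR R * measurableTypeR R => complex.Re (G p.2)).
  exact: (measurableT_comp mR measurable_snd).
have m2I : measurable_fun setT (fun p : measurableTypeR R * measurableTypeR R => complex.Im (G p.2)).
  exact: (measurableT_comp mI measurable_snd).
have mc : measurable_fun setT (fun p : measurableTypeR R * measurableTypeR R => cos p.1).
  apply: (measurableT_comp _ measurable_fst).
  by apply: continuous_measurable_fun; exact: continuous_cos.
have ms : measurable_fun setT (fun p : measurableTypeR R * measurableTypeR R => sin p.1).
  apply: (measurableT_comp _ measurable_fst).
  by apply: continuous_measurable_fun; exact: continuous_sin.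
apply: measurable_funM.
  apply: measurable_funB; first exact: measurable_cst.
  by apply: measurable_funD; exact: measurable_funX.
apply: (measurableT_comp (measurable_powR _)).
by apply: measurable_funD; apply: measurable_funX; exact: measurable_funB.
Qed.

Section Swap.
Variables (G : measurableTypeR R -> R[i]) (v : measurableTypeR R -> R).
Variables (U A : set (measurableTypeR R)).
Hypothesis mR : measurable_fun setT (fun y => complex.Re (G y)).
Hypothesis mI : measurable_fun setT (fun y => complex.Im (G y)).
Hypothesis G1 : forall y, cnorm (G y) < 1.
Hypothesis mv : measurable_fun setT v.
Hypothesis v0 : forall y, 0 <= v y.
Hypothesis mU : measurable U.
Hypothesis mA : measurable A.

(** Indicators stand for the domains of integration, the exchange being made on the whole plane. *)
Let phi (p : measurableTypeR R * measurableTypeR R) : \bar R :=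
  (poisson 1 (G p.2) p.1 * \1_(Icc `&` U) p.1 * (v p.2 * \1_A p.2))%:E.

Let phi0 p : (0 <= phi p)%E.
Proof.
rewrite lee_fin; apply: mulr_ge0; apply: mulr_ge0; rewrite ?indic_ge0 ?v0//.
exact: poisson_ge0.
Qed.

Let mphi : measurable_fun setT phi.
Proof.
apply/measurable_EFinP; apply: measurable_funM; apply: measurable_funM.
- exact: measurable_poisson_joint.
- apply: (measurableT_comp _ measurable_fst); apply: measurable_indic.
  exact: measurableII.
- exact: (measurableT_comp mv measurable_snd).
- by apply: (measurableT_comp _ measurable_snd); exact: measurable_indic.
Qed.

Let hm_indic y : (\int[mu]_x phi (x, y) = hm (G y) U * (v y * \1_A y)%:E)%E.
Proof.
rewrite /phi/=; under eq_integral do rewrite EFinM.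
rewrite ge0_integralZr//; last 3 first.
- apply/measurable_EFinP; apply: measurable_funM; first exact: measurable_poisson.
  by apply: measurable_indic; exact: measurableII.
- by move=> x _; rewrite lee_fin mulr_ge0// poisson_ge0.
- by rewrite lee_fin mulr_ge0 ?indic_ge0.
congr (_ * _)%E; rewrite /hm [RHS]integral_mulindic.
by apply: eq_integral => x _; rewrite EFinM.
Qed.

Lemma measurable_hm : measurable_fun setT (fun y => hm (G y) U).
Proof.
pose psi (p : measurableTypeR R * measurableTypeR R) : \bar R :=
  (poisson 1 (G p.2) p.1 * \1_(Icc `&` U) p.1)%:E.
rewrite (_ : (fun y => hm (G y) U) = fubini_G mu psi).
  apply: measurable_fun_fubini_tonelli_G.
    apply/measurable_EFinP; apply: measurable_funM.
      exact: measurable_poisson_joint.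
    apply: (measurableT_comp _ measurable_fst); apply: measurable_indic.
    exact: measurableII.
  by move=> p; rewrite lee_fin mulr_ge0// poisson_ge0.
apply/funext => y; rewrite /hm /fubini_G [LHS]integral_mulindic.
by apply: eq_integral => x _; rewrite /psi EFinM.
Qed.

Lemma hm_swap :
  (\int[mu]_(y in A) (hm (G y) U * (v y)%:E) =
   \int[mu]_(x in Icc `&` U) \int[mu]_(y in A) (poisson 1 (G y) x * v y)%:E)%E.
Proof.
transitivity (\int[mu]_y \int[mu]_x phi (x, y))%E.
  rewrite [LHS]integral_mulindic; apply: eq_integral => y _.
  by rewrite hm_indic EFinM muleA.
rewrite -(fubini_tonelli _ mphi phi0) [RHS]integral_mulindic.
apply: eq_integral => x _; rewrite /phi/=.
rewrite (integral_mulindic A) muleC -ge0_integralZl//; last 2 first.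
- apply: emeasurable_funM; last by apply/measurable_EFinP; exact: measurable_indic.
  apply/measurable_EFinP; apply: measurable_funM => //.
  exact: (measurableT_comp (measurable_poisson_joint mR mI) (pair1_measurable x)).
- by move=> y _; rewrite mule_ge0 ?lee_fin ?indic_ge0// mulr_ge0// poisson_ge0.
by apply: eq_integral => y _; rewrite -!EFinM; congr EFin; ring.
Qed.

End Swap.

Definition disc_map F :=
  forall z, cnorm z < 1 -> cdiff F z /\ cnorm (F z) < 1.

Lemma disc_map_ray_measurable F rho : disc_map F -> 0 <= rho < 1 ->
  measurable_fun [set: measurableTypeR R] (fun t => complex.Re (F (rho%:C * cis t))) /\
  measurable_fun [set: measurableTypeR R] (fun t => complex.Im (F (rho%:C * cis t))).
Proof.
move=> dF /andP[r0 r1].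
have c t : {for t, continuous (fun t => F (rho%:C * cis t))}.
  apply: (proj1 (polar_ray_continuous _)); apply: cdiff_continuous.
  by apply: (proj1 (dF _ _)); rewrite cnorm_real_cis.
split; apply: continuous_measurable_fun => t; by have /cvg_complex[] := c t.
Qed.

Lemma poisson_scale rho z t : 0 < rho -> poisson rho (rho%:C * z) t = poisson 1 z t.
Proof.
move=> r0; rewrite /poisson -mulrBr !cnormM cnorm_real (gtr0_norm r0) mul1r !exprMn expr1n.
have -> : rho ^+ 2 - rho ^+ 2 * cnorm z ^+ 2 = rho ^+ 2 * (1 - cnorm z ^+ 2) by ring.
by rewrite -mulf_div divff ?mul1r// expf_neq0// gt_eqF.
Qed.

(** Conjugating the quotient of [poisson_Re] makes it holomorphic in the interior point. So
    [u -> poisson 1 (F u) x] is the real part of a holomorphic function, and the Poisson formula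
    applies on the circle of radius [rho]. *)
Lemma poisson_subordination F rho z x : disc_map F -> 0 < rho < 1 -> cnorm z < 1 ->
  (\int[mu]_(t in Icc) (poisson 1 (F (rho%:C * cis t)) x * poisson 1 z t)%:E =
   (2 * pi)%:E * (poisson 1 (F (rho%:C * z)) x)%:E)%E.
Proof.
move=> dF /andP[r0 r1] z1.
have disc u : cnorm u <= rho -> cnorm u < 1 by move=> ur; rewrite (le_lt_trans ur).
pose q u : R[i] := (1 + F u * conjc (cis x)) / (1 - F u * conjc (cis x)).
have den u : cnorm u < 1 -> 1 - F u * conjc (cis x) != 0.
  move=> u1; rewrite subr_eq0; apply/eqP => /(congr1 (@cnorm R)).
  rewrite cnorm1 cnormM cnorm_conj cnorm_cis mulr1 => F1.
  by have [_] := dF _ u1; rewrite -F1 ltxx.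
have qd u : cnorm u <= rho -> cdiff q u.
  move=> /disc u1; have [dFu _] := dF _ u1; apply: cdiffM.
    by apply: cdiffD; [exact: cdiff_cst|apply: cdiffM => //; exact: cdiff_cst].
  apply: cdiffV; first exact: den.
  by apply: cdiffB; [exact: cdiff_cst|apply: cdiffM => //; exact: cdiff_cst].
have qE u : cnorm u < 1 -> complex.Re (q u) = poisson 1 (F u) x.
  move=> u1; have [_ Fu1] := dF _ u1.
  rewrite (poisson_Re Fu1) expr1n mul1r.
  have Reconj (w : R[i]) : complex.Re (conjc w) = complex.Re w by case: w.
  rewrite -[LHS]Reconj /q rmorphM fmorphV rmorphD rmorphB !rmorphM !rmorph1.
  by rewrite -[in RHS](conjcK (cis x)).
have zr : cnorm (rho%:C * z) < rho by rewrite cnormM cnorm_real gtr0_norm// gtr_pMr.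
have := poisson_formula_Re zr (fun u p => cdiff_continuous (qd u p))
  (fun u p => qd u (proj2 (andP p))).
rewrite qE; last by rewrite disc// ltW.
move=> E; rewrite -EFinM -E /Rintegral fineK.
  apply: eq_integral => t _; rewrite poisson_scale// qE ?cnorm_real_cis ?(ltW r0)//.
  by rewrite mulrC.
apply: integrable_fin_num => //.
apply: continuous_integrable => t _; apply: cvgM; first exact: continuous_poisson.
have zn : cnorm (rho%:C * cis t) <= rho by rewrite cnorm_real_cis// ltW.
by have /cvg_complex[] := proj1 (polar_ray_continuous (cdiff_continuous (qd _ zn))).
Qed.

Lemma hm_subordination F rho z U : disc_map F -> 0 < rho < 1 -> cnorm z < 1 ->
  measurable U ->
  (\int[mu]_(t in Icc) (hm (F (rho%:C * cis t)%R) U * (poisson 1 z t)%:E) =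
   (2 * pi)%:E * hm (F (rho%:C * z)%R) U)%E.
Proof.
move=> dF /[dup] r01 /andP[r0 r1] z1 mU.
have [mR mI] := @disc_map_ray_measurable F rho dF ltac:(by rewrite (ltW r0)).
rewrite hm_swap//; last 3 first.
- by move=> t; apply: (proj2 (dF _ _)); rewrite cnorm_real_cis// ltW.
- exact: measurable_poisson.
- by move=> t; rewrite poisson_ge0.
under eq_integral do rewrite poisson_subordination//.
rewrite /hm ge0_integralZl//.
- exact: measurableII.
- apply: measurable_poissonE; apply: (proj2 (dF _ _)).
  by rewrite cnormM cnorm_real gtr0_norm// mulr_ilt1 ?cnorm_ge0// ltW.
- move=> t _; rewrite lee_fin poisson_ge0//; apply: (proj2 (dF _ _)).
  by rewrite cnormM cnorm_real gtr0_norm// mulr_ilt1 ?cnorm_ge0// ltW.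
- by rewrite lee_fin ltW// two_pi_gt0.
Qed.

End HarmonicMeasureFubini.

(** * Chords of the circle *)

Section Chords.
Variable R : realType.
Implicit Types (s t x d : R).

Lemma sqr_cnorm_cisB s t : cnorm (cis s - cis t) ^+ 2 = 2 - 2 * cos (s - t).
Proof.
rewrite sqr_cnorm ReB ImB/= cosB.
have := cos2Dsin2 s; have := cos2Dsin2 t; nra.
Qed.

Lemma cos_le_cos x d : 0 <= d -> d <= pi -> d <= `|x| -> `|x| <= 2 * pi - d ->
  cos x <= cos d.
Proof.
move=> d0 dpi dx xd; rewrite -cos_norm.
have mono y z : 0 <= y -> y <= z -> z <= pi -> cos z <= cos y.
  move=> y0 yz zpi; move: yz; rewrite le_eqVlt => /predU1P[->//|yz].
  by rewrite ltW// ltr_cos// in_itv/=; apply/andP; split; lra.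
have [xpi|pix] := leP `|x| pi; first exact: mono.
have -> : cos `|x| = cos (2 * pi - `|x|).
  by rewrite -cosN -cosD2pi; congr cos; rewrite mulr2n; ring.
by apply: mono; lra.
Qed.

(** The two bounds on [|s - t|] keep the angles at least [d] apart modulo [2 * pi]. *)
Lemma cnorm_cisB_ge s t d : 0 <= d -> d <= pi ->
  d <= `|s - t| -> `|s - t| <= 2 * pi - d ->
  2 - 2 * cos d <= cnorm (cis s - cis t) ^+ 2.
Proof.
move=> d0 dpi ds sd; rewrite sqr_cnorm_cisB.
by have := cos_le_cos d0 dpi ds sd; lra.
Qed.

Lemma chord_gt0 d : 0 < d -> d <= pi -> 0 < 2 - 2 * cos d.
Proof.
move=> d0 dpi; have : cos d < cos 0.
  by rewrite ltr_cos// in_itv/=; apply/andP; split; lra.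
rewrite cos0; lra.
Qed.

End Chords.

(** * Harmonic measure of preimages *)

Section Pullback.
Variable R : realType.
Local Notation mu := (@lebesgue_measure R).
Local Notation Icc := (`[0, 2 * pi]%classic : set (measurableTypeR R)).
Implicit Types (f g h k F : R[i] -> R[i]) (r t s rho : R) (z u w : R[i]).
Implicit Types (U V W A D : set (measurableTypeR R)).

(** The approach to [cis s] is unrestricted. This is the behaviour at interior points of [U], which
    is why general sets are approximated from outside. *)
Definition full_at U s := forall e : R, 0 < e -> exists2 d : R, 0 < d &
  forall z, cnorm z < 1 -> cnorm (z - cis s) < d ->
    ((2 * pi * (1 - e))%:E <= hm z U)%E.

Lemma full_at_nbhd U s (d : R) : measurable U -> 0 < d ->
  (forall t, Icc t -> cnorm (cis t - cis s) < d -> U t) -> full_at U s.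
Proof.
move=> mU d0 dU e e0.
(* Within [c] of [cis s], the numerator of the kernel is at most [2 * c <= e * (d / 2) ^ 2], while
   the points outside [U] are at distance at least [d / 2]. *)
pose c := Num.min (d / 2) (e * d ^+ 2 / 8).
have d20 : 0 < d ^+ 2 by rewrite exprn_gt0.
have c0 : 0 < c by rewrite lt_min divr_gt0//= divr_gt0// mulr_gt0.
have cd : c <= d / 2 by rewrite /c ge_min lexx.
have ce : c <= e * d ^+ 2 / 8 by rewrite /c ge_min lexx orbT.
exists c => // z z1 zs.
have far t : Icc t -> (~` U) t -> poisson 1 z t <= e.
  move=> It nUt; have ds : d <= cnorm (cis t - cis s).
    by rewrite leNgt; apply/negP => /(dU t It).
  have := ler_cnorm_dist (cis t) z (cis s); rewrite /poisson mul1r expr1n.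
  have : 1 - cnorm z <= cnorm (z - cis s).
    by rewrite cnorm_distC -(cnorm_cis s); exact: ler_cnorm_sub.
  have := cnorm_ge0 z.
  move: (cnorm (cis t - z)) (cnorm (z - cis s)) (cnorm z) ds zs z1 => y b x ds bc x1 x0 xb yb.
  have yd : d / 2 <= y by lra.
  have y0 : 0 < y by lra.
  rewrite ler_pdivrMr ?exprn_gt0//.
  have : (d / 2) ^+ 2 <= y ^+ 2 by rewrite ler_pXn2r// nnegrE; lra.
  move: (y ^+ 2) => yy Hyy.
  have : e * (d / 2) ^+ 2 <= e * yy by rewrite ler_pM2l.
  have -> : 1 - x ^+ 2 = (1 - x) * (1 + x) by ring.
  have : (1 - x) * (1 + x) <= c * 2 by apply: ler_pM; lra.
  by rewrite exprMn; lra.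
have nU : (hm z (~` U) <= (2 * pi * e)%:E)%E.
  apply: (le_trans (hm_le_cst z1 (measurableC mU) far)).
  rewrite (_ : 2 * pi * e = e * (2 * pi)); last by ring.
  rewrite EFinM -mu_Icc lee_wpmul2l ?lee_fin ?(ltW e0)//.
  apply: le_measure; rewrite ?inE//; first by apply: measurableII; exact: measurableC.
have := hmC z1 mU; have := hm_fin_num z1 mU; have := hm_fin_num z1 (measurableC mU).
move: nU; case: (hm z U) => // x; case: (hm z (~` U)) => // y.
rewrite !lee_fin => ye _ _ /eqP; rewrite -EFinD eqe => /eqP xy.
lra.
Qed.

Lemma limn_einf_le (u : nat -> \bar R) c m :
  (forall n, (m <= n)%N -> (u n <= c)%E) -> (limn_einf u <= c)%E.
Proof.
move=> uc; rewrite limn_einf_lim; apply: lime_le; first exact: is_cvg_einfs.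
exists m => // n /= mn; apply: le_trans (uc n mn).
by apply: ereal_inf_lbound; exists n => /=.
Qed.

Lemma limn_einf_ge (u : nat -> \bar R) c m :
  (forall n, (m <= n)%N -> (c <= u n)%E) -> (c <= limn_einf u)%E.
Proof.
move=> uc; rewrite limn_einf_lim; apply: lime_ge; first exact: is_cvg_einfs.
exists m => // n /= mn; apply: le_ereal_inf_tmp => _ [k /= nk <-].
by apply: uc; rewrite (leq_trans mn).
Qed.

Lemma le_of_le_succV (c : R) (L : \bar R) : 0 <= c ->
  (forall k : nat, ((c * (1 - k.+1%:R^-1))%:E <= L)%E) -> (c%:E <= L)%E.
Proof.
move=> c0; case: L => [l|_|/(_ 0%N)]; last by rewrite leeNy_eq.
  move=> H; rewrite lee_fin; apply/ler_addgt0Pr => e e0.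
  have ce0 : 0 <= c / e by rewrite divr_ge0// ltW.
  have := H (Num.bound (c / e)); rewrite lee_fin.
  have := archi_boundP ce0; set n := Num.bound _ => cn.
  have n0 : 0 < n.+1%:R :> R by rewrite ltr0n.
  have : c / n.+1%:R <= e.
    rewrite ler_pdivrMr//; rewrite ltr_pdivrMr// in cn.
    by rewrite (le_trans (ltW cn))// mulrC ler_wpM2l ?(ltW e0)// ler_nat leqnSn.
  move: (n.+1%:R^-1) => x h1; rewrite mulrBr mulr1 => h2.
  by clear -h1 h2; lra.
by rewrite leey.
Qed.

(** A sequence, since Fatou's lemma is to be applied; the shift by 2 keeps the radii positive. *)
Definition radius (n : nat) : R := 1 - n.+2%:R^-1.

Lemma radius_gt0 n : 0 < radius n.
Proof. by rewrite subr_gt0 invf_lt1 ?ltr1n// ltr0n. Qed.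

Lemma radius_lt1 n : radius n < 1.
Proof. by rewrite ltrBlDr ltrDl invr_gt0 ltr0n. Qed.

Lemma radius_near (e : R) : 0 < e -> exists m, forall n, (m <= n)%N -> 1 - radius n < e.
Proof.
move=> e0; have ie0 : 0 <= e^-1 by rewrite invr_ge0 ltW.
exists (Num.bound e^-1) => n mn; rewrite /radius opprB addrCA subrr addr0.
rewrite invf_plt ?posrE ?ltr0n//; apply: (lt_le_trans (archi_boundP ie0)).
by rewrite ler_nat (leq_trans mn)// -addn2 leq_addr.
Qed.

Definition radial_limit F t w := forall e : R, 0 < e ->
  exists m : nat, forall n, (m <= n)%N -> cnorm (F ((radius n)%:C * cis t) - w) < e.

(* [V] is the set of the [t] such that the lower limit of [hm (F z) U], as [z]
   tends to [cis t] along the radius, is at least [2 * pi]; the estimate of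
   [hm z V] follows from [hm_subordination] and Fatou's lemma. *)
Lemma pullback_full F U : disc_map F -> measurable U ->
  exists V, [/\ measurable V, forall z, cnorm z < 1 -> (hm z V <= hm (F z) U)%E &
    forall t s, radial_limit F t (cis s) -> full_at U s -> V t].
Proof.
move=> dF mU.
have r1 n : cnorm ((radius n)%:C : R[i]) < 1.
  by rewrite cnorm_real gtr0_norm ?radius_gt0// radius_lt1.
have rt1 n t : cnorm ((radius n)%:C * cis t) < 1.
  by rewrite cnorm_real_cis ?radius_lt1// ltW// radius_gt0.
pose g n t := hm (F ((radius n)%:C * cis t)) U.
have mg n : measurable_fun setT (g n : measurableTypeR R -> \bar R).
  have [mR mI] := @disc_map_ray_measurable _ F (radius n) dF
    ltac:(by rewrite radius_lt1 ltW// radius_gt0).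
  by apply: measurable_hm => // t; apply: (proj2 (dF _ _)).
have g0 n t : (0 <= g n t)%E by apply: hm_ge0; apply: (proj2 (dF _ _)).
pose level (k : nat) : \bar R := (2 * pi * (1 - k.+1%:R^-1))%:E.
pose V : set (measurableTypeR R) := \bigcap_k \bigcup_m \bigcap_(n in [set n | (m <= n)%N])
  [set t | (level k <= g n t)%E].
have mlev (k n : nat) : measurable ([set t | (level k <= g n t)%E] : set (measurableTypeR R)).
  have := emeasurable_fun_c_infty measurableT (mg n) (level k).
  by rewrite setTI.
have mV : measurable V.
  apply: bigcapT_measurable => k; apply: bigcupT_measurable => m.
  by apply: bigcap_measurableType => n _; exact: mlev.
exists V; split=> //; last first.
  move=> t s Ft Us j _.
  have k0 : 0 < j.+1%:R^-1 :> R by rewrite invr_gt0 ltr0n.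
  have [d d0 dP] := Us _ k0; have [m mP] := Ft _ d0.
  exists m => // n /= mn; apply: dP; last exact: mP.
  by apply: (proj2 (dF _ _)).
move=> z z1.
have Fz1 : cnorm (F z) < 1 := proj2 (dF _ z1).
have pi20 : (0 <= (2 * pi)%:E :> \bar R)%E by rewrite lee_fin ltW// two_pi_gt0.
pose f n (t : measurableTypeR R) := (g n t * (poisson 1 z t)%:E)%E.
have mf n : measurable_fun Icc (f n).
  apply: emeasurable_funM; last exact: measurable_poissonE.
  exact: measurable_funS (mg n).
have f0 n t : Icc t -> (0 <= f n t)%E by move=> _; rewrite mule_ge0 ?lee_fin ?poisson_ge0.
have := fatou (mu : {measure set _ -> \bar R}) (measurable_itv _) mf f0.
have lo : ((2 * pi)%:E * hm z V <= \int[mu]_(x in Icc) limn_einf (f^~ x))%E.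
  rewrite /hm -ge0_integralZl//; [|exact: measurableII|exact: measurable_poissonE|]; last first.
    by move=> t _; rewrite lee_fin poisson_ge0.
  have einf0 t : Icc t -> (0 <= limn_einf (f ^~ t))%E.
    by move=> It; apply: (@limn_einf_ge _ _ 0%N) => n _; exact: f0.
  have meinf : measurable_fun Icc (fun t => limn_einf (f ^~ t)).
    rewrite /limn_einf; apply: measurableT_comp => //.
    apply: measurable_fun_limn_esup => n.
    by apply: measurableT_comp => //; exact: mf.
  apply: (@le_trans _ _ (\int[mu]_(x in Icc `&` V) limn_einf (f^~ x))%E); last first.
    apply: ge0_subset_integral => //; exact: measurableII.
  apply: ge0_le_integral => //.
  - exact: measurableII.
  - by move=> t _; rewrite mule_ge0// lee_fin poisson_ge0.
  - by apply: emeasurable_funM => //; exact: measurable_poissonE.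
  - exact: measurable_funS meinf.
  move=> t [It Vt]; rewrite -EFinM; apply: le_of_le_succV.
    by rewrite mulr_ge0 ?poisson_ge0// ltW// two_pi_gt0.
  move=> k; have [m _ mP] := Vt k I.
  apply: (@limn_einf_ge _ _ m) => n mn.
  rewrite mulrAC EFinM; apply: lee_wpmul2r; first by rewrite lee_fin poisson_ge0.
  exact: mP.
(* [F] at [radius n] times [z] tends to [F z], where [poisson_usc] controls the harmonic measure
   from above. *)
have hi (e : R) : 0 < e -> (limn_einf (fun n => \int[mu]_(x in Icc) f n x) <=
    (2 * pi)%:E * ((1 + e)%:E * hm (F z) U))%E.
  move=> e0; have [d d0 dP] := poisson_usc Fz1 e0.
  have /cvg_cnormP/(_ _ d0)/nbhs_cnorm[b b0 bP] := cdiff_continuous (proj1 (dF _ z1)).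
  have [m mP] := radius_near b0.
  apply: (@limn_einf_le _ _ m) => n mn.
  rewrite hm_subordination//; last by rewrite radius_gt0 radius_lt1.
  apply: lee_wpmul2l => //.
  have rz : cnorm ((radius n)%:C * z - z) < b.
    have -> : (radius n)%:C * z - z = ((radius n)%:C - 1) * z by ring.
    rewrite cnormM -(rmorph1 (real_complex R)) -rmorphB cnorm_real distrC ger0_norm; last first.
      by rewrite subr_ge0 ltW// radius_lt1.
    apply: (le_lt_trans _ (mP _ mn)); rewrite ger_pMr ?ltW//.
    by rewrite subr_gt0 radius_lt1.
  have [h1 h2] := dP _ (bP _ rz).
  by apply: hm_le_hm => //; rewrite addr_ge0// ltW.
move=> fat.
have fV := hm_fin_num z1 mV; have fU := hm_fin_num Fz1 mU.
have {fat}key (e : R) : 0 < e -> ((2 * pi)%:E * hm z V <= (2 * pi)%:E * ((1 + e)%:E * hm (F z) U))%E.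
  by move=> e0; apply: (le_trans lo); apply: (le_trans fat); exact: hi.
have U0 := hm_ge0 U Fz1.
move: key fV fU U0; case: (hm z V) => // x; case: (hm (F z) U) => // y key _ _.
rewrite !lee_fin => y0; apply/ler_addgt0Pr => e e0.
have y10 : 0 < y + 1 by rewrite ltr_wpDl.
have := key (e / (y + 1)) (divr_gt0 e0 y10); rewrite -!EFinM lee_fin ler_pM2l ?two_pi_gt0//.
move=> /le_trans; apply; rewrite mulrDl mul1r lerD2l mulrAC ler_pdivrMr//.
by rewrite ler_pM2l// lerDl.
Qed.

End Pullback.

(** * Preimages of arbitrary measurable sets *)

Section PullbackGeneral.
Variable R : realType.
Local Notation mu := (@lebesgue_measure R).
Local Notation Icc := (`[0, 2 * pi]%classic : set (measurableTypeR R)).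
Implicit Types (F : R[i] -> R[i]) (r t s rho : R) (z u w : R[i]).
Implicit Types (U V W A D : set (measurableTypeR R)).

Lemma full_at_chord U s (d : R) : measurable U -> 0 < d -> d <= pi ->
  (forall t, Icc t -> (d <= `|t - s| <= 2 * pi - d) \/ U t) -> full_at U s.
Proof.
move=> mU d0 dpi dU; have c0 := chord_gt0 d0 dpi.
apply: (@full_at_nbhd _ _ _ (Num.sqrt (2 - 2 * cos d))) => //.
  by rewrite sqrtr_gt0.
move=> t It ts; have [/andP[h1 h2]|//] := dU t It.
have := cnorm_cisB_ge (ltW d0) dpi h1 h2; rewrite leNgt => /negP; case.
rewrite -(sqr_sqrtr (ltW c0)) ltr_pXn2r// ?nnegrE ?cnorm_ge0 ?sqrtr_ge0//.
Qed.

(** Outer regularity gives the open set [Q]. The intervals [B1] about [0] and [B2] about [2 * pi]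
    are added for [s = 0], whose neighbourhoods on the circle show up at both ends of
    [[0, 2 * pi]]. *)
Lemma circle_outer W (e : R) : measurable W -> 0 < e ->
  exists U, [/\ measurable U, (mu (Icc `&` (U `\` W)) <= e%:E)%E &
    forall s, 0 <= s < 2 * pi -> W s -> full_at U s].
Proof.
move=> mW e0; have mIW : measurable (Icc `&` W) by exact: measurableII.
have IWfin : (mu (Icc `&` W) < +oo)%E.
  apply: (@le_lt_trans _ _ (mu Icc)); last by rewrite mu_Icc ltry.
  by apply: le_measure; rewrite ?inE.
have e20 : 0 < e / 2 by lra.
have [Q [oO WO muO]] := lebesgue_regularity_outer mIW IWfin e20.
(* [B1] and [B2] have total length [4 * d <= e / 2], and [d <= 1] keeps [d] below [pi]. *)
pose d := Num.min (e / 8) 1.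
have d0 : 0 < d by rewrite lt_min ltr01 andbT; lra.
have de : d <= e / 8 by rewrite /d ge_min lexx.
have d1 : d <= 1 by rewrite /d ge_min lexx orbT.
have pi2 := @pi_ge2 R.
pose B1 : set (measurableTypeR R) := `](- d), d[%classic.
pose B2 : set (measurableTypeR R) := `](2 * pi - d), (2 * pi + d)[%classic.
have mO : measurable (Q : set (measurableTypeR R)) by exact: open_measurable.
have mB1 : measurable B1 by exact: measurable_itv.
have mB2 : measurable B2 by exact: measurable_itv.
have mU : measurable (Q `|` B1 `|` B2) by do 2?apply: measurableU.
exists (Q `|` B1 `|` B2); split=> //.
  have muB1 : mu B1 = (2 * d)%:E.
    rewrite /B1 lebesgue_measure_itv/= lte_fin; have -> : - d < d by lra.
    by rewrite -EFinD; congr EFin; lra.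
  have muB2 : mu B2 = (2 * d)%:E.
    rewrite /B2 lebesgue_measure_itv/= lte_fin; have -> : 2 * pi - d < 2 * pi + d by lra.
    by rewrite -EFinD; congr EFin; lra.
  apply: (@le_trans _ _ (mu ((Q `\` (Icc `&` W)) `|` B1 `|` B2))).
    apply: le_measure; rewrite ?inE.
    - by apply: measurableII; exact: measurableD.
    - by do 2?apply: measurableU => //; exact: measurableD.
    - move=> t [It [[[Ot|?]|?] nWt]]; [left; left|left; right|right] => //.
      by split=> // -[_].
  have mOI : measurable (Q `\` (Icc `&` W) : set (measurableTypeR R)) by exact: measurableD.
  apply: (le_trans (measureU2 _ _ _)) => //; first exact: measurableU.
  apply: (@le_trans _ _ ((mu (Q `\` (Icc `&` W)) + mu B1) + mu B2)%E).
    by apply: leeD => //; exact: measureU2.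
  rewrite muB1 muB2.
  apply: (@le_trans _ _ ((e / 2)%:E + (2 * d)%:E + (2 * d)%:E)%E).
    by apply: leeD => //; apply: leeD => //; exact: ltW.
  by rewrite -!EFinD lee_fin; lra.
move=> s /andP[s0 s2] Ws.
move: s0; rewrite le_eqVlt => /predU1P[s0|s0].
  apply: (@full_at_chord _ _ d) => //; first lra.
  move=> t /=; rewrite in_itv/= -s0 subr0 => /andP[t0 t2].
  rewrite ger0_norm//.
  have [td|dt] := ltP t d; first by right; left; right; rewrite /B1/= in_itv/=; apply/andP; split; lra.
  have [td'|dt'] := leP t (2 * pi - d); first by left; apply/andP; split.
  by right; right; rewrite /B2/= in_itv/=; apply/andP; split; lra.
have Os : Q s by apply: WO; split=> //=; rewrite in_itv/= !ltW.
have /nbhs_ballP[b /= b0 bO] : nbhs s Q by exact: open_nbhs_nbhs.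
pose m := Num.min b (Num.min s (2 * pi - s)).
have m0 : 0 < m by rewrite !lt_min b0 s0; lra.
have mb : m <= b by rewrite /m ge_min lexx.
have ms : m <= s by rewrite /m !ge_min lexx orbT.
have ms' : m <= 2 * pi - s by rewrite /m !ge_min lexx !orbT.
apply: (@full_at_chord _ _ m) => //; first lra.
move=> t /=; rewrite in_itv/= => /andP[t0 t2].
have [tm|mt] := ltP `|t - s| m.
  by right; left; left; apply: bO; rewrite /ball/= distrC (lt_le_trans tm).
left; apply/andP; split=> //.
rewrite ler_norml; apply/andP; split; lra.
Qed.

(** [V] is the intersection of the pullbacks of outer approximations of [W] whose excess tends to
    [0]; the factor converting the excess into harmonic measure depends on [F z] alone. As [V]
    merely encloses the radial preimage, the measurability of the latter does not come up. *)
Lemma pullback F W : disc_map F -> measurable W ->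
  exists V, [/\ measurable V, forall z, cnorm z < 1 -> (hm z V <= hm (F z) W)%E &
    forall t s, 0 <= s < 2 * pi -> W s -> radial_limit F t (cis s) -> V t].
Proof.
move=> dF mW.
have H (n : nat) : exists UV : set (measurableTypeR R) * set (measurableTypeR R),
    [/\ measurable UV.1, (mu (Icc `&` (UV.1 `\` W)) <= (n.+1%:R^-1)%:E)%E,
       forall s, 0 <= s < 2 * pi -> W s -> full_at UV.1 s &
       [/\ measurable UV.2, forall z, cnorm z < 1 -> (hm z UV.2 <= hm (F z) UV.1)%E &
    forall t s, radial_limit F t (cis s) -> full_at UV.1 s -> UV.2 t]].
  have n0 : 0 < n.+1%:R^-1 :> R by rewrite invr_gt0 ltr0n.
  have [U [mU muU fU]] := circle_outer mW n0.
  have [V [mV hV rV]] := pullback_full dF mU.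
  by exists (U, V).
have [UV UVP] := choice H.
exists (\bigcap_n (UV n).2); split.
- by apply: bigcapT_measurable => n; have [_ _ _ []] := UVP n.
- move=> z z1; have [_ Fz1] := dF z z1.
  pose C := (1 + cnorm (F z)) / (1 - cnorm (F z)).
  have C0 : 0 <= C.
    by apply: divr_ge0; [rewrite addr_ge0 ?cnorm_ge0|rewrite subr_ge0 ltW].
  have mcap : measurable (\bigcap_n (UV n).2).
    by apply: bigcapT_measurable => n; have [_ _ _ []] := UVP n.
  have key n : (hm z (\bigcap_n (UV n).2) <= hm (F z) W + (C * n.+1%:R^-1)%:E)%E.
    have [mU muU _ [mV hV _]] := UVP n.
    apply: (@le_trans _ _ (hm z (UV n).2)).
      by apply: hm_le => // t [_ tV]; exact: tV.
    apply: (le_trans (hV _ z1)).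
    have mD : measurable ((UV n).1 `\` W) by exact: measurableD.
    apply: (@le_trans _ _ (hm (F z) (W `|` ((UV n).1 `\` W)))).
      apply: hm_le => //; first exact: measurableU.
      by move=> t [_ tU]; have [?|?] := pselect (W t); [left|right].
    rewrite hmU//; last by apply/disj_setPS => t [? []].
    apply: leeD => //; apply: (le_trans (hm_le_mu Fz1 mD)).
    by rewrite -/C (EFinM C); apply: lee_wpmul2l => //; rewrite lee_fin.
  have fV := hm_fin_num z1 mcap; have fW := hm_fin_num Fz1 mW.
  move: key fV fW; case: (hm z _) => // x; case: (hm (F z) W) => // y key _ _.
  rewrite lee_fin; apply/ler_addgt0Pr => e e0.
  have Ce0 : 0 <= C / e by rewrite divr_ge0// ltW.
  have := key (Num.bound (C / e)); have := archi_boundP Ce0.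
  set n := Num.bound _; rewrite -EFinD lee_fin => Cn /le_trans; apply.
  rewrite lerD2l ler_pdivrMr ?ltr0n//; rewrite ltr_pdivrMr// in Cn.
  by rewrite (le_trans (ltW Cn))// mulrC ler_wpM2l ?(ltW e0)// ler_nat leqnSn.
- move=> t s s2 Ws Ft n _; have [_ _ fU [_ _ rV]] := UVP n.
  by apply: rV Ft (fU _ s2 Ws).
Qed.

End PullbackGeneral.

(** * A linear lower bound for chords *)

Section ChordLowerBound.
Variable R : realType.
Implicit Types (s t x d : R).

Lemma sin_ge_linear : exists2 c : R, 0 < c & forall x, 0 <= x <= pi / 2 -> c * x <= sin x.
Proof.
have : \forall x \near (0 : R), 2^-1 < cos x.
  have := @continuous_cos R 0; rewrite /continuous_at cos0 => c0.
  apply: (cvgr_gt _ c0); rewrite invf_lt1// ltr1n//.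
move=> /nbhs_ballP[e /= e0 eP].
pose d := Num.min (e / 2) (pi / 2).
have pi2 := @pi_ge2 R; have pih2 := @pihalf_lt2 R.
have d0 : 0 < d by rewrite lt_min; lra.
have de : d <= e / 2 by rewrite /d ge_min lexx.
have dpi : d <= pi / 2 by rewrite /d ge_min lexx orbT.
have near0 x : 0 <= x -> x <= d -> x / 2 <= sin x.
  rewrite le_eqVlt => /predU1P[<-|x0] xd; first by rewrite sin0 mul0r.
  have [|c] := @MVT R sin cos 0 x x0 (fun y _ => is_derive_sin y).
    by apply: continuous_subspaceT; exact: continuous_sin.
  rewrite in_itv/= sin0 !subr0 => /andP[c0 cx] ->.
  rewrite mulrC ler_wpM2r ?ltW//; apply: eP; rewrite /ball/= sub0r normrN ger0_norm; lra.
(* Beyond [d], [sin x >= sin d >= d / 2], and [x <= pi / 2 < 2]. *)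
exists (d / 4); first lra.
move=> x /andP[x0 xpi].
have [xd|/ltW dx] := leP x d.
  apply: le_trans (near0 x x0 xd); nra.
have sd : d / 2 <= sin d by apply: near0; lra.
have : sin d <= sin x.
  move: dx; rewrite le_eqVlt => /predU1P[->//|dx].
  by rewrite ltW// ltr_sin// in_itv/=; apply/andP; split; lra.
nra.
Qed.

Lemma chord_ge : exists2 c : R, 0 < c &
  forall s t d, 0 <= d <= pi -> d <= `|s - t| <= 2 * pi - d ->
    c * d <= cnorm (cis s - cis t).
Proof.
have [c c0 cP] := sin_ge_linear; exists c => // s t d /andP[d0 dpi] /andP[ds sd].
rewrite -(@ler_pXn2r _ 2)// ?nnegrE ?cnorm_ge0//; last by rewrite mulr_ge0// ltW.
apply: le_trans (cnorm_cisB_ge d0 dpi ds sd).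
have := cP (d / 2); move=> /(_ ltac:(lra)) cd.
have -> : 2 - 2 * cos d = 4 * sin (d / 2) ^+ 2.
  have -> : d = (d / 2) *+ 2 by rewrite mulr2n; lra.
  rewrite cos_mulr2n cos2sin2 [_ *+ 2 / 2](_ : _ = d / 2); last by rewrite mulr2n; lra.
  by rewrite mulr2n; ring.
have : (c * (d / 2)) ^+ 2 <= sin (d / 2) ^+ 2.
  have cd0 : 0 <= c * (d / 2) by rewrite mulr_ge0 ?(ltW c0)// divr_ge0.
  by rewrite ler_pXn2r// nnegrE (le_trans cd0).
by rewrite !exprMn; lra.
Qed.

End ChordLowerBound.

(** * Fatou's theorem and composition of boundary maps *)

Section Density.
Variable R : realType.
Local Notation mu := (@lebesgue_measure R).
Local Notation Icc := (`[0, 2 * pi]%classic : set (measurableTypeR R)).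
Implicit Types (F : R[i] -> R[i]) (r t s rho : R) (z u w : R[i]).
Implicit Types (U V W A D : set (measurableTypeR R)).

(* Far from [cis s] the kernel at [z] is dominated by the kernel at the point
   of height [d] above [cis s], whose total mass is known. *)
Lemma poisson_far z s t (d : R) : cnorm z < 1 -> 0 < d -> d <= 1 ->
  d <= cnorm (cis t - cis s) -> 2 * cnorm (z - cis s) <= cnorm (cis t - cis s) ->
  poisson 1 z t <= 32 * (1 - cnorm z) / d * poisson 1 ((1 - d)%:C * cis s) t.
Proof.
move=> z1 d0 d1 dt zt; rewrite /poisson !mul1r expr1n.
have x0 := cnorm_ge0 z.
have n : cnorm ((1 - d)%:C * cis s) = 1 - d by rewrite cnorm_real_cis ?subr_ge0.
have y1 := ler_cnorm_dist (cis t) z (cis s).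
have y2 : cnorm (cis t - (1 - d)%:C * cis s) <= cnorm (cis t - cis s) + d.
  have -> : cis t - (1 - d)%:C * cis s = (cis t - cis s) + d%:C * cis s.
    by rewrite rmorphB rmorph1; ring.
  by rewrite (le_trans (ler_cnormD _ _))// cnorm_real_cis// ltW.
have y3 : d <= cnorm (cis t - (1 - d)%:C * cis s).
  by rewrite (le_trans _ (ler_cnorm_sub _ _))// n cnorm_cis; lra.
rewrite n; move: (cnorm (cis t - cis s)) (cnorm (z - cis s)) (cnorm (cis t - z))
  (cnorm (cis t - (1 - d)%:C * cis s)) (cnorm z) x0 z1 dt zt y1 y2 y3
  => D b y y' x x0 x1 dD bD Dy y'D dy'.
have D0 : 0 < D by lra.
have y0 : D / 2 <= y by lra.
have yp : 0 < y by lra.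
have y'p : 0 < y' by lra.
have y'2 : y' <= 2 * D by lra.
rewrite ler_pdivrMr ?exprn_gt0// -!mulrA.
have -> : 1 - x ^+ 2 = (1 - x) * (1 + x) by ring.
rewrite (mulrCA 32); rewrite ler_pM2l ?subr_gt0//.
have -> : 32 * (d^-1 * ((1 - (1 - d) ^+ 2) * (y' ^- 2 * y ^+ 2))) =
   32 * (2 - d) * (y ^+ 2 / y' ^+ 2) by field; rewrite !gt_eqF.
have : 16^-1 <= y ^+ 2 / y' ^+ 2.
  rewrite ler_pdivlMr ?exprn_gt0//.
  have : (D / 2) ^+ 2 <= y ^+ 2 by rewrite ler_pXn2r// nnegrE; lra.
  have : y' ^+ 2 <= (2 * D) ^+ 2 by rewrite ler_pXn2r// nnegrE; lra.
  by rewrite !exprMn; lra.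
move: (y ^+ 2 / _) => q q16; nra.
Qed.

Lemma hm_far z s U (d : R) : cnorm z < 1 -> 0 < d -> d <= 1 -> measurable U ->
  (forall t, Icc t -> U t -> d <= cnorm (cis t - cis s) /\
     2 * cnorm (z - cis s) <= cnorm (cis t - cis s)) ->
  (hm z U <= (32 * (1 - cnorm z) / d * (2 * pi))%:E)%E.
Proof.
move=> z1 d0 d1 mU far.
have w1 : cnorm ((1 - d)%:C * cis s) < 1 by rewrite cnorm_real_cis ?subr_ge0//; lra.
have c0 : 0 <= 32 * (1 - cnorm z) / d.
  by rewrite divr_ge0 ?(ltW d0)// mulr_ge0// subr_ge0 ltW.
apply: (@le_trans _ _ ((32 * (1 - cnorm z) / d)%:E * hm ((1 - d)%:C * cis s)%R U)%E).
  apply: hm_le_hm => // t It Ut; have [h1 h2] := far t It Ut.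
  exact: poisson_far.
rewrite [leRHS]EFinM; apply: lee_wpmul2l; first by rewrite lee_fin.
by rewrite -(hm_full w1); apply: hm_le.
Qed.

Lemma density_complement V s (e : R) : measurable V -> V s -> 0 < e ->
  ((mu (V `&` ball s r) * (mu (ball s r))^-1)%E @[r --> 0^'+] --> (\1_V s)%:E) ->
  exists2 r0 : R, 0 < r0 & forall r, 0 < r < r0 ->
    (mu (ball s r `\` V) <= (2 * r * e)%:E)%E.
Proof.
move=> mV Vs e0; rewrite indicE mem_set// => dens.
have N : nbhs (1%:E : \bar R) [set x | ((1 - e)%:E < x)%E].
  rewrite /nbhs/= /ereal_nbhs/=.
  have : \forall y \near (1 : R), 1 - e < y by apply: lt_nbhsr; lra.
  by apply: filterS => y; rewrite lte_fin.
have := dens _ N; rewrite nbhs_simpl/= /at_right /within/= => /nbhs_ballP[r0 /= r00 r0P].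
exists r0 => // r /andP[rp rr0].
have rb : ball (0 : R) r0 r by rewrite /ball/= sub0r normrN gtr0_norm.
have := r0P r rb rp.
have mB : measurable (ball s r : set (measurableTypeR R)) by exact: measurable_ball.
have muB : mu (ball s r) = (2 * r)%:E.
  by rewrite lebesgue_measure_ball ?(ltW rp)// mulr2n; congr EFin; lra.
rewrite muB; have r20 : 0 < 2 * r by lra.
have mVB : measurable (V `&` ball s r) by exact: measurableI.
have mBV : measurable (ball s r `\` V : set (measurableTypeR R)) by exact: measurableD.
have add : (mu (V `&` ball s r) + mu (ball s r `\` V) = (2 * r)%:E)%E.
  rewrite -measureU//; last by apply/seteqP; split=> // t [[Vt _] [_]].
  rewrite -muB; congr (mu _); apply/seteqP; split=> [t [[]|[]]//|t Bt].
  by have [Vt|nVt] := pselect (V t); [left|right].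
have := measure_ge0 mu (V `&` ball s r); have := measure_ge0 mu (ball s r `\` V).
move: add; move: (mu (V `&` _)) (mu (_ `\` _)) => [x||] [y||] //.
rewrite -EFinD => -[xy] y0 x0.
by rewrite inver gt_eqF// -EFinM lte_fin ltr_pdivlMr// lee_fin => h; nra.
Qed.

(** Valid at density points of [V]. With [h = 1 - |z|], the complement of [V] is cut at distance
    [r = h * L] from [s]: inside, the kernel is at most [2 / h] and density makes the set small;
    outside, [hm_far] gives [O(h / r)], small when [L] is large. *)
Lemma hm_density V : measurable V ->
  {ae mu, forall s, V s -> 0 < s < 2 * pi -> forall M e : R, 0 < e ->
     exists2 d : R, 0 < d & forall z, cnorm z < 1 ->
       cnorm (z - cis s) < M * (1 - cnorm z) -> cnorm (z - cis s) < d ->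
       ((2 * pi * (1 - e))%:E <= hm z V)%E}.
Proof.
move=> mV; have := lebesgue_density mV.
apply: (@filterS _ _ (ae_filter_ringOfSetsType mu)) => s dens Vs /andP[s0 s2] M e e0.
have [c c0 cP] := chord_ge R.
(* The second entry gives [2 * |z - cis s| <= c * r], as [hm_far] requires; the third makes the far
   part at most [pi * e]. The density tolerance [e / (4 * L)] makes the near part at most [e], and
   [e + pi * e <= 2 * pi * e]. *)
pose L := Num.max 1 (Num.max (2 * M / c) (64 / (c * e))).
have L1 : 1 <= L by rewrite /L le_max lexx.
have LM : 2 * M / c <= L by rewrite /L !le_max lexx orbT.
have Le : 64 / (c * e) <= L by rewrite /L !le_max lexx !orbT.
have L0 : 0 < L by lra.
have eL0 : 0 < e / (4 * L) by rewrite divr_gt0// mulr_gt0.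
have [r0 r00 r0P] := density_complement mV Vs eL0 dens.
(* For [r < m] the interval about [s] does not wrap around the circle, [c * r <= 1], and the density
   estimate applies. *)
pose m := Num.min r0 (Num.min (Num.min s (2 * pi - s)) c^-1).
have m0 : 0 < m by rewrite !lt_min r00 s0 invr_gt0 c0 subr_gt0 s2.
have mr : m <= r0 by rewrite /m ge_min lexx.
have ms : m <= s by rewrite /m !ge_min lexx ?orbT.
have ms' : m <= 2 * pi - s by rewrite /m !ge_min lexx ?orbT.
have mc : m <= c^-1 by rewrite /m !ge_min lexx ?orbT.
exists (m / L); first by rewrite divr_gt0.
move=> z z1 zM; rewrite ltr_pdivlMr// => zm.
set h := 1 - cnorm z in zM; have h0 : 0 < h by rewrite subr_gt0.
have hz : h <= cnorm (z - cis s).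
  by rewrite /h cnorm_distC -(cnorm_cis s); exact: ler_cnorm_sub.
pose r := h * L; have rp : 0 < r by rewrite mulr_gt0.
have rm : r < m by apply: le_lt_trans zm; rewrite ler_pM2r.
have mB : measurable (ball s r : set (measurableTypeR R)) by exact: measurable_ball.
have mN : measurable (ball s r `\` V : set (measurableTypeR R)) by exact: measurableD.
have mCV : measurable (~` V) by exact: measurableC.
have mF : measurable (~` V `\` (ball s r : set (measurableTypeR R))) by exact: measurableD.
have near_le : (hm z (ball s r `\` V) <= e%:E)%E.
  apply: (le_trans (hm_le_mu z1 mN)).
  have rr0 : 0 < r < r0 by rewrite rp (lt_le_trans rm).
  apply: (@le_trans _ _ ((2 / h)%:E * (2 * r * (e / (4 * L)))%:E)%E).
    apply: lee_pmul.
    - by rewrite lee_fin divr_ge0 ?(ltW h0)// addr_ge0 ?cnorm_ge0.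
    - exact: measure_ge0.
    - rewrite lee_fin ler_pM2r ?invr_gt0//; lra.
    - apply: le_trans (r0P r rr0); apply: le_measure; rewrite ?inE//.
      exact: measurableII.
  by rewrite -EFinM lee_fin /r le_eqVlt; apply/orP; left; apply/eqP; field; rewrite !gt_eqF.
have far_le : (hm z (~` V `\` ball s r) <= (pi * e)%:E)%E.
  have cr0 : 0 < c * r by rewrite mulr_gt0.
  have cr1 : c * r <= 1 by rewrite mulrC -ler_pdivlMr// mul1r; lra.
  apply: (@le_trans _ _ (32 * (1 - cnorm z) / (c * r) * (2 * pi))%:E).
    apply: (hm_far (s := s)) => // t; rewrite /= in_itv/= => /andP[t0 t2] [_ nB].
    have rt : r <= `|t - s|.
      by rewrite leNgt; apply/negP => tr; apply: nB; rewrite /ball/= distrC.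
    have D : c * r <= cnorm (cis t - cis s).
      apply: cP; first by apply/andP; split; lra.
      by rewrite rt/= ler_norml; apply/andP; split; lra.
    split=> //; apply: le_trans D.
    have : 2 * M * h <= c * r.
      have LM' : 2 * M <= L * c by rewrite -ler_pdivrMr.
      by have := ler_wpM2l (ltW h0) LM'; rewrite /r; lra.
    lra.
  rewrite lee_fin -/h /r.
  have -> : 32 * h / (c * (h * L)) * (2 * pi) = pi * (64 / (c * L)).
    by field; rewrite !gt_eqF.
  rewrite ler_pM2l ?pi_gt0// ler_pdivrMr ?mulr_gt0//.
  by move: Le; rewrite ler_pdivrMr ?mulr_gt0//; nra.
have tot : (hm z (~` V) <= e%:E + (pi * e)%:E)%E.
  apply: (@le_trans _ _ (hm z ((ball s r `\` V) `|` (~` V `\` ball s r)))).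
    apply: hm_le => //; first exact: measurableU.
    by move=> t [_ nV]; have [?|?] := pselect (ball s r t); [left|right].
  rewrite hmU//; last by apply/disj_setPS => t [[? _] []].
  exact: leeD.
have := hmC z1 mV; have := hm_fin_num z1 mV; have := hm_fin_num z1 mCV.
move: tot; case: (hm z V) => // x; case: (hm z (~` V)) => // y.
rewrite -EFinD !lee_fin => ye _ _ /eqP; rewrite -EFinD eqe => /eqP xy.
have := @pi_ge2 R; nra.
Qed.

End Density.

(** * Nontangential limits and their composition *)

Section BoundaryLimits.
Variable R : realType.
Local Notation mu := (@lebesgue_measure R).
Local Notation Icc := (`[0, 2 * pi]%classic : set (measurableTypeR R)).
Implicit Types (F G : R[i] -> R[i]) (r t s rho : R) (z u w l : R[i]).
Implicit Types (U V W A D E : set (measurableTypeR R)).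

Lemma unit_discE z : unit_disc z = (cnorm z < 1) :> Prop.
Proof. by rewrite /unit_disc/= norm_cnormE -(rmorph1 (real_complex R)) ltcR. Qed.

Lemma unit_circleE z : unit_circle z <-> cnorm z = 1.
Proof.
rewrite /unit_circle/= norm_cnormE -(rmorph1 (real_complex R)).
by split=> [/complexI|->].
Qed.

Lemma stolzE (M : R) w z :
  stolz M w z <-> (cnorm z < 1 /\ cnorm (z - w) < M * (1 - cnorm z)).
Proof.
rewrite /stolz/= unit_discE !norm_cnormE -(rmorph1 (real_complex R)) -rmorphB -rmorphM.
by rewrite ltcR.
Qed.

Lemma nontangential_limitP F w l : nontangential_limit F w l <->
  forall M e : R, 0 < e -> exists2 d : R, 0 < d & forall z, cnorm z < 1 ->
    cnorm (z - w) < M * (1 - cnorm z) -> cnorm (z - w) < d -> cnorm (F z - l) < e.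
Proof.
split=> [nt M e e0|H M].
  have /cvg_cnormP/(_ _ e0) := nt M.
  rewrite near_withinE => /nbhs_cnorm[d d0 dP].
  by exists d => // z z1 zM zd; apply: dP => //; apply/stolzE.
apply/cvg_cnormP => e e0; have [d d0 dP] := H M e e0.
rewrite near_withinE; apply/nbhs_cnorm; exists d => // z zd /stolzE[z1 zM].
exact: dP.
Qed.

Lemma nontangential_radial F t l : nontangential_limit F (cis t) l ->
  radial_limit F t l.
Proof.
(* On the radius [|z - cis t| = 1 - |z|], so it lies in the region of aperture 2. *)
move=> /nontangential_limitP nt e e0; have [d d0 dP] := nt 2 e e0.
have [m mP] := radius_near d0; exists m => n mn.
have r0 := radius_gt0 R n; have r1 := radius_lt1 R n.
have E : cnorm ((radius R n)%:C * cis t - cis t) = 1 - radius R n.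
  have -> : (radius R n)%:C * cis t - cis t = (radius R n - 1)%:C * cis t.
    by move: (radius R n) => r; rewrite rmorphB rmorph1; ring.
  by rewrite cnormM cnorm_cis mulr1 cnorm_real ler0_norm ?opprB// subr_le0 ltW.
have N : cnorm ((radius R n)%:C * cis t) = radius R n by rewrite cnorm_real_cis// ltW.
by apply: dP; rewrite ?E ?N//; [lra|exact: mP].
Qed.

Lemma circle_angle l : cnorm l = 1 -> exists2 s, 0 <= s < 2 * pi & l = cis s.
Proof.
move=> l1; have := sqr_cnorm l; rewrite l1 expr1n.
case: l {l1} => x y /= xy; have pi0 := @pi_gt0 R.
have x1 : -1 <= x <= 1 by apply/andP; split; nra.
have sy : sin (acos x) = `|y|.
  by rewrite sin_acos// (_ : 1 - x ^+ 2 = y ^+ 2) ?sqrtr_sqr//; lra.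
have cx : cos (acos x) = x by rewrite acosK// in_itv.
have [y0|y0] := leP 0 y.
  exists (acos x); last by rewrite /cis cx sy ger0_norm.
  by rewrite acos_ge0//= (le_lt_trans (acos_lepi x1))//; lra.
exists (2 * pi - acos x).
  have a0 : 0 < acos x by apply: acos_gt0; apply/andP; split; nra.
  by have := acos_lepi x1 => a1; apply/andP; split; lra.
have -> : cis (2 * pi - acos x) = cis (- acos x) :> R[i] by rewrite addrC cisD2pi.
by rewrite /cis cosN sinN cx sy ltr0_norm// opprK.
Qed.

Lemma hm_weighted_le z U (f : R -> R) (c : R) : cnorm z < 1 -> measurable U ->
  measurable_fun [set: measurableTypeR R] (f : measurableTypeR R -> R) ->
  0 <= c -> (forall t, Icc t -> U t -> 0 <= f t <= c) ->
  (\int[mu]_(t in Icc `&` U) (f t * poisson 1 z t)%:E <= c%:E * hm z U)%E.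
Proof.
move=> z1 mU mf c0 fc; have mI := measurableII mU.
rewrite /hm -ge0_integralZl//; [|exact: measurable_poissonE|]; last first.
  by move=> t _; rewrite lee_fin poisson_ge0.
apply: ge0_le_integral => //.
- by move=> t [It Ut]; have /andP[f0 _] := fc t It Ut; rewrite lee_fin mulr_ge0// poisson_ge0.
- apply/measurable_EFinP; apply: measurable_funM; last exact: measurable_poisson.
  exact: measurable_funS mf.
- by apply: emeasurable_funM => //; exact: measurable_poissonE.
- move=> t [It Ut]; have /andP[_ fle] := fc t It Ut.
  by rewrite -EFinM lee_fin ler_wpM2r// poisson_ge0.
Qed.

(* Integrating [|cis t - cis s|^2] against the kernel at [z] gives
   [2 - 2 Re (conj (cis s) z)], which dominates [|z - cis s|^2]. *)
Lemma hm_concentration z s E (d e : R) : cnorm z < 1 -> measurable E ->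
  0 <= d -> (forall t, Icc t -> E t -> cnorm (cis t - cis s) <= d) ->
  ((2 * pi * (1 - e))%:E <= hm z E)%E ->
  cnorm (z - cis s) ^+ 2 <= d ^+ 2 + 4 * e.
Proof.
move=> z1 mE d0 Ed zE.
pose f t := cnorm (cis t - cis s) ^+ 2.
have fE t : f t = 2 - 2 * complex.Re (conjc (cis s) * cis t).
  by rewrite /f sqr_cnorm_cisB cosB /=; ring.
have cf : continuous (f : R -> R).
  move=> t; rewrite /f; under eq_fun do rewrite sqr_cnorm_cisB.
  apply: cvgB; first exact: cvg_cst.
  apply: cvgM; first exact: cvg_cst.
  apply: (@continuous_comp _ _ _ (fun t : R => t - s) cos); last exact: continuous_cos.
  by apply: cvgB; [exact: cvg_id|exact: cvg_cst].
have mf : measurable_fun [set: measurableTypeR R] (f : measurableTypeR R -> R).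
  exact: continuous_measurable_fun.
pose q u : R[i] := 2%:C - 2%:C * (conjc (cis s) * u).
have qd u : cdiff q u.
  apply: cdiffB; first exact: cdiff_cst.
  apply: cdiffM; first exact: cdiff_cst.
  by apply: cdiffM; [exact: cdiff_cst|exact: cdiff_id].
have qRe u : complex.Re (q u) = 2 - 2 * complex.Re (conjc (cis s) * u).
  by rewrite /q; case: (conjc (cis s) * u) => a b /=; ring.
have := poisson_formula_Re z1 (fun u _ => cdiff_continuous (qd u)) (fun u _ => qd u).
under eq_Rintegral do rewrite mul1r qRe -fE mulrC.
rewrite qRe => PF.
have PI : (\int[mu]_(t in Icc) (f t * poisson 1 z t)%:E =
    (2 * pi * (2 - 2 * complex.Re (conjc (cis s) * z)))%:E)%E.
  rewrite -PF /Rintegral fineK//; apply: integrable_fin_num => //.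
  apply: continuous_integrable => t _; apply: cvgM; first exact: cf.
  exact: continuous_poisson.
have mCE := measurableC mE.
have split_ : (\int[mu]_(t in Icc) (f t * poisson 1 z t)%:E =
   \int[mu]_(t in Icc `&` E) (f t * poisson 1 z t)%:E +
   \int[mu]_(t in Icc `&` ~` E) (f t * poisson 1 z t)%:E)%E.
  rewrite -ge0_integral_setU//; [|exact: measurableII|exact: measurableII|..].
  - by rewrite -setIUr setUv setIT.
  - apply/measurable_EFinP; apply: measurable_funM; last exact: measurable_poisson.
    exact: measurable_funS mf.
  - by move=> t _; rewrite lee_fin mulr_ge0 ?poisson_ge0// sqr_ge0.
  - by apply/disj_setPS => t [[_ ?] [_]].
have le1 := @hm_weighted_le z E f (d ^+ 2) z1 mE mf (sqr_ge0 _).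
have le2 := @hm_weighted_le z (~` E) f 4 z1 mCE mf (ltac:(by [])).
have {}le1 : (\int[mu]_(t in Icc `&` E) (f t * poisson 1 z t)%:E <= (d ^+ 2)%:E * hm z E)%E.
  by apply: le1 => t It Et; rewrite sqr_ge0/= ler_pXn2r ?nnegrE ?cnorm_ge0//; exact: Ed.
have {}le2 : (\int[mu]_(t in Icc `&` ~` E) (f t * poisson 1 z t)%:E <= 4%:E * hm z (~` E))%E.
  by apply: le2 => t _ _; rewrite sqr_ge0/= /f sqr_cnorm_cisB; have := cos_geN1 (t - s); lra.
have : cnorm (z - cis s) ^+ 2 <= 2 - 2 * complex.Re (conjc (cis s) * z).
  have : cnorm z ^+ 2 <= 1 by rewrite expr_le1 ?cnorm_ge0// ltW.
  rewrite !sqr_cnorm ReB ImB; have := cos2Dsin2 s.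
  by case: (z) => a b /=; nra.
move=> /le_trans; apply.
have tot := hmC z1 mE; have f1 := hm_fin_num z1 mE; have f2 := hm_fin_num z1 mCE.
have h0 := hm_ge0 (~` E) z1.
have := leeD le1 le2; rewrite -split_ PI.
move: zE tot f1 f2 h0; case: (hm z E) => // x; case: (hm z (~` E)) => // y.
rewrite lee_fin => xe /eqP; rewrite -EFinD eqe => /eqP xy _ _.
rewrite lee_fin -!EFinM -EFinD lee_fin => y0 H.
have pi0 := @two_pi_gt0 R.
rewrite -(ler_pM2l pi0) (le_trans H)//.
have : d ^+ 2 * x <= d ^+ 2 * (2 * pi) by rewrite ler_wpM2l ?sqr_ge0//; lra.
nra.
Qed.

(** Restricted to the range of angles in which [hm_density] applies. *)
Definition boundary_inner F :=
  {ae mu, forall t, 0 < t < 2 * pi ->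
     exists2 l, cnorm l = 1 & nontangential_limit F (cis t) l}.

Lemma boundary_inner_id : boundary_inner id.
Proof.
apply: aeW => t _; exists (cis t); first exact: cnorm_cis.
by apply/nontangential_limitP => M e e0; exists e.
Qed.

Lemma mu_null_of_hm0 V : measurable V -> (hm 0%R V <= 0)%E ->
  mu.-negligible (Icc `&` V).
Proof.
move=> mV; rewrite hm0// => V0; apply/negligibleP; first exact: measurableII.
by apply/eqP; rewrite eq_le V0 measure_ge0.
Qed.

Lemma ler_dist_width (a b x y : R) :
  a <= x < a + b -> a <= y < a + b -> `|x - y| <= b.
Proof. by move=> ? ?; rewrite ler_norml; lra. Qed.

(** No approach region is followed through [F]. For almost every [t], [F] has a limit [cis s] at
    [cis t], and [G] a limit [cis s'] at [cis s], since the pullback of the exceptional set of [G]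
    is null. If [s'] lies in a short interval [E], then [t] lies in the set [V] obtained by pulling
    [E] back through both maps, and almost every point of [V] is a density point. So [hm z V], and
    with it [hm (G (F z)) E], becomes nearly full nontangentially, and [hm_concentration] puts
    [G (F z)] near [cis s']. *)
Lemma boundary_inner_comp F G : disc_map F -> disc_map G ->
  boundary_inner F -> boundary_inner G -> boundary_inner (G \o F).
Proof.
move=> dF dG bF bG.
have [N0 [mN0 muN0 N0P]] := bG.
(* [0] is added because [boundary_inner G] says nothing at that angle. *)
pose W0 : set (measurableTypeR R) := N0 `|` [set 0].
have mW0 : measurable W0 by apply: measurableU.
have muW0 : mu (Icc `&` W0) = 0%E.
  apply/eqP; rewrite eq_le measure_ge0 andbT.
  apply: (@le_trans _ _ (mu W0)); first by apply: le_measure; rewrite ?inE//; exact: measurableII.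
  apply: (le_trans (measureU2 _ _ _)) => //.
  rewrite -[leRHS](adde0 0%E); apply: leeD; first by rewrite -muN0.
  by rewrite -(lebesgue_measure_set1 (0 : R)).
have [V0 [mV0 hV0 rV0]] := pullback dF mW0.
have z01 : cnorm (0 : R[i]) < 1 by rewrite cnorm0.
have V0null : mu.-negligible (Icc `&` V0).
  apply: mu_null_of_hm0 => //; apply: (le_trans (hV0 _ z01)).
  apply: (le_trans (hm_le_mu (proj2 (dF _ z01)) mW0)).
  by rewrite muW0 mule0.
(* A countable family of intervals, with members of arbitrarily small length around every [s'];
   countability lets the exceptional null sets be united. *)
pose E (p : nat * nat) : set (measurableTypeR R) :=
  `[p.1%:R / p.2.+1%:R, (p.1.+1)%:R / p.2.+1%:R[%classic.
have mE p : measurable (E p) by exact: measurable_itv.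
have H (p : nat * nat) : exists V, [/\ measurable V,
    forall z, cnorm z < 1 -> (hm z V <= hm (G (F z)) (E p))%E &
    forall t s s', 0 <= s < 2 * pi -> 0 <= s' < 2 * pi -> E p s' ->
      radial_limit G s (cis s') -> radial_limit F t (cis s) -> V t].
  have [W [mW hW rW]] := pullback dG (mE p).
  have [V [mV hV rV]] := pullback dF mW.
  exists V; split=> //.
    move=> z z1; apply: (le_trans (hV _ z1)); apply: hW; exact: (proj2 (dF _ z1)).
  by move=> t s s' s2 s'2 Es' Gs Ft; apply: rV Ft => //; exact: rW Gs.
have [V VP] := choice H.
have dens : {ae mu, forall s, forall p, V p s -> 0 < s < 2 * pi -> forall M e : R, 0 < e ->
     exists2 d : R, 0 < d & forall z, cnorm z < 1 ->
       cnorm (z - cis s) < M * (1 - cnorm z) -> cnorm (z - cis s) < d ->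
       ((2 * pi * (1 - e))%:E <= hm z (V p))%E}.
  have : {ae mu, forall s, forall i j : nat, V (i, j) s -> 0 < s < 2 * pi -> forall M e : R, 0 < e ->
     exists2 d : R, 0 < d & forall z, cnorm z < 1 ->
       cnorm (z - cis s) < M * (1 - cnorm z) -> cnorm (z - cis s) < d ->
       ((2 * pi * (1 - e))%:E <= hm z (V (i, j)))%E}.
    apply: ae_foralln => i; apply: ae_foralln => j.
    by apply: hm_density; have [] := VP (i, j).
  by apply: (@filterS _ _ (ae_filter_ringOfSetsType mu)) => s Hs [i j]; exact: Hs.
have nV0 : {ae mu, forall t, ~ (Icc `&` V0) t}.
  by apply: negligibleS V0null => t /=; rewrite /setC/= notE.
rewrite /boundary_inner.
have := @filterI _ _ (ae_filter_ringOfSetsType mu) _ _ dens nV0.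
move=> /(@filterI _ _ (ae_filter_ringOfSetsType mu) _ _ bF).
apply: (@filterS _ _ (ae_filter_ringOfSetsType mu)) => t [bFt [dt nt]] t2.
have [l l1 Fl] := bFt t2.
have [s s2 ls] := circle_angle l1; rewrite {}ls {l1} in Fl.
have It : Icc t by rewrite /= in_itv/=; case/andP: t2 => *; rewrite !ltW.
have nW0 : ~ W0 s.
  by move=> sW; apply: nt; split=> //; apply: rV0 s2 sW _; exact: nontangential_radial.
have s0 : 0 < s.
  rewrite lt_neqAle; case/andP: s2 => -> _; rewrite andbT; apply/eqP => s0.
  by apply: nW0; right.
have [l' l1 Gl] : exists2 l, cnorm l = 1 & nontangential_limit G (cis s) l.
  apply: contrapT => nl; apply: nW0; left; apply: N0P => /= Gs; apply: nl; apply: Gs.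
  by rewrite s0; case/andP: s2.
have [s' s'2 ls] := circle_angle l1; rewrite {}ls {l1} in Gl.
exists (cis s'); first exact: cnorm_cis.
apply/nontangential_limitP => M e e0.
(* With chords of at most [2 / (n + 1) < e / 2] and this deficit, [hm_concentration] bounds the
   squared distance by [e ^ 2 / 4 + e ^ 2 / 4]. *)
have e160 : 0 < e ^+ 2 / 16 by rewrite divr_gt0// exprn_gt0.
pose n := Num.bound (4 / e).
have nE : 4 / e < n.+1%:R.
  apply: (lt_le_trans (archi_boundP _)); first by rewrite divr_ge0// ltW.
  by rewrite ler_nat leqnSn.
have n0 : 0 < n.+1%:R :> R by rewrite ltr0n.
pose j := Num.truncn (s' * n.+1%:R).
have s'0 : 0 <= s' by case/andP: s'2.
have jP : E (j, n) s'.
  rewrite /E/= in_itv/= ler_pdivrMr// ltr_pdivlMr//.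
  by apply: truncn_itv; rewrite mulr_ge0// ltW.
have Vt : V (j, n) t.
  by have [_ _ VV] := VP (j, n); apply: (VV t s s') => //; exact: nontangential_radial.
have [d d0 dP] := dt (j, n) Vt t2 M (e ^+ 2 / 16) e160.
exists d => // z z1 zM zd.
have [_ hV _] := VP (j, n).
have Gz1 : cnorm (G (F z)) < 1 by exact: (proj2 (dG _ (proj2 (dF _ z1)))).
have cc : 0 <= 2 / n.+1%:R :> R by rewrite divr_ge0// ltW.
have := @hm_concentration (G (F z)) s' (E (j, n)) (2 / n.+1%:R) (e ^+ 2 / 16) Gz1 (mE _) cc.
have Hd : forall x, Icc x -> E (j, n) x -> cnorm (cis x - cis s') <= 2 / n.+1%:R.
  move=> x _ Ex; rewrite (le_trans (ler_cnorm_cisB _ _))// ler_pM2l//.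
  move: Ex jP; rewrite /E/= !in_itv/=.
  have -> : j.+1%:R / n.+1%:R = j%:R / n.+1%:R + n.+1%:R^-1 :> R.
    by rewrite -addn1 natrD mulrDl mul1r.
  exact: ler_dist_width.
move=> /(_ Hd (le_trans (dP z z1 zM zd) (hV z z1))) H1.
rewrite -(@ltr_pXn2r _ 2)// ?nnegrE ?cnorm_ge0 ?(ltW e0)//; apply: (le_lt_trans H1).
have : 2 / n.+1%:R < e / 2.
  by rewrite ltr_pdivrMr//; rewrite ltr_pdivrMr// in nE; lra.
move=> h2; have : (2 / n.+1%:R) ^+ 2 < (e / 2) ^+ 2.
  by rewrite ltr_pXn2r// nnegrE; lra.
have e2 : (e / 2) ^+ 2 = e ^+ 2 / 4 by field.
have := exprn_gt0 2 e0; rewrite e2; move: (e ^+ 2) ((2 / n.+1%:R) ^+ 2) => p q; lra.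
Qed.

End BoundaryLimits.

(** * Iterates of centred inner functions *)

Section Iterates.
Variable R : realType.
Local Notation mu := (@lebesgue_measure R).
Implicit Types (x y a lam : R) (z : R[i]).

(** In terms of the odds [x / (1 - x)] the bound becomes multiplication by a constant independent of
    [x], and can be iterated. *)
Lemma schwarz_harnack_odds x y lam : 0 <= x < 1 -> lam < 1 ->
  y <= x * (1 - (1 - lam) * (1 - x) / (1 + x)) ->
  y / (1 - y) <= 2 / (3 - lam) * (x / (1 - x)).
Proof.
move=> /andP[x0 x1] lam1 yx; have xp : 0 < 1 + x by lra.
have {}yx : y * (1 + x) <= x * (1 + x - (1 - lam) * (1 - x)).
  rewrite -ler_pdivlMr// (le_trans yx)// le_eqVlt; apply/orP; left; apply/eqP.
  by field; rewrite gt_eqF.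
have t0 : 0 <= (1 - lam) * (1 - x) by rewrite mulr_ge0// subr_ge0 ltW.
have y1 : y < 1 by rewrite -(ltr_pM2r xp); nra.
rewrite ler_pdivrMr ?subr_gt0//.
rewrite (_ : _ / _ * _ * _ = 2 * x * (1 - y) / ((3 - lam) * (1 - x))); last first.
  by field; rewrite !gt_eqF ?subr_gt0//; lra.
rewrite ler_pdivlMr; last by rewrite mulr_gt0// ?subr_gt0//; lra.
suff : y * (2 + (1 - lam) * (1 - x)) <= 2 * x by lra.
rewrite -(ler_pM2r xp).
have := ler_wpM2r (ltac:(lra) : 0 <= 2 + (1 - lam) * (1 - x)) yx.
move: ((1 - lam) * (1 - x)) t0 => t t0 h.
rewrite mulrAC (le_trans h)//.
(* The exact slack of the inequality once the denominators are cleared. *)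
have : 0 <= x * (t * (1 - x) + t ^+ 2).
  by rewrite mulr_ge0// addr_ge0 ?sqr_ge0// mulr_ge0//; lra.
lra.
Qed.

(* With [q = sqrt lam], the bounds [ln lam >= 2 (1 - 1 / q)] and
   [ln (2 / (3 - lam)) <= 2 / (3 - lam) - 1] reduce the claim to
   [0 <= (1 - q) ^ 2 + 2 q ^ 3]. *)
Lemma odds_factor_le a lam : 0 < a -> a <= lam < 1 ->
  2 / (3 - lam) <= lam `^ (3 * (6 * (a^-1 + 1))^-1).
Proof.
move=> a0 /andP[al l1]; have l0 : 0 < lam by lra.
have -> : 3 * (6 * (a^-1 + 1))^-1 = a / (2 * (1 + a)).
  by field; rewrite !gt_eqF//; lra.
pose q := Num.sqrt lam.
have q0 : 0 < q by rewrite sqrtr_gt0.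
have ql : q ^+ 2 = lam by rewrite sqr_sqrtr// ltW.
have q1 : q < 1 by rewrite -(@ltr_pXn2r _ 2)// ?nnegrE ?ler01 ?(ltW q0)// ql expr1n.
have p0 : 0 < 2 / (3 - lam) by rewrite divr_gt0//; lra.
rewrite -(@ler_ln R)// ?posrE ?powR_gt0// ln_powR.
have lnq : 1 - q^-1 <= ln q.
  have : ln (1 + (q^-1 - 1)) <= q^-1 - 1.
    by apply: le_ln1Dx; have := invr_gt0 q; rewrite q0; lra.
  by rewrite (_ : 1 + (q^-1 - 1) = q^-1) ?lnV ?posrE//; lra.
have lnl : ln lam = 2 * ln q by rewrite -ql lnXn// mulr_natl.
have lnp : ln (2 / (3 - lam)) <= 2 / (3 - lam) - 1.
  have := @le_ln1Dx R (2 / (3 - lam) - 1); rewrite (_ : 1 + (_ - 1) = 2 / (3 - lam)); last by ring.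
  by apply; lra.
apply: (le_trans lnp).
(* The exponent increases with [a] and [ln lam <= 0], so [a] may be replaced by [lam]. *)
have ee : a / (2 * (1 + a)) <= lam / (2 * (1 + lam)).
  by rewrite ler_pdivrMr ?mulr_gt0//; [rewrite mulrAC ler_pdivlMr ?mulr_gt0//; nra|lra].
have e0 : 0 <= lam / (2 * (1 + lam)) by rewrite divr_ge0//; lra.
have lnl0 : ln lam <= 0 by rewrite ln_le0// ltW.
apply: (@le_trans _ _ (lam / (2 * (1 + lam)) * ln lam)); last by rewrite ler_wnM2r.
apply: (@le_trans _ _ (lam / (2 * (1 + lam)) * (2 * (1 - q^-1)))).
  rewrite -ql.
  have -> : 2 / (3 - q ^+ 2) - 1 = - ((1 - q) * ((1 + q) / (3 - q ^+ 2))).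
    by field; rewrite gt_eqF// ql; lra.
  have -> : q ^+ 2 / (2 * (1 + q ^+ 2)) * (2 * (1 - q^-1)) = - ((1 - q) * (q / (1 + q ^+ 2))).
    by field; rewrite !gt_eqF// ?ql; lra.
  rewrite lerN2 ler_pM2l ?subr_gt0// ler_pdivrMr; last by rewrite ql; lra.
  rewrite mulrAC ler_pdivlMr; last by rewrite ql; lra.
  have := sqr_ge0 (1 - q); have := exprn_gt0 3 q0; lra.
by rewrite ler_wpM2l// lnl ler_pM2l.
Qed.

Lemma centred_inner_schwarz (f : R[i] -> R[i]) lam : centred_inner f ->
  `|derive1 f 0| <= lam%:C -> forall z, cnorm z < 1 ->
  cnorm (f z) <= cnorm z * (1 - (1 - lam) * (1 - cnorm z) / (1 + cnorm z)).
Proof.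
move=> [[fd f1 _] f0] df; apply: schwarz_harnack => //.
- by move=> u u1; apply: fd; rewrite unit_discE.
- by move=> u u1; have := f1 u; rewrite unit_discE norm_cnormE -(rmorph1 (real_complex R)) lecR => /(_ u1).
- by move: df; rewrite norm_cnormE lecR.
Qed.

Lemma centred_inner_odds (f : R[i] -> R[i]) lam : centred_inner f ->
  `|derive1 f 0| <= lam%:C -> lam < 1 -> forall z, cnorm z < 1 ->
  cnorm (f z) / (1 - cnorm (f z)) <= 2 / (3 - lam) * (cnorm z / (1 - cnorm z)).
Proof.
move=> ci df lam1 z z1; apply: schwarz_harnack_odds => //.
  by rewrite cnorm_ge0.
exact: centred_inner_schwarz.
Qed.

(** [inner_function] gives only [|f z| <= 1]; strictness comes from [|f z| <= |z|]. *)
Lemma centred_inner_disc_map (f : R[i] -> R[i]) lam : centred_inner f ->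
  `|derive1 f 0| <= lam%:C -> lam < 1 -> disc_map f.
Proof.
move=> ci df lam1 z z1; split.
  by case: ci => -[fd _ _] _; apply: derivable_cdiff; apply: fd; rewrite unit_discE.
apply: le_lt_trans (z1); apply: (le_trans (centred_inner_schwarz ci df z1)).
rewrite ler_piMr ?cnorm_ge0// lerBlDr lerDl divr_ge0// ?addr_ge0 ?cnorm_ge0//.
by rewrite mulr_ge0// subr_ge0 ltW.
Qed.

Lemma centred_inner_boundary (f : R[i] -> R[i]) : centred_inner f -> boundary_inner f.
Proof.
move=> [[_ _ H] _]; move: H; apply: (@filterS _ _ (ae_filter_ringOfSetsType mu)).
by move=> t [l /unit_circleE l1 nt] _; exists l.
Qed.

Variables (a : R) (lam : nat -> R) (f : nat -> R[i] -> R[i]).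
Hypothesis a0 : 0 < a.
Hypothesis lamP : forall n, (1 <= n)%N -> a <= lam n < 1.
Hypothesis fP : forall n, (1 <= n)%N ->
  centred_inner (f n) /\ `|derive1 (f n) 0| <= (lam n)%:C.

Lemma disc_map_comp (F G : R[i] -> R[i]) : disc_map F -> disc_map G -> disc_map (G \o F).
Proof.
move=> dF dG z z1; have [cF F1] := dF z z1; have [cG G1] := dG _ F1.
by split=> //; exact: cdiff_comp.
Qed.

Lemma iter_comp_disc_map n : disc_map (iter_comp f n).
Proof.
elim: n => [|n IH] /=; first by move=> z z1; split=> //; exact: cdiff_id.
apply: disc_map_comp => //; have [ci df] := fP (ltn0Sn n).
by apply: centred_inner_disc_map ci df _; case/andP: (lamP (ltn0Sn n)).
Qed.

Lemma iter_comp_boundary_inner n : boundary_inner (iter_comp f n).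
Proof.
elim: n => [|n IH] /=; first exact: boundary_inner_id.
have [ci df] := fP (ltn0Sn n).
apply: boundary_inner_comp => //; first exact: iter_comp_disc_map.
  by apply: centred_inner_disc_map ci df _; case/andP: (lamP (ltn0Sn n)).
exact: centred_inner_boundary.
Qed.

Lemma prod_lam_bounds n : 0 < \prod_(1 <= i < n.+1) lam i <= 1.
Proof.
elim: n => [|n IH]; first by rewrite big_geq// ltr01 lexx.
case/andP: IH => h0 h1; have /andP[al l1] := lamP (ltn0Sn n).
rewrite big_nat_recr//=; apply/andP; split.
  by rewrite mulr_gt0// (lt_le_trans a0).
by rewrite mulr_ile1// ?(ltW h0)// ltW// (lt_le_trans a0).
Qed.

Lemma iter_comp_odds n z : cnorm z < 1 ->
  cnorm (iter_comp f n z) / (1 - cnorm (iter_comp f n z)) <=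
  (\prod_(1 <= i < n.+1) lam i) `^ (3 * (6 * (a^-1 + 1))^-1) * (cnorm z / (1 - cnorm z)).
Proof.
move=> z1; elim: n => [|n IH]; first by rewrite big_geq// powR1 mul1r.
have [ci df] := fP (ltn0Sn n); have lP := lamP (ltn0Sn n); have /andP[al l1] := lP.
have [_ Fz1] := iter_comp_disc_map n z1.
have /andP[p0 _] := prod_lam_bounds n.
rewrite big_nat_recr//= powRM ?(ltW p0)//; last by rewrite ltW// (lt_le_trans a0).
rewrite [leRHS](_ : _ = lam n.+1 `^ (3 * (6 * (a^-1 + 1))^-1) *
  ((\prod_(1 <= i < n.+1) lam i) `^ (3 * (6 * (a^-1 + 1))^-1) * (cnorm z / (1 - cnorm z)))); last first.
  by rewrite mulrAC mulrC.
have o0 : 0 <= cnorm (iter_comp f n z) / (1 - cnorm (iter_comp f n z)).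
  by rewrite divr_ge0 ?cnorm_ge0// subr_ge0 ltW.
apply: (le_trans (centred_inner_odds ci df l1 Fz1)).
apply: ler_pM (odds_factor_le a0 lP) IH => //.
by rewrite divr_ge0//; lra.
Qed.

End Iterates.

(** * Neighbourhoods of arcs *)

Section Arcs.
Variable R : realType.
Local Notation mu := (@lebesgue_measure R).
Local Notation Icc := (`[0, 2 * pi]%classic : set (measurableTypeR R)).
Implicit Types (A : set R[i]) (x y t s p q C : R).

(* Satisfied by an arc and by its complement, [p] and [q] being the angles of
   the two end points. *)
Definition two_ended C A := exists p q, forall x y, A (cis x) -> ~ A (cis y) ->
  cnorm (cis y - cis p) <= C * cnorm (cis x - cis y) \/
  cnorm (cis y - cis q) <= C * cnorm (cis x - cis y).

(** Exchanging [x] and [y], the end near one point is also near the other, at the cost of their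
    mutual distance. *)
Lemma two_endedC C A : two_ended C A -> two_ended (C + 1) (~` A).
Proof.
move=> [p [q pq]]; exists p, q => x y nAx /contrapT Ay.
have D u : cnorm (cis y - u) <= cnorm (cis x - u) + cnorm (cis x - cis y).
  have -> : cis y - u = (cis x - u) - (cis x - cis y) by ring.
  exact: ler_cnormB.
rewrite mulrDl mul1r.
by have [H|H] := pq y x Ay nAx; [left|right];
  apply: (le_trans (D _)); rewrite lerD2r (le_trans H)// (cnorm_distC (cis y)).
Qed.

Lemma near_angle x y : exists2 y', cis y' = cis y & `|y' - x| <= pi.
Proof.
have [s /andP[s0 s2] sE] := circle_angle (cnorm_cis (y - (x - pi))).
exists (x - pi + s); last by rewrite ler_norml; lra.
by rewrite cisD -sE -cisD; congr cis; lra.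
Qed.

(** Take the representative [y'] of [y] within [pi] of [x']. Between [x'] and [y'] the interval is
    left through an end point, which is then at most [|x' - y'|] away from [y']; passing from chords
    to angles and back costs [2 / c]. *)
Lemma arc_two_ended : exists2 C, 0 < C & forall A, circle_arc A -> two_ended C A.
Proof.
have [c c0 cP] := chord_ge R.
exists (2 / c); first by rewrite divr_gt0.
(* On a side where [I] is unbounded, [inf I] or [sup I] is a default value, but there no [y']
   outside [I] exists and the value is not consulted. *)
move=> A [I itvI ->]; exists (inf I), (sup I) => x y [x' Ix' <-] nAy.
have [y' yE y'x'] := near_angle x' y.
have nIy' : ~ I y' by move=> Iy'; apply: nAy; exists y'.
rewrite -yE.
have near_ e : `|y' - e| <= `|x' - y'| ->
    cnorm (cis y' - cis e) <= 2 / c * cnorm (cis x' - cis y').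
  move=> ye; apply: (le_trans (ler_cnorm_cisB _ _)).
  rewrite mulrAC ler_pdivlMr// -mulrA ler_pM2l//.
  apply: le_trans (cP x' y' `|x' - y'| _ _).
  - by rewrite mulrC ler_pM2l.
  - by rewrite normr_ge0 distrC.
  - by rewrite lexx/=; rewrite distrC in y'x'; lra.
have I0 : I !=set0 by exists x'.
have [yx|xy] := leP y' x'; [left|right]; apply: near_.
  have lbI : lbound I y'.
    move=> i Ii; rewrite leNgt; apply/negP => iy; apply: nIy'.
    by apply: itvI Ii Ix' _ _; rewrite ?(ltW iy).
  have h1 : y' <= inf I by exact: lb_le_inf.
  have h2 : inf I <= x' by apply: ge_inf => //; exists y'.
  by rewrite distrC !ger0_norm ?subr_ge0// lerD2r.
have ubI : ubound I y'.
  move=> i Ii; rewrite leNgt; apply/negP => iy; apply: nIy'.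
  by apply: itvI Ix' Ii _ _; rewrite ?(ltW iy) ?(ltW xy).
have h1 : sup I <= y' by exact: ge_sup.
have h2 : x' <= sup I by apply: ub_le_sup => //; exists y'.
by rewrite (distrC x') !ger0_norm ?subr_ge0 ?(ltW xy)// lerD2l lerN2.
Qed.

Definition chord_nbhd A s := [set t | exists2 x, A (cis x) & cnorm (cis t - cis x) < s].

Lemma continuous_chord w : continuous (fun t : R => cnorm (cis t - w)).
Proof.
move=> t; apply/cvgrPdist_lt => e e0; near=> u.
apply: (@le_lt_trans _ _ (2 * `|t - u|)).
  apply: le_trans (ler_cnorm_cisB t u).
  have -> : cis t - cis u = (cis t - w) - (cis u - w) by ring.
  by rewrite [leRHS]cnorm_distC; exact: ler_norm_cnormB.
rewrite mulrC -ltr_pdivlMr//.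
by near: u; apply: cvgr_dist_lt; rewrite ?divr_gt0//; exact: cvg_id.
Unshelve. all: by end_near. Qed.

Lemma open_chord_lt w s : open [set t : R | cnorm (cis t - w) < s].
Proof. exact: (open_comp (fun t _ => @continuous_chord w t) (@open_lt _ s)). Qed.

Lemma chord_nbhdE A s : chord_nbhd A s =
  \bigcup_(x in [set x | A (cis x)]) [set t | cnorm (cis t - cis x) < s].
Proof. by apply/seteqP; split=> t [x Ax xt]; exists x. Qed.

Lemma open_chord_nbhd A s : open (chord_nbhd A s).
Proof. by rewrite chord_nbhdE; apply: bigcup_open => x _; exact: open_chord_lt. Qed.

Lemma mu_itv_le (b b' : bool) x y d : y - x <= d -> 0 <= d ->
  (mu [set` Interval (BSide b x) (BSide b' y)] <= d%:E)%E.
Proof.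
move=> xyd d0; rewrite lebesgue_measure_itv/=.
by case: ifPn => _; rewrite -?EFinD lee_fin.
Qed.

Lemma mu_chord_lt : exists2 C, 0 < C & forall p s, 0 < s ->
  (mu (Icc `&` [set t | (cnorm (cis t - cis p) < s)%R]) <= (C * s)%:E)%E.
Proof.
have [c c0 cP] := chord_ge R.
exists (4 / c); first by rewrite divr_gt0.
move=> p0 s s0; pose d := s / c; have d0 : 0 < d by rewrite divr_gt0.
have [p /andP[pp0 pp2] ->] := circle_angle (cnorm_cis p0).
have mN : measurable (Icc `&` [set t | cnorm (cis t - cis p) < s] : set (measurableTypeR R)).
  by apply: measurableII; apply: open_measurable; exact: open_chord_lt.
have -> : 4 / c * s = 4 * d by rewrite /d; field; rewrite gt_eqF.
have [dpi|pid] := leP d pi; last first.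
  apply: (@le_trans _ _ (mu Icc)); first by apply: le_measure; rewrite ?inE.
  by rewrite mu_Icc lee_fin; lra.
(* [B2] and [B3] catch what wraps around the angle [0]; the three lengths add up to [4 * d]. *)
pose B1 : set (measurableTypeR R) := `](p - d), (p + d)[%classic.
pose B2 : set (measurableTypeR R) := `[0, d[%classic.
pose B3 : set (measurableTypeR R) := `](2 * pi - d), (2 * pi)]%classic.
have mB1 : measurable B1 by exact: measurable_itv.
have mB2 : measurable B2 by exact: measurable_itv.
have mB3 : measurable B3 by exact: measurable_itv.
apply: (@le_trans _ _ (mu (B1 `|` B2 `|` B3))).
  apply: le_measure; rewrite ?inE//; first by do 2?apply: measurableU.
  move=> t []; rewrite /= in_itv/= => /andP[t0 t2] ts.
  have := cP t p d; have -> : c * d = s by rewrite /d; field; rewrite gt_eqF.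
  move=> /(_ ltac:(lra)) H.
  have [td|td] := ltP `|t - p| d.
    left; left; rewrite /B1/= in_itv/=; move: td; rewrite ltr_norml.
    by clear; lra.
  have : 2 * pi - d < `|t - p|.
    by rewrite ltNge; apply/negP => td'; move: ts; rewrite ltNge H// td.
  have [tp|pt] := leP p t.
    rewrite ger0_norm ?subr_ge0// => h; right; rewrite /B3/= in_itv/=.
    by clear -h t2 pp0; lra.
  rewrite ltr0_norm ?subr_lt0// => h; left; right; rewrite /B2/= in_itv/=.
  by clear -h t0 pp2; lra.
apply: (le_trans (measureU2 _ _ _)) => //; first exact: measurableU.
apply: (@le_trans _ _ ((2 * d)%:E + d%:E + d%:E)%E); last by rewrite -!EFinD lee_fin; lra.
apply: leeD; first (apply: (le_trans (measureU2 _ _ _)) => //; apply: leeD).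
- by apply: mu_itv_le; lra.
- by apply: mu_itv_le; lra.
- by apply: mu_itv_le; lra.
Qed.

(** [A] contains a neighbourhood of each of its points other than the ends. So it is open apart from
    the fibres [K p] and [K q] of [cis], each of which lies in [A] or is disjoint from it. *)
Lemma two_ended_measurable C A : 0 < C -> two_ended C A ->
  measurable ([set t | A (cis t)] : set (measurableTypeR R)).
Proof.
move=> C0 [p [q pq]].
pose K u := [set t : R | cis t = cis u].
have mK u : measurable (K u : set (measurableTypeR R)).
  rewrite -(setCK (K u)); apply: measurableC; apply: open_measurable.
  have -> : ~` K u = (fun t : R => cnorm (cis t - cis u)) @^-1` [set x | 0 < x].
    by apply/seteqP; split=> t; rewrite /K/= cnorm_gt0 subr_eq0 => /eqP.
  by apply: open_comp (@open_gt _ 0) => t _; exact: continuous_chord.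
have mAK u : measurable ([set t | A (cis t)] `&` K u : set (measurableTypeR R)).
  have [Au|nAu] := pselect (A (cis u)).
    rewrite (_ : _ `&` _ = K u)//; apply/seteqP; split=> [t []//|t tu]; split=> //=.
    by rewrite tu.
  rewrite (_ : _ `&` _ = set0)//; apply/seteqP; split=> // t [/=].
  by rewrite /K/= => + tu; rewrite tu.
have -> : [set t | A (cis t)] = ([set t | A (cis t)] `&` K p) `|` ([set t | A (cis t)] `&` K q) `|`
    ([set t | A (cis t)] `&` ~` K p `&` ~` K q).
  apply/seteqP; split=> [t At|t [[[]|[]]|[[]]]//].
  have [?|?] := pselect (K p t); first by left; left.
  by have [?|?] := pselect (K q t); [left; right|right].
apply: measurableU; first exact: measurableU.
apply: open_measurable; rewrite openE => x [[/= Ax xp] xq].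
have far u : ~ K u x -> exists2 e, 0 < e & forall y, `|x - y| < e ->
    C * cnorm (cis x - cis y) < cnorm (cis y - cis u).
  move=> xu; have d0 : 0 < cnorm (cis x - cis u) by rewrite cnorm_gt0 subr_eq0; apply/eqP.
  have C10 : 0 < 2 * (C + 1) by rewrite mulr_gt0// addr_gt0.
  exists (cnorm (cis x - cis u) / (2 * (C + 1))); first exact: divr_gt0.
  move=> y; rewrite ltr_pdivlMr// => xy.
  have := ler_cnorm_cisB x y; have := ler_cnorm_dist (cis x) (cis y) (cis u).
  have : C * (2 * `|x - y|) + 2 * `|x - y| < cnorm (cis x - cis u) by lra.
  move: (cnorm (cis x - cis y)) (cnorm (cis y - cis u)) => a b h1 h2 h3.
  have : C * a <= C * (2 * `|x - y|) by rewrite ler_pM2l.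
  lra.
have [e e0 eP] := far p xp; have [e' e'0 e'P] := far q xq.
apply/nbhs_ballP; exists (Num.min e e') => /=; first by rewrite lt_min e0.
move=> y; rewrite /ball/= lt_min => /andP[ye ye'].
have hp := eP y ye; have hq := e'P y ye'.
have C0' : 0 <= C * cnorm (cis x - cis y) by rewrite mulr_ge0 ?cnorm_ge0// ltW.
split; [split|].
- by apply: contrapT => /(pq x y Ax)[]; rewrite leNgt ?hp ?hq.
- by rewrite /K/= => yp; have := le_lt_trans C0' hp; rewrite yp subrr cnorm0 ltxx.
- by rewrite /K/= => yp; have := le_lt_trans C0' hq; rewrite yp subrr cnorm0 ltxx.
Qed.

(** A point of the neighbourhood outside [A] is within [C * s] of one of the two ends. *)
Lemma mu_chord_nbhd : exists2 C', 0 < C' & forall C A s, 0 < C -> two_ended C A -> 0 < s ->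
  (mu (Icc `&` chord_nbhd A s) <= mu (Icc `&` [set t | A (cis t)]) + (C' * C * s)%:E)%E.
Proof.
have [C' C'0 C'P] := mu_chord_lt.
exists (2 * C'); first exact: mulr_gt0.
move=> C A s C0 tA s0.
have mA := two_ended_measurable C0 tA; have [p [q pq]] := tA.
have mN u : measurable (Icc `&` [set t | (cnorm (cis t - cis u) < C * s)%R]).
  by apply: measurableII; apply: open_measurable; exact: open_chord_lt.
apply: (@le_trans _ _ (mu ((Icc `&` [set t | A (cis t)]) `|`
    ((Icc `&` [set t | (cnorm (cis t - cis p) < C * s)%R]) `|`
     (Icc `&` [set t | (cnorm (cis t - cis q) < C * s)%R]))))).
  apply: le_measure; rewrite ?inE.
  - by apply: measurableII; apply: open_measurable; exact: open_chord_nbhd.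
  - by apply: measurableU; [exact: measurableII|exact: measurableU].
  - move=> t [It [x Ax xt]]; have [At|nAt] := pselect (A (cis t)); first by left.
    have lt_ : C * cnorm (cis x - cis t) < C * s by rewrite ltr_pM2l// cnorm_distC.
    by right; have [h|h] := pq x t Ax nAt; [left|right]; split=> //=; exact: le_lt_trans lt_.
apply: (le_trans (measureU2 _ _ _)) => //; [exact: measurableII|exact: measurableU|].
apply: leeD => //; apply: (le_trans (measureU2 _ _ _)) => //.
apply: (@le_trans _ _ ((C' * (C * s))%:E + (C' * (C * s))%:E)%E).
  by apply: leeD; apply: C'P; exact: mulr_gt0.
by rewrite -EFinD lee_fin; lra.
Qed.

End Arcs.

(** * Poisson smoothing of an arc *)

Section Smoothing.
Variable R : realType.
Local Notation mu := (@lebesgue_measure R).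
Local Notation Icc := (`[0, 2 * pi]%classic : set (measurableTypeR R)).
Implicit Types (F : R[i] -> R[i]) (A : set R[i]) (x y t s q r : R).
Implicit Types (U V W : set (measurableTypeR R)).

Lemma poisson_sym r x y : 0 <= r ->
  poisson 1 (r%:C * cis x) y = poisson 1 (r%:C * cis y) x.
Proof.
move=> r0; rewrite /poisson !cnorm_real_cis//; congr (_ / _).
have E u v : cnorm (1%:C * cis u - r%:C * cis v) ^+ 2 =
    1 + r ^+ 2 - 2 * r * (cos u * cos v + sin u * sin v).
  transitivity ((cos u ^+ 2 + sin u ^+ 2) + r ^+ 2 * (cos v ^+ 2 + sin v ^+ 2) -
    2 * r * (cos u * cos v + sin u * sin v)); last by rewrite !cos2Dsin2 mulr1.
  by rewrite sqr_cnorm mul1r ReB ImB /cis/=; ring.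
by rewrite !E (mulrC (cos y)) (mulrC (sin y)).
Qed.

(* Both sides are compared with the integral over [t] in [V] and in [A] of the
   harmonic measure, at [(1 - q ^ 2) cis t], of the [q]-neighbourhood of [A]:
   it is almost [2 * pi] there, and by symmetry of the kernel the integral
   equals that, over this neighbourhood, of the harmonic measure of a part of
   [V]. *)
Lemma smoothing F V W A q : disc_map F -> measurable V -> measurable W ->
  (forall z, cnorm z < 1 -> (hm z V <= hm (F z) W)%E) ->
  measurable ([set t | A (cis t)] : set (measurableTypeR R)) ->
  0 < q -> q <= 64^-1 -> (forall z, cnorm z = 1 - q ^+ 2 -> cnorm (F z) <= q) ->
  ((2 * pi * (1 - 32 * q))%:E * mu (Icc `&` (V `&` [set t | A (cis t)])) <=
   ((1 + q) / (1 - q))%:E * mu (Icc `&` W) * mu (Icc `&` chord_nbhd A q))%E.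
Proof.
move=> dF mV mW hV mA q0 q64 Fq.
pose r := 1 - q ^+ 2.
have qq : q ^+ 2 <= q / 64 by rewrite expr2 ler_pM2l//; lra.
have qq0 : 0 < q ^+ 2 by rewrite exprn_gt0.
have r0 : 0 <= r by rewrite /r; lra.
have r1 : r < 1 by rewrite /r; lra.
pose G (y : measurableTypeR R) := r%:C * cis (y : R).
have GN y : cnorm (G y) = r by rewrite cnorm_real_cis.
have G1 y : cnorm (G y) < 1 by rewrite GN.
have [mR mI] : measurable_fun setT (fun y => complex.Re (G y)) /\
   measurable_fun setT (fun y => complex.Im (G y)).
  have did : disc_map (@id R[i]) by move=> z z1; split=> //; exact: cdiff_id.
  by apply: (disc_map_ray_measurable did); rewrite r0.
have mN : measurable (chord_nbhd A q : set (measurableTypeR R)).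
  by apply: open_measurable; exact: open_chord_nbhd.
have mVA : measurable (V `&` [set t | A (cis t)]) by exact: measurableI.
have mIVA := measurableII mVA.
have mIN := measurableII mN.
have v1 : measurable_fun setT (cst 1 : measurableTypeR R -> R) by [].
have E : (\int[mu]_(y in Icc `&` (V `&` [set t | A (cis t)])) hm (G y) (chord_nbhd A q) =
    \int[mu]_(x in Icc `&` chord_nbhd A q) hm (G x) (V `&` [set t | A (cis t)]))%E.
  have := hm_swap mR mI G1 v1 (fun=> ler01) mN mIVA.
  under eq_integral do rewrite mule1.
  under [X in _ = X -> _]eq_integral => x _.
    under eq_integral => y _ do rewrite mulr1 poisson_sym//.
    over.
  exact.
apply: (@le_trans _ _ (\int[mu]_(y in Icc `&` (V `&` [set t | A (cis t)])) hm (G y) (chord_nbhd A q))%E).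
  rewrite -integral_cst//; apply: ge0_le_integral => //.
  - by move=> y _; rewrite lee_fin; apply: mulr_ge0; [have := @pi_gt0 R; lra|lra].
  - exact: measurable_funS (measurable_hm mR mI G1 mN).
  - move=> y [_ [_ Ay]]; have mNC := measurableC mN.
    (* [G y] is at height [q ^ 2], and points off the neighbourhood are at chordal distance at least
       [q] from [cis y]. *)
    have far : (hm (G y) (~` chord_nbhd A q) <= (32 * (1 - cnorm (G y)) / q * (2 * pi))%:E)%E.
      apply: (@hm_far _ _ y _ _ (G1 y) q0 _ mNC); first lra.
      move=> t It nN; have yt : q <= cnorm (cis t - cis y).
        by rewrite leNgt; apply/negP => ty; apply: nN; exists y.
      split=> //; apply: le_trans yt.
      have -> : cnorm (G y - cis y) = q ^+ 2.
        have -> : G y - cis y = (- q ^+ 2)%:C * cis y.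
          by rewrite /G /r rmorphN rmorphB rmorph1; ring.
        by rewrite cnormM cnorm_cis mulr1 cnorm_real normrN gtr0_norm.
      lra.
    have := hmC (G1 y) mN; have := hm_fin_num (G1 y) mN; have := hm_fin_num (G1 y) mNC.
    move: far; case: (hm _ (chord_nbhd _ _)) => // h; case: (hm _ (~` _)) => // h'.
    rewrite !lee_fin GN => hq _ _ /eqP; rewrite -EFinD eqe => /eqP hh.
    have : 32 * (1 - r) / q * (2 * pi) = 32 * q * (2 * pi).
      by rewrite /r; field; rewrite gt_eqF.
    lra.
rewrite E -integral_cst//.
apply: ge0_le_integral => //.
- by move=> x _; exact: hm_ge0.
- exact: measurable_funS (measurable_hm mR mI G1 mVA).
- move=> x _.
  apply: (@le_trans _ _ (hm (G x) V)); first by apply: hm_le => // t [_ []].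
  apply: (le_trans (hV _ (G1 x))); have [_ F1] := dF _ (G1 x).
  apply: (le_trans (hm_le_mu F1 mW)).
  apply: lee_wpmul2r => //; rewrite lee_fin.
  have Fx : cnorm (F (G x)) <= q by apply: Fq; rewrite GN.
  have F0 := cnorm_ge0 (F (G x)).
  rewrite ler_pdivrMr ?subr_gt0// mulrAC ler_pdivlMr; last lra.
  nra.
Qed.

End Smoothing.

(** * Arc length of preimages *)

Section ArcLength.
Variable R : realType.
Local Notation mu := (@lebesgue_measure R).
Local Notation mo := ((wlength (@idfun R))^*%mu).
Local Notation Icc := (`[0, 2 * pi]%classic : set (measurableTypeR R)).
Implicit Types (F : R[i] -> R[i]) (A E X Y Z : set R[i]) (x y t s q C : R).
Implicit Types (U V W : set (measurableTypeR R)).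

Lemma mo_Ico : mo `[0, 2 * pi[%classic = (2 * pi)%:E.
Proof.
(* On Borel sets [mu] is [mo] by conversion, whence the closing [exact]. *)
have : mu `[0, 2 * pi[%classic = (2 * pi)%:E.
  by rewrite lebesgue_measure_itv/= lte_fin two_pi_gt0 -EFinD subr0.
exact.
Qed.

Lemma mo_angles_fin_num X : mo (angles X) \is a fin_num.
Proof.
rewrite ge0_fin_numE ?outer_measure_ge0//.
apply: (@le_lt_trans _ _ (mo `[0, 2 * pi[%classic)); last by rewrite mo_Ico ltry.
by apply: le_outer_measure; exact: subIsetl.
Qed.

(** [arc_length] is thus an outer measure, monotone and subadditive on all sets, and applies to
    preimages as they stand. *)
Lemma arc_lengthE X : (arc_length X)%:E = mo (angles X).
Proof. by rewrite /arc_length fineK// mo_angles_fin_num. Qed.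

Lemma arc_length_ge0 X : 0 <= arc_length X.
Proof. by rewrite -lee_fin arc_lengthE outer_measure_ge0. Qed.

Lemma arc_length_le2pi X : arc_length X <= 2 * pi.
Proof.
rewrite -lee_fin arc_lengthE -mo_Ico; apply: le_outer_measure; exact: subIsetl.
Qed.

Lemma arc_length_le X Y : X `&` @unit_circle R `<=` Y -> arc_length X <= arc_length Y.
Proof.
move=> XY; rewrite -lee_fin !arc_lengthE; apply: le_outer_measure => t [t2 Xt].
by split=> //; apply: XY; split=> //; apply/unit_circleE; exact: cnorm_cis.
Qed.

Lemma arc_length_le_mu X V : measurable V -> angles X `<=` V ->
  ((arc_length X)%:E <= mu (Icc `&` V))%E.
Proof.
move=> mV XV; rewrite arc_lengthE.
have : (mo (angles X) <= mo (Icc `&` V))%E.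
  apply: le_outer_measure => t tX; split; last exact: XV.
  by case: tX => + _; rewrite /= !in_itv/= => /andP[-> /ltW].
exact.
Qed.

Lemma mu_le_arc_length A : measurable ([set t | A (cis t)] : set (measurableTypeR R)) ->
  (mu (Icc `&` [set t | A (cis t)]) <= (arc_length A)%:E)%E.
Proof.
move=> mA; rewrite arc_lengthE.
(* [Icc] contains the angle [2 * pi], which [angles] leaves out. *)
apply: (@le_trans _ _ (mo (angles A `|` [set 2 * pi]))).
  have : (mo (Icc `&` [set t | A (cis t)]) <= mo (angles A `|` [set (2 * pi)%R]))%E.
    apply: le_outer_measure => t [] /=; rewrite in_itv/= => /andP[t0 t2] At.
    move: t2; rewrite le_eqVlt => /predU1P[->|t2]; first by right.
    by left; split=> //=; rewrite in_itv/= t0.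
  exact.
apply: (le_trans (outer_measureU2 _ _ _)).
have m1 : mo [set 2 * pi] = 0%E by have := lebesgue_measure_set1 (2 * pi : R); exact.
by rewrite -[leRHS]adde0 -m1.
Qed.

Lemma arc_lengthU X Y Z : X `&` @unit_circle R `<=` Y `|` Z ->
  arc_length X <= arc_length Y + arc_length Z.
Proof.
move=> XYZ; rewrite -lee_fin EFinD !arc_lengthE.
apply: le_trans (outer_measureU2 _ _ _); apply: le_outer_measure => t [t2 Xt].
have [] : (Y `|` Z) (cis t).
- by apply: XYZ; split=> //; apply/unit_circleE; exact: cnorm_cis.
- by left.
- by right.
Qed.

(** Caratheodory's criterion for [angles A], tested on [[0, 2 * pi[]. *)
Lemma arc_lengthC A : arc_measurable A -> arc_length A + arc_length (~` A) = 2 * pi.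
Proof.
move=> mA; apply: EFin_inj; rewrite EFinD !arc_lengthE.
apply: etrans mo_Ico; apply: etrans (esym (mA _)).
congr (mo _ + mo _)%E; apply/seteqP; split=> t.
- by move=> [].
- by case=> ? [].
- by move=> [t2 nA]; split=> // -[].
- by move=> [t2 nA]; split=> // At; apply: nA; split.
Qed.

Lemma borel_arc_measurable A : measurable ([set t | A (cis t)] : set (measurableTypeR R)) ->
  arc_measurable A.
Proof.
move=> mA; apply: sub_caratheodory.
by have : measurable (`[0, 2 * pi[%classic `&` [set t | A (cis t)] : set (measurableTypeR R)) by exact: measurableI.
Qed.

(** [W] is a G-delta hull of [angles E], of the same outer measure, and [V] its pullback. *)
Lemma preimage_hull F E : disc_map F -> E `<=` @unit_circle R ->
  exists V W, [/\ measurable V, measurable W,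
    forall z, cnorm z < 1 -> (hm z V <= hm (F z) W)%E,
    (mu (Icc `&` W) <= (arc_length E)%:E)%E &
    angles (boundary_preimage F E) `<=` V].
Proof.
move=> dF EC; have [G [oG EG muG]] := outer_measure_Gdelta (angles E).
pose W : set (measurableTypeR R) := \bigcap_i G i.
have mW : measurable W.
  by apply: bigcapT_measurable => i; apply: open_measurable.
have [V [mV hV rV]] := pullback dF mW.
exists V, W; split=> //.
  rewrite arc_lengthE -muG; apply: le_measure; rewrite ?inE//; exact: measurableII.
move=> t [_ [_ [l El nt]]]; have /unit_circleE/circle_angle[s s2 ls] := EC _ El.
rewrite ls in El nt; apply: (rV t s s2); last exact: nontangential_radial.
by apply: EG; split=> //=; rewrite in_itv.
Qed.

(** One half of Loewner's lemma: at [0], which [F] fixes, harmonic measure is length. *)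
Lemma arc_length_preimage_le F E : disc_map F -> F 0 = 0 -> E `<=` @unit_circle R ->
  arc_length (boundary_preimage F E) <= arc_length E.
Proof.
move=> dF F0 EC; have [V [W [mV mW hV muW bV]]] := preimage_hull dF EC.
rewrite -lee_fin (le_trans (arc_length_le_mu mV bV))// (le_trans _ muW)//.
have z01 : cnorm (0 : R[i]) < 1 by rewrite cnorm0.
by rewrite -!hm0// -{2}F0; exact: hV.
Qed.

(** The arithmetic following [smoothing]: [P] is [pi]; [m], [w] and [n] measure the part of [V] in
    the arc, [W] and the neighbourhood; [b] and [e] are the lengths of the arc and of [E]. The bound
    on [q] keeps [1 - 33 * q], which is at most [(1 - q) * (1 - 32 * q)], at least [31 / 64]. *)
Lemma smoothing_bound_real (P q m w e n b K : R) : 2 <= P -> 0 < q -> q <= 64^-1 ->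
  0 <= K -> 0 <= b <= 2 * P -> 0 <= n <= b + K * q -> 0 <= w <= e -> 0 <= m ->
  2 * P * (1 - 32 * q) * m <= (1 + q) / (1 - q) * w * n ->
  m <= (b / (2 * P) + (100 + K) * q) * e.
Proof.
move=> P2 q0 q64 K0 /andP[b0 bP] /andP[n0 nb] /andP[w0 we] m0 H.
have q1 : 0 < 1 - q by lra.
have e0 : 0 <= e by exact: le_trans we.
have P0 : 0 < 2 * P by lra.
have {}H : (1 - 33 * q) * (2 * P) * m <= (1 + q) * (b + K * q) * e.
  apply: (@le_trans _ _ ((1 - q) * (2 * P * (1 - 32 * q) * m))).
    have : 0 <= q ^+ 2 * (2 * P * m) by rewrite !mulr_ge0//; lra.
    lra.
  apply: (@le_trans _ _ ((1 - q) * ((1 + q) / (1 - q) * w * n))); first by rewrite ler_pM2l.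
  have -> : (1 - q) * ((1 + q) / (1 - q) * w * n) = (1 + q) * (n * w).
    by field; rewrite gt_eqF.
  by rewrite -mulrA; apply: ler_wpM2l; [lra|exact: ler_pM].
have q33 : 31 / 64 <= 1 - 33 * q by lra.
have q33p : 0 < 1 - 33 * q by lra.
rewrite -(ler_pM2l (mulr_gt0 q33p P0)) (le_trans H)// mulrA ler_wpM2r//.
have -> : (1 - 33 * q) * (2 * P) * (b / (2 * P) + (100 + K) * q) =
    (1 - 33 * q) * (b + 2 * P * (100 + K) * q) by field; lra.
(* What remains once the terms free of [q] cancel and [q] is divided out. Since [34 * b <= 68 * P],
   the constant 100, which provides [31 / 64 * 200 * P], is large enough. *)
suff : 34 * b + K + q * K <= (1 - 33 * q) * (2 * P * (100 + K)).
  move=> /(ler_wpM2l (ltW q0)); lra.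
apply: (@le_trans _ _ (31 / 64 * (2 * P * (100 + K)))); last first.
  by rewrite ler_wpM2r// mulr_ge0//; lra.
have : 2 * K <= P * K by rewrite ler_wpM2r.
have : q * K <= 64^-1 * K by rewrite ler_wpM2r.
lra.
Qed.

(** Stated for two-ended sets so as to apply to an arc and to its complement. *)
Lemma arc_length_preimage_arc_le : exists2 C', 0 < C' & forall F A E C q,
  0 < C -> two_ended C A -> disc_map F -> E `<=` @unit_circle R ->
  0 < q -> q <= 64^-1 -> (forall z, cnorm z = 1 - q ^+ 2 -> cnorm (F z) <= q) ->
  arc_length (A `&` boundary_preimage F E) <=
  (arc_length A / (2 * pi) + (100 + C' * C) * q) * arc_length E.
Proof.
have [C' C'0 C'P] := mu_chord_nbhd R; exists C' => //.
move=> F A E C q C0 tA dF EC q0 q64 Fq.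
have mA := two_ended_measurable C0 tA.
have [V [W [mV mW hV muW bV]]] := preimage_hull dF EC.
have := smoothing dF mV mW hV mA q0 q64 Fq.
have mVA : measurable (V `&` [set t | A (cis t)]) by exact: measurableI.
have := @arc_length_le_mu (A `&` boundary_preimage F E) _ mVA.
have bVA : angles (A `&` boundary_preimage F E) `<=` V `&` [set t | A (cis t)].
  by move=> t [t2 [At Bt]]; split=> //; apply: bV; split.
move=> /(_ bVA).
have := C'P C A q C0 tA q0; have := mu_le_arc_length mA; move: muW.
have fin (X : set (measurableTypeR R)) : measurable X ->
    exists2 x, mu (Icc `&` X) = x%:E & 0 <= x <= 2 * pi.
  move=> mX; have h1 : (0 <= mu (Icc `&` X))%E by exact: measure_ge0.
  have h2 : (mu (Icc `&` X) <= (2 * pi)%:E)%E.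
    by rewrite -mu_Icc; apply: le_measure; rewrite ?inE//; exact: measurableII.
  case: (mu (Icc `&` X)) h1 h2 => // x; rewrite !lee_fin => x0 x2.
  by exists x => //; rewrite x0.
have [w -> /andP[w0 _]] := fin _ mW.
have [b -> /andP[b0 _]] := fin _ mA.
have [m -> /andP[m0 _]] := fin _ mVA.
have [n -> /andP[n0 _]] := fin _ (open_measurable (@open_chord_nbhd R A q)).
rewrite -EFinD -!EFinM !lee_fin => we bA nb am H.
apply: (le_trans am); apply: smoothing_bound_real H => //.
- exact: pi_ge2.
- by rewrite mulr_ge0// ltW.
- by rewrite arc_length_ge0 arc_length_le2pi.
- by rewrite n0/= (le_trans nb)// lerD2r.
- by rewrite w0.
Qed.

(** This is what the unimodular limits are for: almost every point of the circle lies in one of the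
    two preimages, and outer measure is subadditive. *)
Lemma arc_length_preimage_full F : boundary_inner F -> forall E,
  2 * pi <= arc_length (boundary_preimage F E) + arc_length (boundary_preimage F (@unit_circle R `\` E)).
Proof.
move=> [N [mN muN NP]] E.
pose X := boundary_preimage F E; pose Y := boundary_preimage F (@unit_circle R `\` E).
rewrite -lee_fin EFinD !arc_lengthE -mo_Ico.
have cover : `[0, 2 * pi[%classic `<=` (angles X `|` angles Y) `|` (N `|` [set 0]).
  move=> t t2; have [->|t0] := eqVneq t 0; first by right; right.
  have [Nt|nN] := pselect (N t); first by right; left.
  have t02 : 0 < t < 2 * pi.
    by move: t2; rewrite /= in_itv/= => /andP[t00 ->]; rewrite lt_neqAle eq_sym t0 t00.
  left; have : 0 < t < 2 * pi -> exists2 l, cnorm l = 1 & nontangential_limit F (cis t) l.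
    by apply: contrapT => h; apply: nN; apply: NP.
  move=> /(_ t02)[l /unit_circleE l1 nt]; have ct : unit_circle (cis t) by apply/unit_circleE; exact: cnorm_cis.
  have [El|nEl] := pselect (E l); first by left; split=> //; split=> //; exists l.
  by right; split=> //; split=> //; exists l.
apply: (@le_trans _ _ (mo ((angles X `|` angles Y) `|` (N `|` [set 0])))).
  exact: le_outer_measure.
apply: (le_trans (outer_measureU2 _ _ _)).
have N0 : (mo (N `|` [set 0%R]) <= 0)%E.
  apply: (le_trans (outer_measureU2 _ _ _)).
  have m0 : mo [set 0] = 0%E by have := lebesgue_measure_set1 (0 : R); exact.
  have mN0 : mo N = 0%E by exact: muN.
  by apply: (@le_trans _ _ (mo N + mo [set 0%R])%E); rewrite // m0 mN0 adde0.
apply: (@le_trans _ _ (mo (angles X `|` angles Y) + 0)%E); first exact: leeD.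
rewrite adde0; exact: outer_measureU2.
Qed.

End ArcLength.

(** * The two-sided estimate *)

Section Deviation.
Variable R : realType.
Implicit Types (F : R[i] -> R[i]) (A E : set R[i]) (q : R).

Lemma preimage_deviation : exists2 K : R, 0 < K & forall F A E q,
  disc_map F -> boundary_inner F -> F 0 = 0 ->
  circle_arc A -> E `<=` @unit_circle R -> arc_measurable E -> 0 < arc_length E ->
  0 < q -> (q <= 64^-1 -> forall z, cnorm z = 1 - q ^+ 2 -> cnorm (F z) <= q) ->
  `| arc_length (A `&` boundary_preimage F E) / arc_length E - arc_length A / (2 * pi) |
  <= K * q.
Proof.
have [C C0 CP] := arc_two_ended R; have [C' C'0 C'P] := arc_length_preimage_arc_le R.
have pi0 := @two_pi_gt0 R; have CC0 : 0 < C' * (C + 1) by rewrite mulr_gt0// addr_gt0.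
pose K := 100 + C' * (C + 1); exists K; first by rewrite addr_gt0.
move=> F A E q dF bF F0 arcA EC mE E0 q0 Fq; have tA := CP A arcA.
have mA := borel_arc_measurable (two_ended_measurable C0 tA).
have P0 := @arc_length_ge0 R (A `&` boundary_preimage F E).
have PE : arc_length (A `&` boundary_preimage F E) <= arc_length E.
  by apply: le_trans (arc_length_preimage_le dF F0 EC); apply: arc_length_le => z [[]].
have A0 := @arc_length_ge0 R A; have A2 := @arc_length_le2pi R A.
have aE : arc_length A / (2 * pi) + arc_length (~` A) / (2 * pi) = 1.
  by rewrite -mulrDl arc_lengthC// divff// gt_eqF.
have a0 : 0 <= arc_length A / (2 * pi) by rewrite divr_ge0// ltW.
have a0' : 0 <= arc_length (~` A) / (2 * pi) by rewrite divr_ge0 ?arc_length_ge0// ltW.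
rewrite ler_distl ler_pdivrMr// ler_pdivlMr//.
(* For [q > 1 / 64] the bound is trivial: both quantities lie in [[0, 1]], and [K >= 100] makes
   [K * q >= 1]. *)
have [q64|q64] := leP q 64^-1; last first.
  have : 1 <= K * q.
    have : 100 * q <= K * q by rewrite ler_pM2r// lerDl ltW.
    lra.
  move: (arc_length A / _) (arc_length (~` A) / _) (K * q) aE a0 a0' => u v k *.
  apply/andP; split; first by rewrite (le_trans _ P0)// mulr_le0_ge0 ?(ltW E0)//; lra.
  by rewrite (le_trans PE)// ler_peMl ?(ltW E0)//; lra.
have up := C'P F A E C q C0 tA dF EC q0 q64 (Fq q64).
have C10 : 0 < C + 1 by rewrite addr_gt0.
have down := C'P F (~` A) E (C + 1) q C10 (two_endedC tA) dF EC q0 q64 (Fq q64).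
(* [full], [compl] and [Esum] show that the preimage of [E] is at least as long as [E]; removing the
   part in the complement of [A], bounded by [down], leaves the lower bound. *)
have full := arc_length_preimage_full bF E.
have compl : arc_length (boundary_preimage F (@unit_circle R `\` E)) <= arc_length (~` E).
  apply: (@le_trans _ _ (arc_length (@unit_circle R `\` E))).
    by apply: arc_length_preimage_le => // z [].
  by apply: arc_length_le => z [[]].
have Esum := arc_lengthC mE.
have split_ : arc_length (boundary_preimage F E) <=
    arc_length (A `&` boundary_preimage F E) + arc_length (~` A `&` boundary_preimage F E).
  apply: arc_lengthU => z [Bz _]; have [?|?] := pselect (A z); [left|right]; by split.
have CK : 100 + C' * C <= K by rewrite lerD2l ler_pM2l// lerDl.
have {}up : arc_length (A `&` boundary_preimage F E) <=
    (arc_length A / (2 * pi) + K * q) * arc_length E.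
  by apply: (le_trans up); rewrite ler_pM2r// lerD2l ler_pM2r.
move: down up; rewrite -/K.
move: (arc_length A / _) (arc_length (~` A) / _) (K * q) aE => u v k uv.
have {uv}-> : v = 1 - u by lra.
by move=> down up; apply/andP; split=> //; lra.
Qed.

End Deviation.

Theorem theoremA (R : realType) (a : R) (a01 : 0 < a < 1) :
  exists2 K : R, 0 < K &
    forall (lam : nat -> R) (f : nat -> R[i] -> R[i]),
      (forall n, (1 <= n)%N -> a <= lam n < 1) ->
      (\prod_(1 <= i < n.+1) lam i @[n --> \oo] --> (0 : R)) ->
      (forall n, (1 <= n)%N ->
        centred_inner (f n) /\ `|derive1 (f n) 0| <= (lam n)%:C) ->
      forall n, (1 <= n)%N ->
      forall A E : set R[i],
        circle_arc A -> E `<=` @unit_circle R -> arc_measurable E ->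
        0 < arc_length E ->
        `| arc_length (A `&` boundary_preimage (iter_comp f n) E) / arc_length E
           - arc_length A / (2 * pi) |
        <= K * (\prod_(1 <= i < n.+1) lam i) `^ (6 * (a^-1 + 1))^-1.
Proof.
have a0 : 0 < a by case/andP: a01.
have [K K0 KP] := preimage_deviation R; exists K => // lam f lamP _ fP n _ A E arcA EC mE E0.
have dF := iter_comp_disc_map lamP fP n.
have /andP[L0 _] := prod_lam_bounds a0 lamP n.
have odds := iter_comp_odds a0 lamP fP n.
(* The odds dominate the modulus, as their denominator is at most [1]. *)
have odds_le z y : 0 <= y -> cnorm z < 1 ->
    cnorm (iter_comp f n z) / (1 - cnorm (iter_comp f n z)) <= y ->
    cnorm (iter_comp f n z) <= y.
  move=> y0 z1; have [_ F1] := dF z z1; rewrite ler_pdivrMr ?subr_gt0// => /le_trans; apply.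
  by rewrite ler_piMr// lerBlDr lerDl cnorm_ge0.
apply: KP => //.
- exact: iter_comp_boundary_inner lamP fP n.
(* At [z = 0] the bound on the odds is [0], so the composite fixes [0]. *)
- have z01 : cnorm (0 : R[i]) < 1 by rewrite cnorm0.
  have := odds _ z01; rewrite cnorm0 mul0r mulr0 => /(odds_le _ _ (lexx 0) z01).
  by move=> F0; apply/eqP; apply: contraTT F0; rewrite -cnorm_gt0 ltNge.
- exact: powR_gt0.
(* The factor 3 in the exponent turns the bound on the odds into [q ^ 3] times the odds of [z]. *)
- move: odds; rewrite mulrC powRrM powR_mulrn ?powR_ge0//.
  have := powR_gt0 (6 * (a^-1 + 1))^-1 L0.
  move: (_ `^ (6 * _)^-1) => q q0 odds q64 z zq.
  have q20 : 0 < q ^+ 2 by rewrite exprn_gt0.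
  have z1 : cnorm z < 1 by rewrite zq; lra.
  apply: odds_le => //; first exact: ltW.
  apply: (le_trans (odds z z1)); rewrite zq.
  have -> : q ^+ 3 * ((1 - q ^+ 2) / (1 - (1 - q ^+ 2))) = q * (1 - q ^+ 2).
    by rewrite subKr; field; rewrite gt_eqF.
  by rewrite ler_piMr ?(ltW q0)//; lra.
Qed.
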